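(* Assume $\rho>3(\tau+\lambda)$, $\rho>0$, $\beta\in[0,1)$, let $\theta=1-\beta$ and $\zeta=2\theta(\rho+\lambda\beta+\tau)+\tau+2\rho\beta^{2}\theta^{-1}$. Run the minibatch stochastic extrapolated model-based method with batch size $m\ge1$ for $K\ge 1$ iterations with $x^1=x^0\in\mathcal X$ and $$\gamma=\gamma_0\sqrt{\frac{K}{m}}+\theta^{-2}\zeta+\lambda$$ for some $\gamma_0>0$. Let $z^k=x^k+\frac{\beta}{1-\beta}(x^k-x^{k-1})$, let $\Delta=f(x^1)-\min_x f(x)$, and let $k^*$ be an index chosen uniformly at random in $\{1,2,\ldots,K\}$. Then $$\mathbb{E}[\|\nabla f_{1/\rho}(z^{k^{*}})\|^{2}]\le\frac{\rho}{\rho-\theta\lambda}\bigg[\frac{\theta^{-1}(\rho\beta+2\zeta)\Delta}{K}+ \Big(\theta\gamma_0\Delta+\frac{\rho L^2}{\theta\gamma_0}\Big)\frac{2}{\sqrt{mK}}\bigg].$$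
   Context: Setting: $\mathcal X\subseteq\mathbb R^d$ is a nonempty closed convex set, $\xi$ is a random sample with distribution $\Xi$, and $f(x)=\mathbb E_{\xi\sim\Xi}[f(x,\xi)]$ is to be minimized over $\mathcal X$; $f$ is bounded below, and $\min_x f(x)$ denotes its minimal value over $\mathcal X$. $\|\cdot\|$ is the Euclidean norm. A function $g$ is $\lambda$-weakly convex if $g+\frac{\lambda}{2}\|\cdot\|^2$ is convex. Each $f(\cdot,\xi)$ is continuous and $\mu$-weakly convex with $\mu<\lambda+\tau$. For each $x\in\mathcal X$ and $\xi$ a model function $f_x(\cdot,\xi)$ is given such that, for constants $\lambda\ge 0$, $\tau\ge 0$, $L>0$ and all $\xi\sim\Xi$: (i) for all $x\in\mathcal X$, $y\mapsto f_x(y,\xi)$ is $\lambda$-weakly convex; (ii) $f_x(x,\xi)=f(x,\xi)$ for all $x\in\mathcal X$; (iii) $|f_x(y,\xi)-f(y,\xi)|\le\frac{\tau}{2}\|x-y\|^2$ for all $x,y\in\mathcal X$; (iv) $f_x(z,\xi)-f_x(y,\xi)\le L\|z-y\|$ for all $x,y,z\in\mathcal X$. Moreau envelope: $f_{1/\rho}(x)=\min_{y\in\mathcal X}\{f(y)+\frac{\rho}{2}\|x-y\|^2\}$ for $x\in\mathbb R^d$; for the $\rho$ considered it is differentiable with $\nabla f_{1/\rho}(x)=\rho(x-\hat x)$, $\hat x=\mathrm{argmin}_{y\in\mathcal X}\{f(y)+\frac{\rho}{2}\|x-y\|^2\}$. Minibatch stochastic extrapolated model-based method: given $x^0,x^1\in\mathcal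 X$, $\beta$ and $\gamma$, for $k=1,\dots,K$ draw a fresh batch $B_k=\{\xi_{k,1},\dots,\xi_{k,m}\}$ of i.i.d. samples from $\Xi$ (independent of previous batches) and, with $f_{x}(y,B_k)=\frac1m\sum_{i=1}^m f_x(y,\xi_{k,i})$, set $$y^k=x^k+\beta(x^k-x^{k-1}),\qquad x^{k+1}=\mathrm{argmin}_{x\in\mathcal X}\Big\{f_{x^k}(x,B_k)+\frac{\gamma}{2}\|x-y^k\|^2\Big\}.$$ The index $k^*$ is independent of the samples, and the expectation is over all randomness. *)

(* Defs.v *)
From HB Require Import structures.
From mathcomp Require Export all_boot all_order all_algebra.
From mathcomp Require Export all_classical all_reals all_analysis.
Import Order.TTheory GRing.Theory Num.Theory.
Import numFieldNormedType.Exports.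

Set Implicit Arguments.
Unset Strict Implicit.
Unset Printing Implicit Defensive.

Local Open Scope classical_set_scope.
Local Open Scope ring_scope.

(* The library norm `|v| on row vectors is the sup norm; it induces the same
   topology (hence the same closed sets and derivatives) as this one. *)
Definition enorm (R : realType) (d : nat) (v : 'rV[R]_d) : R :=
  Num.sqrt (\sum_(i < d) v ord0 i ^+ 2).

Definition weakly_convex_on (R : realType) (d : nat) (X : set 'rV[R]_d)
    (lam : R) (g : 'rV[R]_d -> R) : Prop :=
  convex_function X (fun y : 'rV[R]_d => g y + lam / 2 * enorm y ^+ 2).

Definition is_argmin (V : Type) (R : realType) (X : set V) (g : V -> R) (x : V)
    : Prop :=
  X x /\ forall y, X y -> g x <= g y.

Definition gradient (R : realType) (d : nat) (g : 'rV[R]_d -> R)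
    (x : 'rV[R]_d) : 'rV[R]_d :=
  \row_(i < d) 'D_(delta_mx ord0 i) g x.

(* [moreau_env X f rho] is the envelope written f_{1/rho}. *)
Definition moreau_env (R : realType) (d : nat) (X : set 'rV[R]_d)
    (f : 'rV[R]_d -> R) (rho : R) (x : 'rV[R]_d) : R :=
  inf [set f y + rho / 2 * enorm (x - y) ^+ 2 | y in X].

Definition population (R : realType) (d : nat) (dS : measure_display)
    (S : measurableType dS) (Xi : probability S R) (F : 'rV[R]_d -> S -> R)
    (x : 'rV[R]_d) : R :=
  fine ('E_Xi[F x])%E.

Definition batch_model (R : realType) (d : nat) (S : Type)
    (fm : 'rV[R]_d -> 'rV[R]_d -> S -> R) (m : nat) (B : 'I_m -> S)
    (x y : 'rV[R]_d) : R :=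
  m%:R^-1 * \sum_(i < m) fm x y (B i).

Definition borel_rV (R : realType) (d : nat) :=
  g_sigma_algebraType (@open 'rV[R]_d).

Definition mutually_independent (R : realType) (dT dS : measure_display)
    (T : measurableType dT) (S : measurableType dS) (P : probability T R)
    (I : finType) (X : I -> T -> S) : Prop :=
  forall (J : {set I}) (A : I -> set S),
    (forall i, measurable (A i)) ->
    P (\bigcap_(i in [set` J]) X i @^-1` A i) =
    (\prod_(i in J) P (X i @^-1` A i))%E.

Definition sigma_of (dT dS : measure_display) (T : measurableType dT)
    (S : measurableType dS) (I : Type) (X : I -> T -> S) : set (set T) :=
  <<s \bigcup_i preimage_set_system setT (X i) measurable >>.

Definition independent_systems (R : realType) (dT : measure_display)
    (T : measurableType dT) (P : probability T R) (F G : set (set T)) : Prop :=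
  forall A B, F A -> G B -> P (A `&` B) = (P A * P B)%E.

(* Batches, and the iterates they produce, are numbered from 1; [x 0] and [x 1]
   are the two starting points. *)
Definition extrapolated_method (R : realType) (d : nat) (S T : Type)
    (X : set 'rV[R]_d) (fm : 'rV[R]_d -> 'rV[R]_d -> S -> R) (beta gamma : R)
    (K m : nat) (xi : nat -> 'I_m -> T -> S) (x : nat -> T -> 'rV[R]_d)
    : Prop :=
  forall (k : nat) (w : T), (1 <= k <= K)%N ->
    let y := x k w + beta *: (x k w - x k.-1 w) in
    is_argmin X
      (fun u => batch_model fm (fun i => xi k i w) (x k w) u
                + gamma / 2 * enorm (u - y) ^+ 2)
      (x k.+1 w).

Definition extrap (R : realType) (d : nat) (T : Type) (beta : R)
    (x : nat -> T -> 'rV[R]_d) (k : nat) (w : T) : 'rV[R]_d :=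
  x k w + (beta / (1 - beta)) *: (x k w - x k.-1 w).

(* Main.v *)
(* Write z for the extrapolated point, h for the proximal point of z and M(z) for the
   Moreau envelope. Testing the optimality of x^{k+1} for the (gamma - lambda)-strongly
   convex step problem at theta h + beta x^k, and the optimality of h at x^k and
   x^{k+1}, gives
     theta (rho - theta lambda + nu / 3) |h - z|^2 <= (1 + beta) (f(x^k) - f(x^{k+1}))
       + 2 c / rho (M(z^k) - M(z^{k+1})) + telescoping terms + 2 noise,
   where nu = rho - lambda - tau, c = (gamma - lambda) theta^2, and the noise compares the
   batch model with f at the new point.

   The noise is handled by stability. Adjoin a fresh sample to the batch and let x_j be
   the step computed from all of these m + 1 samples but the j-th, x_0 being the actual
   step. Exchangeability turns the expected noise into the mean of f_0(x_0) - f_0(x_j),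
   f_0 being the fresh model; weak convexity of f_0 along the mean of the x_j, strong
   convexity of the step problems, and E <x_0 - y, x_j - y> >= 0, y being the
   prox-center, bound it by (9/8) L^2 / (m s_0) with s_0 = gamma_0 sqrt(K / m). The factor
   9/8 is absorbed by the term nu / 3 above, because rho > 3 (tau + lambda). *)

Require Import Defs.
From HB Require Import structures.
From mathcomp Require Import ring lra measurable_realfun perm.
Import Order.TTheory GRing.Theory Num.Theory.
Import numFieldNormedType.Exports.

Set Implicit Arguments.
Unset Strict Implicit.
Unset Printing Implicit Defensive.

Local Open Scope classical_set_scope.
Local Open Scope ring_scope.

(** * Euclidean norm *)

(** The obstacle is the bias of the batch model at x^{k+1}, a point fitted to the batch. The points
    h and x^k are fixed before the batch is drawn, so their batch losses have the right mean; only
    the gap at x^{k+1} remains, and it has to be of order 1 / m, free of the dimension. Given the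
    samples that they share, x_0 and x_j are the same function of two independent samples of one
    law, so E <x_0 - y, x_j - y> is the mean of a squared norm. Hence E |x_0 - x_j|^2 <= 2 E |x_0 -
    y|^2, which the proximal term of the step pays for. With r = 1 / m the resulting constant is (2
    - r) (1 + r) / 2, whose maximum 9/8 is reached at m = 2. The term nu / 3 pays for a second
    excess: the differences of f telescope with the factor 1 + beta, while the claimed bound leaves
    room for beta only. X may be unbounded and the losses are merely integrable. But a minimiser of
    a Lipschitz function plus a proximal term stays at bounded distance from its center, so each
    iterate lies in a deterministic ball around x0, and losses normalised at x0 are bounded
    there. *)

Section Euclidean.
Variables (R : realType) (d : nat).
Implicit Types (u v w : 'rV[R]_d) (a t : R).

Definition dot u v : R := \sum_(i < d) u ord0 i * v ord0 i.

Lemma dotC u v : dot u v = dot v u.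
Proof. by apply: eq_bigr => i _; rewrite mulrC. Qed.

Lemma dotDl u v w : dot (u + v) w = dot u w + dot v w.
Proof. by rewrite -big_split; apply: eq_bigr => i _; rewrite !mxE mulrDl. Qed.

Lemma dotZl a u v : dot (a *: u) v = a * dot u v.
Proof. by rewrite /dot big_distrr; apply: eq_bigr => i _; rewrite !mxE -mulrA. Qed.

Lemma dotDr u v w : dot u (v + w) = dot u v + dot u w.
Proof. by rewrite !(dotC u) dotDl. Qed.

Lemma dotZr a u v : dot u (a *: v) = a * dot u v.
Proof. by rewrite !(dotC u) dotZl. Qed.

Lemma dotNl u v : dot (- u) v = - dot u v.
Proof. by rewrite -scaleN1r dotZl mulN1r. Qed.

Lemma dotNr u v : dot u (- v) = - dot u v.
Proof. by rewrite !(dotC u) dotNl. Qed.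

Definition dotE := (dotDl, dotDr, dotNl, dotNr, dotZl, dotZr).

Lemma dot_ge0 u : 0 <= dot u u.
Proof. by apply: sumr_ge0 => i _; rewrite -expr2 sqr_ge0. Qed.

Lemma enorm_sqE u : enorm u ^+ 2 = dot u u.
Proof.
rewrite /enorm sqr_sqrtr; last by apply: sumr_ge0 => i _; rewrite sqr_ge0.
by apply: eq_bigr => i _; rewrite expr2.
Qed.

Lemma enorm_ge0 u : 0 <= enorm u.
Proof. exact: sqrtr_ge0. Qed.

Lemma enorm_eqP u v : dot u u = dot v v -> enorm u = enorm v.
Proof.
move=> e; apply/eqP; rewrite -(eqrXn2 (n := 2)) ?enorm_ge0//.
by rewrite !enorm_sqE e.
Qed.

Lemma enormN u : enorm (- u) = enorm u.
Proof. by apply: enorm_eqP; rewrite !dotE opprK. Qed.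

Lemma enormB u v : enorm (u - v) = enorm (v - u).
Proof. by rewrite -enormN opprB. Qed.

Lemma enormZ a u : enorm (a *: u) = `|a| * enorm u.
Proof.
apply/eqP; rewrite -(eqrXn2 (n := 2)) ?enorm_ge0 ?mulr_ge0 ?enorm_ge0//.
by rewrite exprMn !enorm_sqE !dotE real_normK ?num_real// mulrA expr2.
Qed.

Lemma dot_le_enorm u v : dot u v <= enorm u * enorm v.
Proof.
have [v0|v0] := eqVneq (dot v v) 0.
  suff -> : dot u v = 0 by rewrite mulr_ge0 ?enorm_ge0.
  rewrite /dot big1// => i _.
  suff -> : v ord0 i = 0 by rewrite mulr0.
  move/eqP: v0; rewrite /dot psumr_eq0; last by move=> j _; rewrite -expr2 sqr_ge0.
  by move/allP => /(_ i (mem_index_enum i))/=; rewrite mulf_eq0 orbb => /eqP.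
have vp : 0 < dot v v by rewrite lt_neqAle eq_sym v0 dot_ge0.
apply: le_trans (ler_norm _) _.
rewrite -(@ler_pXn2r _ 2)//.
- rewrite real_normK ?num_real// exprMn !enorm_sqE.
  have := dot_ge0 (dot v v *: u - dot u v *: v).
  rewrite [X in 0 <= X](_ : _ = dot v v * (dot u u * dot v v - dot u v ^+ 2)).
    by rewrite pmulr_rge0// subr_ge0.
  by rewrite !dotE (dotC v u); ring.
- by rewrite nnegrE mulr_ge0 ?enorm_ge0.
Qed.

Lemma enormD u v : enorm (u + v) <= enorm u + enorm v.
Proof.
rewrite -(@ler_pXn2r _ 2)// ?nnegrE ?addr_ge0 ?enorm_ge0//.
rewrite sqrrD !enorm_sqE !dotE (dotC v u).
have := dot_le_enorm u v; move: (dot u v) (enorm u * enorm v) => p q; lra.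
Qed.

Lemma enorm_triangle w u v : enorm (u - v) <= enorm (u - w) + enorm (w - v).
Proof. by rewrite -(subrK w u) -addrA addrK enormD. Qed.

Lemma enorm0 : enorm (0 : 'rV[R]_d) = 0.
Proof. by rewrite -(scale0r 0) enormZ normr0 mul0r. Qed.

Lemma enorm_eq0 u : enorm u = 0 -> u = 0.
Proof.
move=> u0; apply/rowP => i; rewrite mxE.
have /eqP : dot u u = 0 by rewrite -enorm_sqE u0 expr0n.
rewrite /dot psumr_eq0; last by move=> j _; rewrite -expr2 sqr_ge0.
by move/allP => /(_ i (mem_index_enum i))/=; rewrite mulf_eq0 orbb => /eqP.
Qed.

Lemma coord_le_enorm u i : `|u ord0 i| <= enorm u.
Proof.
rewrite -(@ler_pXn2r _ 2)// ?nnegrE ?enorm_ge0//.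
rewrite real_normK ?num_real// enorm_sqE /dot (bigD1 i)//= expr2 lerDl.
by apply: sumr_ge0 => j _; rewrite -expr2 sqr_ge0.
Qed.

Lemma enorm_le_coord u (M : R) : 0 <= M -> (forall i, `|u ord0 i| <= M) ->
  enorm u <= d%:R * M.
Proof.
move=> M0 uM; rewrite -(@ler_pXn2r _ 2)// ?nnegrE ?enorm_ge0 ?mulr_ge0//.
rewrite enorm_sqE /dot.
apply: (@le_trans _ _ (\sum_(i < d) M ^+ 2)).
  apply: ler_sum => i _; rewrite -expr2 -real_normK ?num_real//.
  by rewrite ler_pXn2r// ?nnegrE.
rewrite sumr_const card_ord -[leLHS]mulr_natl exprMn ler_wpM2r ?sqr_ge0//.
by rewrite expr2 -natrM ler_nat; case: d => // n; rewrite leq_pmulr.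
Qed.

Lemma mx_norm_le_enorm u : `|u| <= enorm u.
Proof.
rewrite /Num.norm/= mx_normrE; apply: bigmax_le; first exact: enorm_ge0.
by move=> [i j] _ /=; rewrite ord1 coord_le_enorm.
Qed.

Lemma enorm_le_mx_norm u : enorm u <= d%:R * `|u|.
Proof.
apply: enorm_le_coord => // i; rewrite /Num.norm/= mx_normrE.
exact: (le_bigmax _ (fun ij => `|u ij.1 ij.2|) (ord0, i)).
Qed.

Lemma dot_convex t u v : 0 <= t <= 1 ->
  dot (t *: u + (1 - t) *: v) (t *: u + (1 - t) *: v) <=
  t * dot u u + (1 - t) * dot v v.
Proof.
move=> /andP[t0 t1]; rewrite -subr_ge0.
suff -> : t * dot u u + (1 - t) * dot v v -
  dot (t *: u + (1 - t) *: v) (t *: u + (1 - t) *: v) =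
  t * (1 - t) * dot (u - v) (u - v).
  by rewrite mulr_ge0 ?dot_ge0 ?mulr_ge0 ?subr_ge0.
by rewrite !dotE (dotC v u); ring.
Qed.

End Euclidean.

(** * Weak convexity and proximal points *)

(* For negative [c] this is strong convexity. *)
Definition wcx (R : realType) (d : nat) (X : set 'rV[R]_d) (c : R)
    (g : 'rV[R]_d -> R) : Prop :=
  forall u v t, X u -> X v -> 0 <= t <= 1 ->
  g (t *: u + (1 - t) *: v) <=
  t * g u + (1 - t) * g v + c / 2 * (t * (1 - t) * dot (u - v) (u - v)).

Definition lipx (R : realType) (d : nat) (X : set 'rV[R]_d) (L : R)
    (g : 'rV[R]_d -> R) : Prop :=
  forall u v, X u -> X v -> g u - g v <= L * enorm (u - v).

Section Reals.
Variable R : realType.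
Implicit Types e s z L r t A B : R.

(** The difference of the two sides is r / 2 times (e + s) (e - s - 2 L / r): beyond this distance
    the proximal term outweighs any gain of an L-Lipschitz function. *)
Lemma quadratic_dominates L r e s : 0 < r -> 0 <= L -> 0 <= s ->
  s + 2 * L / r < e -> L * (e + s) + r / 2 * s ^+ 2 < r / 2 * e ^+ 2.
Proof.
move=> r0 L0 s0 h.
have rL : r * (L / r) = L by field; rewrite gt_eqF.
have q0 : 0 <= L / r by rewrite divr_ge0// ltW.
have {}h : s + 2 * (L / r) < e by move: h; rewrite mulrA.
rewrite -{1}rL; move: (L / r) q0 h => q q0 h.
rewrite -subr_gt0.
have -> : r / 2 * e ^+ 2 - (r * q * (e + s) + r / 2 * s ^+ 2)
  = r / 2 * ((e + s) * (e - s - 2 * q)) by field.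
rewrite pmulr_rgt0 ?divr_gt0// pmulr_rgt0; first by lra.
by lra.
Qed.

(** The limit t -> 0 in a first-order condition: an inequality divided by the step length t, with a
    factor 1 - t left over. *)
Lemma le_shrink A B : (forall t, 0 < t < 1 -> (1 - t) * B <= A) -> B <= A.
Proof.
move=> h; have [B0|B0] := lerP B 0.
  by have := h (1/2) ltac:(lra); lra.
rewrite leNgt; apply/negP => AB.
(* With this choice t (B + |A|) is half of B - A, so (1 - t) B is at least the midpoint of A and
   B. *)
pose t := (B - A) / (2 * (B + `|A|)).
have p : 0 < 2 * (B + `|A|) by rewrite mulr_gt0// ltr_wpDr.
have tE : t * (2 * (B + `|A|)) = B - A by rewrite /t mulfVK// gt_eqF.
have nA := ler_norm (- A); rewrite normrN in nA.
have tt : 0 < t < 1.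
  rewrite divr_gt0 ?subr_gt0//= ltr_pdivrMr// mul1r.
  by move: nA; move: `|A| => a; lra.
have := h _ tt; case/andP: tt; move: t tE => t tE t0 t1.
have : 0 <= t * `|A| by rewrite mulr_ge0// ltW.
move: tE; rewrite mulrDr mulrDr; rewrite mulrBl mul1r.
rewrite (mulrCA t 2) (mulrCA t 2).
move: (t * B) (t * `|A|) => x y; lra.
Qed.

End Reals.

Section Prox.
Variables (R : realType) (d : nat) (X : set 'rV[R]_d).
Implicit Types (u v w x z : 'rV[R]_d) (g h : 'rV[R]_d -> R).

Lemma wcxP lam g : weakly_convex_on X lam g -> wcx X lam g.
Proof.
move=> H u v t Xu Xv tt.
pose i : {i01 R} := Itv01 (proj1 (andP tt)) (proj2 (andP tt)).
have {H} : g (t *: u + (1 - t) *: v) + lam / 2 * enorm (t *: u + (1 - t) *: v) ^+ 2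
    <= t * (g u + lam / 2 * enorm u ^+ 2)
       + (1 - t) * (g v + lam / 2 * enorm v ^+ 2).
  exact: (H i u v (mem_set Xu) (mem_set Xv)).
rewrite !enorm_sqE.
have -> : dot (t *: u + (1 - t) *: v) (t *: u + (1 - t) *: v) =
  t * dot u u + (1 - t) * dot v v - t * (1 - t) * dot (u - v) (u - v).
  by rewrite !dotE (dotC v u); ring.
move: (g _) (g u) (g v) (dot u u) (dot v v) (dot (u - v) _) => a b c p q s.
by lra.
Qed.

Lemma wcx_le c c' g : c <= c' -> wcx X c g -> wcx X c' g.
Proof.
move=> cc H u v t Xu Xv tt; apply: le_trans (H u v t Xu Xv tt) _.
rewrite lerD2l; apply: ler_wpM2r; last by lra.
by case/andP: tt => ? ?; rewrite mulr_ge0 ?dot_ge0// mulr_ge0// subr_ge0.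
Qed.

Lemma wcx_scale c a g : 0 <= a -> wcx X c g -> wcx X (a * c) (fun u => a * g u).
Proof.
move=> a0 H u v t Xu Xv tt.
have := ler_wpM2l a0 (H u v t Xu Xv tt).
move: (g _) (g u) (g v) (t * _ * dot _ _) => p q r s.
by rewrite !mulrDr; move: a0 => _; lra.
Qed.

Lemma wcx_sum (I : Type) (s : seq I) (Pr : pred I) c (g : I -> 'rV[R]_d -> R) :
  (forall i, Pr i -> wcx X c (g i)) ->
  wcx X (\sum_(i <- s | Pr i) c) (fun u => \sum_(i <- s | Pr i) g i u).
Proof.
move=> H u v t Xu Xv tt.
have {}H i (Pi : Pr i) := H i Pi u v t Xu Xv tt.
move: (dot _ _) H => q H.
rewrite !mulr_sumr !mulr_suml -!big_split/=.
exact: ler_sum.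
Qed.

Lemma lipx_sum (I : Type) (s : seq I) (Pr : pred I) L (g : I -> 'rV[R]_d -> R) :
  (forall i, Pr i -> lipx X L (g i)) ->
  lipx X (\sum_(i <- s | Pr i) L) (fun u => \sum_(i <- s | Pr i) g i u).
Proof.
move=> H u v Xu Xv; rewrite -sumrB mulr_suml.
by apply: ler_sum => i Pi; exact: H.
Qed.

Lemma lipx_scale L a g : 0 <= a -> lipx X L g -> lipx X (a * L) (fun u => a * g u).
Proof. by move=> a0 H u v Xu Xv; rewrite -mulrBr -mulrA ler_wpM2l// H. Qed.

Lemma lipx_norm L g u v : lipx X L g -> X u -> X v ->
  `|g u - g v| <= L * enorm (u - v).
Proof.
by move=> H Xu Xv; rewrite ler_norml H// andbT lerNl opprB enormB H.
Qed.

Lemma lipx_continuous L g : lipx X L g -> {within X, continuous g}.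
Proof.
move=> H; apply/subspace_continuousP => x Xx.
apply/cvgrPdist_lt => e e0.
have L0 : 0 < `|L| * d%:R + 1 by rewrite ltr_wpDl// mulr_ge0.
near=> u.
have Xu : X u by near: u; exact: withinT.
apply: le_lt_trans (lipx_norm H Xx Xu) _.
have ux : `|x - u| < e / (`|L| * d%:R + 1).
  near: u; apply: cvg_within;
  have : \forall u \near x, `|x - u| < e / (`|L| * d%:R + 1).
    by apply: (@cvgr_dist_lt _ _ _ (nbhs x) _ (fun u => u) x); [exact: cvg_id|rewrite divr_gt0].
  by [].
apply: (@le_lt_trans _ _ ((`|L| * d%:R + 1) * `|x - u|)); last first.
  by rewrite mulrC -ltr_pdivlMr.
have := enorm_le_mx_norm (x - u); have := ler_norm L => h1 h2.
apply: (@le_trans _ _ (`|L| * enorm (x - u))).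
  by rewrite ler_wpM2r// enorm_ge0.
apply: le_trans (ler_wpM2l (normr_ge0 L) h2) _.
by rewrite mulrDl mul1r mulrA lerDl.
Unshelve. all: by end_near.
Qed.

Lemma sq_dist_lipx z r : 0 <= r ->
  lipx [set u | enorm (u - z) <= r] (2 * r) (fun u => dot (u - z) (u - z)).
Proof.
move=> r0 u v /= ur vr; rewrite -!enorm_sqE subr_sqr.
have h : enorm (u - z) - enorm (v - z) <= enorm (u - v).
  by rewrite lerBlDr; exact: enorm_triangle.
have e0 := enorm_ge0 (u - z); have e1 := enorm_ge0 (v - z).
have e2 := enorm_ge0 (u - v).
rewrite mulrC; apply: (@le_trans _ _ ((enorm (u - z) + enorm (v - z)) * enorm (u - v))).
  by rewrite ler_wpM2l// addr_ge0.
by rewrite ler_wpM2r//; lra.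
Qed.

End Prox.

Section ProxExistence.
Variables (R : realType) (d : nat) (X : set 'rV[R]_d).
Implicit Types (u v w x z : 'rV[R]_d) (g h : 'rV[R]_d -> R).

Lemma enorm_ball_closed z r : closed [set u : 'rV[R]_d | enorm (u - z) <= r].
Proof.
have c : continuous (fun u : 'rV[R]_d => enorm (u - z)).
  have H : lipx [set: 'rV[R]_d] 1 (fun u : 'rV[R]_d => enorm (u - z)).
    move=> u v _ _; rewrite mul1r lerBlDr; exact: enorm_triangle.
  by move=> x; have := lipx_continuous H (x := x); rewrite /continuous_at nbhs_subspaceT.
exact: (@preimage_closed _ _ (fun u : 'rV[R]_d => enorm (u - z))
    [set y | y <= r] (fun u _ => c u) (@closed_le _ r)).
Qed.

Lemma enorm_ball_compact z r (A : set 'rV[R]_d) : closed A ->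
  compact (A `&` [set u | enorm (u - z) <= r]).
Proof.
move=> cA; apply: bounded_closed_compact; last first.
  by apply: closedI => //; exact: enorm_ball_closed.
exists (r + enorm z); split; first exact: num_real.
move=> M rM u [_ /= ur]; apply: le_trans (mx_norm_le_enorm u) _.
rewrite -(subrK z u); apply: le_trans (enormD _ _) _.
by apply: le_trans (ltW rM); rewrite lerD2r.
Qed.

Definition prox_obj (g : 'rV[R]_d -> R) (rho : R) z u := g u + rho / 2 * dot (u - z) (u - z).

Definition is_prox g rho z x := is_argmin X (prox_obj g rho z) x.

Lemma prox_obj_far g L rho z x u : 0 < rho -> 0 <= L -> lipx X L g ->
  X x -> X u -> enorm (x - z) + 2 * L / rho < enorm (u - z) ->
  prox_obj g rho z x < prox_obj g rho z u.
Proof.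
move=> r0 L0 gL Xx Xu far; rewrite /prox_obj -!enorm_sqE.
have := quadratic_dominates r0 L0 (enorm_ge0 (x - z)) far.
have h := gL _ _ Xx Xu.
have := enorm_triangle z x u; rewrite (enormB z u) => h2.
have := ler_wpM2l L0 h2; rewrite (addrC (enorm (x - z))).
move: (L * (enorm (u - z) + _)) (_ * enorm (x - z) ^+ 2) (_ * enorm (u - z) ^+ 2).
move: (L * _) h => a h b p q; lra.
Qed.

Lemma prox_obj_lipx g L rho z r : 0 < rho -> 0 <= r -> lipx X L g ->
  lipx (X `&` [set u | enorm (u - z) <= r]) (L + rho * r) (prox_obj g rho z).
Proof.
move=> r0 rr0 gL u v [Xu ur] [Xv vr]; rewrite /prox_obj.
have := gL _ _ Xu Xv.
have := ler_wpM2l (ltW (divr_gt0 r0 (ltr0Sn R 1))) (sq_dist_lipx rr0 ur vr).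
have -> : rho / 2 * (2 * r * enorm (u - v)) = rho * r * enorm (u - v) by field.
move: (enorm (u - v)) (dot _ _) (dot _ _) (g u) (g v) => e a b p q; lra.
Qed.

(** Outside the ball of radius [r] around [z] the objective exceeds its value at [x0], so a minimum
    over the compact part of [X] is global. *)
Lemma prox_exists g L rho z : X !=set0 -> closed X -> 0 < rho -> 0 <= L ->
  lipx X L g -> exists x, is_prox g rho z x.
Proof.
move=> [x0 Xx0] cX r0 L0 gL.
pose r := enorm (x0 - z) + 2 * L / rho.
have q0 : 0 <= 2 * L / rho by rewrite divr_ge0 ?mulr_ge0// ltW.
have rr0 : 0 <= r by rewrite addr_ge0 ?enorm_ge0.
pose A := X `&` [set u | enorm (u - z) <= r].
have Ax0 : A x0 by split=> //=; rewrite /r lerDl.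
have [||| x /set_mem[Xx _] xmin] := @compact_EVT_min _ _ (prox_obj g rho z) A.
- by exists x0.
- exact: enorm_ball_compact.
- exact: lipx_continuous (prox_obj_lipx r0 rr0 gL).
exists x; split=> // u Xu.
have [ur|ru] := lerP (enorm (u - z)) r; first by apply: xmin; rewrite inE.
apply: le_trans (xmin x0 _) _; first by rewrite inE.
exact: ltW (prox_obj_far r0 L0 gL Xx0 Xu ru).
Qed.

Lemma prox_dist g L rho z x u : 0 < rho -> 0 <= L -> lipx X L g ->
  is_prox g rho z x -> X u -> enorm (x - z) <= enorm (u - z) + 2 * L / rho.
Proof.
move=> r0 L0 gL [Xx xm] Xu; rewrite leNgt; apply/negP => far.
by have := prox_obj_far r0 L0 gL Xu Xx far; rewrite ltNge xm.
Qed.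

Hypothesis Xconv : forall u v t, X u -> X v -> 0 <= t <= 1 ->
  X (t *: u + (1 - t) *: v).

(** Test minimality at t u + (1 - t) x, use the curvature of both terms along the segment, divide by
    t and let t tend to 0. The result takes the place of a subgradient optimality condition. *)
Lemma prox_growth g c rho z x u : c <= rho -> wcx X c g -> is_prox g rho z x ->
  X u -> prox_obj g rho z x + (rho - c) / 2 * dot (u - x) (u - x)
         <= prox_obj g rho z u.
Proof.
move=> cr gc [Xx xm] Xu; rewrite -lerBrDl; apply: le_shrink => t /andP[t0 t1].
have tt : 0 <= t <= 1 by rewrite !ltW.
have := xm _ (Xconv Xu Xx tt); have := gc _ _ _ Xu Xx tt; rewrite /prox_obj.
have -> : dot (t *: u + (1 - t) *: x - z) (t *: u + (1 - t) *: x - z) =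
  t * dot (u - z) (u - z) + (1 - t) * dot (x - z) (x - z)
  - t * (1 - t) * dot (u - x) (u - x).
  by rewrite !dotE (dotC x u) (dotC x z) (dotC u z); ring.
move: (g _) (g u) (g x) (dot (u - z) _) (dot (x - z) _) (dot (u - x) _).
move=> a b e p q s h1 h2.
rewrite -(ler_pM2l t0).
lra.
Qed.

Lemma prox_unique g c rho z x y : c < rho -> wcx X c g ->
  is_prox g rho z x -> is_prox g rho z y -> x = y.
Proof.
move=> cr gc px py; apply/eqP; rewrite -subr_eq0; apply/eqP.
apply: enorm_eq0; apply/eqP; rewrite -sqrf_eq0 enorm_sqE.
have := prox_growth (ltW cr) gc px (proj1 py).
have := prox_growth (ltW cr) gc py (proj1 px).
have -> : dot (y - x) (y - x) = dot (x - y) (x - y).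
  by rewrite -opprB dotNl dotNr opprK.
have := dot_ge0 (x - y); move: (dot _ _) (prox_obj _ _ _ _) (prox_obj _ _ _ _).
move=> p a b p0 h1 h2; rewrite eq_le p0 andbT.
have h : (rho - c) / 2 * p <= 0 by lra.
by rewrite -(@pmulr_rle0 _ ((rho - c) / 2)) ?divr_gt0 ?subr_gt0.
Qed.

(** Each minimiser is tested against the other by [prox_growth]. In the sum the values of [g]
    cancel, and (rho - c) |x - x'|^2 <= rho <x - x', z - z'> remains for Cauchy-Schwarz. *)
Lemma prox_lip g c rho z z' x x' : c < rho -> 0 < rho -> wcx X c g ->
  is_prox g rho z x -> is_prox g rho z' x' ->
  enorm (x - x') <= rho / (rho - c) * enorm (z - z').
Proof.
move=> cr r0 gc px py.
have := prox_growth (ltW cr) gc px (proj1 py).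
have := prox_growth (ltW cr) gc py (proj1 px).
rewrite /prox_obj => h1 h2.
have h : (rho - c) * dot (x - x') (x - x') <= rho * dot (x - x') (z - z').
  move: h1 h2; rewrite !dotE (dotC x' x) (dotC z x) (dotC z' x) (dotC z x') (dotC z' x').
  move: (g x) (g x') => a b.
  move: (dot x x) (dot x' x') (dot x x') (dot x z) (dot x z') (dot x' z) (dot x' z').
  move: (dot z z) (dot z' z') => e1 e2 e3 e4 e5 e6 e7 e8 e9 h1 h2.
  lra.
have s0 : 0 < rho - c by rewrite subr_gt0.
have [e0|e0] := eqVneq (enorm (x - x')) 0.
  by rewrite e0 mulr_ge0 ?enorm_ge0// divr_ge0// ltW.
have ep : 0 < enorm (x - x') by rewrite lt_neqAle eq_sym e0 enorm_ge0.
rewrite mulrAC ler_pdivlMr// -(ler_pM2l ep) mulrA -expr2 mulrC enorm_sqE.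
apply: le_trans h _; rewrite [leRHS]mulrCA ler_wpM2l ?(ltW r0)//.
exact: dot_le_enorm.
Qed.

End ProxExistence.

(** * Lipschitz bounds from local ones, and Jensen's inequality under weak convexity *)

Section Lipschitz.
Variables (R : realType) (d : nat) (X : set 'rV[R]_d).
Implicit Types (u v w x z : 'rV[R]_d) (g h : 'rV[R]_d -> R).

Lemma convex_setP : convex_set X -> forall u v (t : R), X u -> X v -> 0 <= t <= 1 ->
  X (t *: u + (1 - t) *: v).
Proof.
move=> Xc u v t Xu Xv tt.
pose i : {i01 R} := Itv01 (proj1 (andP tt)) (proj2 (andP tt)).
exact: (set_mem (Xc u v i (mem_set Xu) (mem_set Xv))).
Qed.

Hypothesis Xconv : forall u v (t : R), X u -> X v -> 0 <= t <= 1 ->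
  X (t *: u + (1 - t) *: v).

(** Cut the segment into n + 1 equal pieces: the linear terms add up unchanged, the quadratic ones
    total tau / 2 e^2 / (n + 1) and vanish in the limit. A Lipschitz model that is accurate up to a
    quadratic controls the loss in this local form only. *)
Lemma lipx_of_local g L tau : 0 <= tau ->
  (forall u v, X u -> X v ->
     g u - g v <= L * enorm (u - v) + tau / 2 * enorm (u - v) ^+ 2) ->
  lipx X L g.
Proof.
move=> tau0 H u v Xu Xv; set e := enorm (u - v).
have key n : g u - g v <= L * e + tau / 2 * e ^+ 2 * n.+1%:R^-1.
  pose N : R := n.+1%:R.
  have N0 : 0 < N by rewrite ltr0Sn.
  pose p i := (i%:R / N) *: u + (1 - i%:R / N) *: v.
  have Xp i : (i <= n.+1)%N -> X (p i).
    move=> ile; apply: Xconv => //; apply/andP; split; first by rewrite divr_ge0// ltW.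
    by rewrite ler_pdivrMr// mul1r ler_nat.
  have p1 : p n.+1 = u by rewrite /p divff ?gt_eqF// subrr scale0r addr0 scale1r.
  have p0 : p 0%N = v by rewrite /p mul0r subr0 scale0r add0r scale1r.
  have pS i : p i.+1 - p i = N^-1 *: (u - v).
    rewrite /p -natr1 (mulrDl i%:R 1) div1r opprD addrA.
    by apply/rowP => k; rewrite !mxE; ring.
  have -> : g u - g v = \sum_(0 <= i < n.+1) (g (p i.+1) - g (p i)).
    by rewrite telescope_sumr// p1 p0.
  rewrite big_mkord.
  apply: (@le_trans _ _ (\sum_(i < n.+1) (L * (N^-1 * e) + tau / 2 * (N^-1 * e) ^+ 2))).
    apply: ler_sum => i _.
    have := H _ _ (Xp i.+1 (ltn_ord i)) (Xp i (ltnW (ltn_ord i))).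
    by rewrite pS enormZ ger0_norm// invr_ge0 ltW.
  rewrite sumr_const card_ord -[leLHS]mulr_natl -/N le_eqVlt; apply/orP; left; apply/eqP.
  by field; rewrite gt_eqF.
apply/ler_addgt0Pr => eps eps0.
have c0 : 0 <= tau / 2 * e ^+ 2 by rewrite mulr_ge0 ?sqr_ge0// divr_ge0.
have [n hn] : exists n, tau / 2 * e ^+ 2 / eps < n.+1%:R.
  exists (Num.truncn (tau / 2 * e ^+ 2 / eps)).
  by rewrite truncnS_gt ?num_real.
apply: le_trans (key n) _; rewrite lerD2l.
by rewrite ler_pdivrMr ?ltr0Sn// [leRHS]mulrC -ler_pdivrMr// ltW.
Qed.

Lemma wcx_add_sq c g : wcx X c g -> wcx X 0 (fun u => g u + c / 2 * dot u u).
Proof.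
move=> gc u v t Xu Xv tt; have := gc u v t Xu Xv tt.
have -> : dot (t *: u + (1 - t) *: v) (t *: u + (1 - t) *: v) =
  t * dot u u + (1 - t) * dot v v - t * (1 - t) * dot (u - v) (u - v).
  by rewrite !dotE (dotC v u); ring.
move: (g _) (g u) (g v) (dot u u) (dot v v) (dot (u - v) _) => a b e p q s; lra.
Qed.

Definition mean n (y : 'I_n -> 'rV[R]_d) : 'rV[R]_d := n%:R^-1 *: \sum_i y i.

Lemma meanS n (y : 'I_n.+2 -> 'rV[R]_d) :
  mean y = (n.+1%:R / n.+2%:R) *: mean (fun i => y (widen_ord (leqnSn _) i))
   + (1 - n.+1%:R / n.+2%:R) *: y ord_max.
Proof.
rewrite /mean big_ord_recr/= scalerDr scalerA; congr (_ *: _ + _ *: _).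
  by rewrite mulrAC divff ?mul1r// pnatr_eq0.
have : 0 < n.+1%:R :> R by rewrite ltr0Sn.
by rewrite -(natr1 n.+1); move: (n.+1%:R) => N N0; field; rewrite gt_eqF// addr_gt0.
Qed.

Lemma mean_in n (y : 'I_n.+1 -> 'rV[R]_d) : (forall i, X (y i)) -> X (mean y).
Proof.
elim: n y => [|n IH] y Xy; first by rewrite /mean big_ord1 invr1 scale1r.
rewrite meanS; apply: Xconv => //; first exact: IH.
by rewrite divr_ge0//= ler_pdivrMr ?ltr0Sn// mul1r ler_nat.
Qed.

Lemma jensen0 n g (y : 'I_n.+1 -> 'rV[R]_d) : wcx X 0 g -> (forall i, X (y i)) ->
  g (mean y) <= n.+1%:R^-1 * \sum_i g (y i).
Proof.
move=> gc; elim: n y => [|n IH] y Xy.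
  by rewrite /mean !big_ord1 invr1 scale1r mul1r.
rewrite meanS.
have tt : 0 <= (n.+1%:R / n.+2%:R : R) <= 1.
  apply/andP; split; first exact: divr_ge0.
  by rewrite ler_pdivrMr ?ltr0Sn// mul1r ler_nat.
have h := gc _ _ _ (mean_in (fun i => Xy (widen_ord (leqnSn _) i))) (Xy ord_max) tt.
apply: le_trans h _; rewrite mul0r mul0r addr0 big_ord_recr/= mulrDr.
apply: lerD; last first.
  rewrite le_eqVlt; apply/orP; left; apply/eqP; congr (_ * _).
  have : 0 < n.+1%:R :> R by rewrite ltr0Sn.
by rewrite -(natr1 n.+1); move: (n.+1%:R) => N N0; field; rewrite gt_eqF// addr_gt0.
have := ler_wpM2l (proj1 (andP tt)) (IH _ (fun i => Xy (widen_ord (leqnSn _) i))).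
move/le_trans; apply; rewrite mulrA le_eqVlt; apply/orP; left; apply/eqP.
by congr (_ * _); rewrite mulrAC divff ?mul1r// pnatr_eq0.
Qed.

Lemma mean_sq n (y : 'I_n.+1 -> 'rV[R]_d) u :
  n.+1%:R^-1 * \sum_i dot (u - y i) (u - y i) =
  dot (u - mean y) (u - mean y)
  + n.+1%:R^-1 * \sum_i dot (y i - mean y) (y i - mean y).
Proof.
have n0 : n.+1%:R != 0 :> R by rewrite pnatr_eq0.
have : \sum_i y i = n.+1%:R *: mean y by rewrite scalerA mulfV// scale1r.
move: (mean y) => c cE.
have dots w : \sum_i dot w (y i) = n.+1%:R * dot w c.
  have -> : n.+1%:R * dot w c = dot w (n.+1%:R *: c) by rewrite dotZr.
  rewrite -cE; elim/big_rec2 : _ => [|i a b _ ->]; last by rewrite dotDr.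
  by rewrite [RHS]big1// => i _; rewrite mxE mulr0.
have e1 w : \sum_i dot (w - y i) (w - y i) =
  n.+1%:R * (dot w w - 2 * dot w c) + \sum_i dot (y i) (y i).
  have -> : \sum_i dot (w - y i) (w - y i) =
      \sum_i ((dot w w - 2 * dot w (y i)) + dot (y i) (y i)).
    by apply: eq_bigr => i _; rewrite !dotE (dotC (y i) w); ring.
  rewrite big_split/= sumrB sumr_const card_ord -mulr_sumr dots.
  by rewrite mulrBr (mulr_natl (dot w w)) (mulrCA n.+1%:R).
have -> : \sum_i dot (y i - c) (y i - c) = \sum_i dot (c - y i) (c - y i).
  by apply: eq_bigr => i _; rewrite -opprB dotNl dotNr opprK.
rewrite !e1 !dotE (dotC c u); move: (\sum_i _) (dot u u) (dot u c) (dot c c) => p q r s.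
by field; rewrite addrC natr1.
Qed.

(** Adding c / 2 |u|^2 reduces this to the convex case; [mean_sq] at 0 identifies the correction as
    the variance of the points. *)
Lemma jensen n c g (y : 'I_n.+1 -> 'rV[R]_d) : wcx X c g -> (forall i, X (y i)) ->
  g (mean y) <= n.+1%:R^-1 * \sum_i g (y i)
    + c / 2 * (n.+1%:R^-1 * \sum_i dot (y i - mean y) (y i - mean y)).
Proof.
move=> gc Xy; have := jensen0 (wcx_add_sq gc) Xy.
have e := mean_sq y 0; rewrite sub0r dotNl dotNr opprK in e.
have e2 : \sum_i dot (0 - y i) (0 - y i) = \sum_i dot (y i) (y i).
  by apply: eq_bigr => i _; rewrite sub0r dotNl dotNr opprK.
rewrite {}e2 in e.
rewrite big_split/= -mulr_sumr mulrDr mulrCA e.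
move: (dot _ _) (g _) (_^-1 * _) (_^-1 * _) => p q r s; lra.
Qed.

End Lipschitz.

(** * Gradient of the Moreau envelope *)

Section Gradient.
Variables (R : realType) (d : nat) (X : set 'rV[R]_d).
Hypotheses (X0 : X !=set0) (Xcl : closed X).
Hypothesis Xconv : forall u v (t : R), X u -> X v -> 0 <= t <= 1 ->
  X (t *: u + (1 - t) *: v).
Variables (f : 'rV[R]_d -> R) (L c rho : R).
Hypotheses (L0 : 0 <= L) (crho : c < rho) (rho0 : 0 < rho).
Hypotheses (fL : lipx X L f) (fc : wcx X c f).

Lemma moreau_envE z x : is_prox X f rho z x -> moreau_env X f rho z = prox_obj f rho z x.
Proof.
move=> [Xx xm]; rewrite /moreau_env; set A := [set _ | _ in _].
have Ax : A (prox_obj f rho z x).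
  by exists x => //; rewrite /prox_obj enormB enorm_sqE.
have lb : lbound A (prox_obj f rho z x).
  by move=> _ [y Xy <-]; rewrite enormB enorm_sqE; exact: xm.
apply/eqP; rewrite eq_le; apply/andP; split.
  by apply: ge_inf => //; exists (prox_obj f rho z x).
by apply: lb_le_inf => //; exists (prox_obj f rho z x).
Qed.

Lemma moreau_env_le z u : X u -> moreau_env X f rho z <= prox_obj f rho z u.
Proof.
move=> Xu; have [x px] := prox_exists z X0 Xcl rho0 L0 fL.
by rewrite (moreau_envE px); apply: (proj2 px).
Qed.

(** Testing [x] in the problem at h v + z, and [x'] in the problem at z, bounds the increment from
    both sides. The bounds differ by rho h <x' - x, v>, which is of order h^2 because [prox_lip]
    makes x' - x of order h. *)
Lemma moreau_env_expansion z v x : is_prox X f rho z x -> exists2 C, 0 <= C &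
  forall h, `|moreau_env X f rho (h *: v + z) - moreau_env X f rho z
   - h * (rho * dot (z - x) v)| <= C * h ^+ 2.
Proof.
move=> px; pose e := enorm v; pose C1 := rho / (rho - c).
have C10 : 0 <= C1 by rewrite divr_ge0 ?subr_ge0// ltW.
have e0 : 0 <= e := enorm_ge0 v.
have r0 := ltW rho0.
exists (rho * C1 * e ^+ 2 + rho / 2 * e ^+ 2).
  apply: addr_ge0; apply: mulr_ge0; rewrite ?sqr_ge0//.
    exact: mulr_ge0.
  exact: divr_ge0.
move=> h; have [x' px'] := prox_exists (h *: v + z) X0 Xcl rho0 L0 fL.
have up := moreau_env_le (h *: v + z) (proj1 px).
have lo := moreau_env_le z (proj1 px').
have M' := moreau_envE px'; have M := moreau_envE px.
have vv : dot v v = e ^+ 2 by rewrite enorm_sqE.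
have dx : h * dot (x' - x) v <= C1 * e ^+ 2 * h ^+ 2.
  rewrite -dotZr; apply: le_trans (dot_le_enorm _ _) _; rewrite enormZ -/e.
  have := prox_lip Xconv crho rho0 fc px' px.
  rewrite addrK enormZ -/e -/C1 => le1.
  have := ler_wpM2r (mulr_ge0 (normr_ge0 h) e0) le1.
  move/le_trans; apply; rewrite -[h ^+ 2]real_normK ?num_real//.
  by rewrite le_eqVlt; apply/orP; left; apply/eqP; ring.
have q0 : 0 <= e ^+ 2 * h ^+ 2 by rewrite mulr_ge0 ?sqr_ge0.
have q1 : 0 <= rho * (e ^+ 2 * h ^+ 2) by rewrite mulr_ge0// ltW.
have q2 : 0 <= rho * (C1 * e ^+ 2 * h ^+ 2).
  by apply: mulr_ge0 => //; rewrite -mulrA; apply: mulr_ge0.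
have dx' := ler_wpM2l (ltW rho0) dx.
move: up lo; rewrite M' M /prox_obj.
have -> : dot (x - (h *: v + z)) (x - (h *: v + z)) =
  dot (x - z) (x - z) + 2 * h * dot (z - x) v + h ^+ 2 * e ^+ 2.
  by rewrite -vv !dotE !(dotC v) (dotC x z); ring.
have -> : dot (x' - (h *: v + z)) (x' - (h *: v + z)) =
  dot (x' - z) (x' - z) + 2 * h * dot (z - x) v - 2 * (h * dot (x' - x) v)
   + h ^+ 2 * e ^+ 2.
  by rewrite -vv !dotE !(dotC v) (dotC x' z); ring.
move: dx' q1 q2.
move: (dot (x - z) _) (dot (x' - z) _) (dot (z - x) _) (dot (x' - x) _) (f x) (f x').
move: C1 {C10 dx} => C1 a b p q fx fx' h0 h1 h2 h3 h4.
rewrite ler_norml; apply/andP; split; lra.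
Qed.

Lemma moreau_env_derive z v x : is_prox X f rho z x ->
  'D_v (moreau_env X f rho) z = rho * dot (z - x) v.
Proof.
move=> px; have [C C0 H] := moreau_env_expansion v px.
apply: cvg_lim => //; apply/cvgrPdist_lt => e e0.
near=> h.
have h0 : h != 0 by near: h; exact: nbhs_dnbhs_neq.
have hs : `|h| < e / (C + 1).
  near: h; apply: dnbhs0_lt; rewrite divr_gt0// ltr_wpDl//.
rewrite /= -[X in `|X - _|](mulKf h0) /GRing.scale/= -mulrBr normrM normfV.
have hp : 0 < `|h| by rewrite normr_gt0.
rewrite mulrC ltr_pdivrMr// distrC.
apply: le_lt_trans (H h) _.
rewrite -[h ^+ 2]real_normK ?num_real// expr2 mulrA ltr_pM2r//.
move: hs; rewrite ltr_pdivlMr ?ltr_wpDl// => hs.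
by move: hs; rewrite mulrDr mulr1 mulrC; apply: le_lt_trans; rewrite lerDl.
Unshelve. all: by end_near.
Qed.

Lemma moreau_env_gradient z x : is_prox X f rho z x ->
  gradient (moreau_env X f rho) z = rho *: (z - x).
Proof.
move=> px; apply/rowP => i; rewrite !mxE (moreau_env_derive _ px); congr (_ * _).
rewrite /dot (bigD1 i)//= big1 ?addr0 => [|j ji]; first by rewrite !mxE !eqxx mulr1.
by rewrite !mxE (negbTE ji) andbF mulr0.
Qed.

End Gradient.

(** * Measurability of minimisers *)

Section DenseSequence.
Variables (R : realType) (d : nat).
Implicit Types (u v : 'rV[R]_d).

Lemma dense_rat_vector u e : 0 < e ->
  exists p : 'rV[rat]_d, enorm (u - map_mx (@ratr R) p) < e.
Proof.
move=> e0; have D0 : 0 < d%:R + 1 :> R by rewrite ltr_wpDl.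
pose r := e / (d%:R + 1); have r0 : 0 < r by rewrite divr_gt0.
have H i : exists q : rat, `|u ord0 i - ratr q| <= r.
  have /rat_in_itvoo[q] : u ord0 i - r < u ord0 i + r by lra.
  rewrite in_itv/= => /andP[h1 h2]; exists q.
  by rewrite ler_norml; apply/andP; split; lra.
have [p hp] := choice H.
exists (\row_i p i); apply: (@le_lt_trans _ _ (d%:R * r)).
  by apply: enorm_le_coord => [|i]; [exact: ltW|rewrite !mxE].
by rewrite /r mulrCA gtr_pMr// ltr_pdivrMr// mul1r ltrDl.
Qed.

(** [X] may contain no rational point, so the sequence runs over pairs of a rational center and a
    radius 1 / (n + 1), and picks a point of [X] in that ball whenever there is one. *)
Lemma dense_sequence (X : set 'rV[R]_d) : X !=set0 ->
  exists q : nat -> 'rV[R]_d, (forall n, X (q n)) /\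
    forall u e, X u -> 0 < e -> exists n, enorm (u - q n) < e.
Proof.
move=> [x0 Xx0].
have H (a : 'rV[rat]_d * nat) : exists y, X y /\
    ((exists2 z, X z & enorm (z - map_mx (@ratr R) a.1) < a.2.+1%:R^-1) ->
      enorm (y - map_mx (@ratr R) a.1) < a.2.+1%:R^-1).
  have [[z Xz za]|no] := pselect (exists2 z, X z &
    enorm (z - map_mx (@ratr R) a.1) < a.2.+1%:R^-1); first by exists z.
  by exists x0.
have [f fP] := choice H.
exists (fun n => if unpickle n is Some a then f a else x0); split.
  by move=> n; case: unpickle => // a; case: (fP a).
move=> u e Xu e0.
have [n ne] : exists n, n.+1%:R^-1 < e / 2.
  have h : 0 < (e / 2)^-1 by rewrite invr_gt0 divr_gt0.
  exists (Num.truncn (e / 2)^-1); rewrite invf_plt ?posrE ?ltr0Sn ?divr_gt0//.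
  by rewrite truncnS_gt ?num_real.
have n0 : 0 < n.+1%:R^-1 :> R by rewrite invr_gt0 ltr0Sn.
have [p up] := dense_rat_vector u n0.
exists (pickle (p, n)); rewrite pickleK.
have [_ /(_ (ex_intro2 _ _ u Xu up))/= fp] := fP (p, n).
apply: le_lt_trans (enorm_triangle (map_mx (@ratr R) p) _ _) _.
rewrite (enormB (map_mx _ _)); move: ne up fp; move: (enorm _) (enorm _) (_^-1).
by move=> a b c; lra.
Qed.

End DenseSequence.

Lemma measurable_inf_seq (R : realType) dT (T : measurableType dT)
    (g : nat -> T -> R) (h : T -> R) :
  (forall n, measurable_fun setT (g n)) -> (forall n w, h w <= g n w) ->
  (forall w e, 0 < e -> exists n, g n w < h w + e) -> measurable_fun setT h.
Proof.
move=> mg hg gh mD; apply: (measurability _ (RGenInftyO.measurableE R)) => //.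
move=> _ [_ [a ->] <-]; rewrite setTI.
have -> : h @^-1` `]-oo, a[ = \bigcup_n (g n @^-1` `]-oo, a[).
  apply/seteqP; split => [w|w [n _]]; rewrite /= !in_itv/=; last exact: le_lt_trans.
  rewrite -subr_gt0 => /(gh w)[n]; rewrite addrC subrK => gn.
  by exists n => //=; rewrite in_itv.
apply: bigcup_measurable => n _; rewrite -[X in measurable X]setTI.
by apply: mg => //; exact: measurable_itv.
Qed.

(** Coordinatewise measurability suits sums, norms and infima; [mvec_borel] converts it to the Borel
    sigma-algebra in which measurability of the models is phrased. *)
Definition mvec (R : realType) (d : nat) dT (T : measurableType dT)
    (U : T -> 'rV[R]_d) : Prop :=
  forall i, measurable_fun setT (fun w => U w ord0 i).

Section MeasurableVectors.
Variables (R : realType) (d : nat) (dT : measure_display) (T : measurableType dT).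
Implicit Types (U V : T -> 'rV[R]_d) (X : set 'rV[R]_d).

Lemma measurable_sumR (I : Type) (s : seq I) (Pr : pred I) (g : I -> T -> R) :
  (forall i, Pr i -> measurable_fun setT (g i)) ->
  measurable_fun setT (fun w => \sum_(i <- s | Pr i) g i w).
Proof.
move=> mg; elim: s => [|i s IH].
  by under eq_fun do rewrite big_nil; exact: measurable_cst.
under eq_fun do rewrite big_cons.
by case Pi: (Pr i) => //; apply: measurable_funD => //; exact: mg.
Qed.

Lemma mvec_cst (u : 'rV[R]_d) : mvec (fun _ : T => u).
Proof. by move=> i; exact: measurable_cst. Qed.

Lemma mvecD U V : mvec U -> mvec V -> mvec (fun w => U w + V w).
Proof.
by move=> mU mV i; under eq_fun do rewrite mxE; exact: measurable_funD.
Qed.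

Lemma mvecZ (a : R) U : mvec U -> mvec (fun w => a *: U w).
Proof.
move=> mU i; under eq_fun do rewrite mxE.
by apply: measurable_funM => //; exact: measurable_cst.
Qed.

Lemma mvecB U V : mvec U -> mvec V -> mvec (fun w => U w - V w).
Proof.
move=> mU mV i; under eq_fun do rewrite mxE [X in _ + X]mxE.
exact: measurable_funB.
Qed.

Lemma measurable_dot U V : mvec U -> mvec V ->
  measurable_fun setT (fun w => dot (U w) (V w)).
Proof. by move=> mU mV; apply: measurable_sumR => i _; exact: measurable_funM. Qed.

Lemma measurable_sqrt (f : T -> R) : measurable_fun setT f ->
  measurable_fun setT (fun w => Num.sqrt (f w)).
Proof.
have ms : measurable_fun [set: R] (@Num.sqrt R).
  exact: (continuous_measurable_fun (@sqrt_continuous R)).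
exact: measurableT_comp ms.
Qed.

Lemma measurable_enorm U : mvec U -> measurable_fun setT (fun w => enorm (U w)).
Proof.
move=> mU; apply: measurable_sqrt; apply: measurable_sumR => i _.
exact: measurable_funX.
Qed.

Lemma mvec_borel U : mvec U -> measurable_fun setT (U : T -> borel_rV R d).
Proof.
move=> mU mD; apply: (measurability _ (erefl : @measurable _ (borel_rV R d) = _)) => //.
move=> _ [A oA <-]; rewrite setTI.
have [|q [_ qd]] := @dense_sequence R d setT; first by exists 0.
pose good k n := [set u | enorm (u - q k) < n.+1%:R^-1] `<=` A.
have -> : U @^-1` A =
    \bigcup_k \bigcup_(n in good k) [set w | enorm (U w - q k) < n.+1%:R^-1].
  apply/seteqP; split => [w Aw|w [k _] [n gn] /= wa]; last exact: gn.
  have /nbhs_normP[e /= e0 eA] := oA _ Aw.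
  have [n ne] : exists n, n.+1%:R^-1 < e / 2.
    have h : 0 < (e / 2)^-1 by rewrite invr_gt0 divr_gt0.
    exists (Num.truncn (e / 2)^-1); rewrite invf_plt ?posrE ?ltr0Sn ?divr_gt0//.
    by rewrite truncnS_gt ?num_real.
  have n0 : 0 < n.+1%:R^-1 :> R by rewrite invr_gt0 ltr0Sn.
  have [k kw] := qd (U w) _ I n0.
  exists k => //; exists n => //= u /= uq; apply: eA => /=.
  apply: le_lt_trans (mx_norm_le_enorm _) _.
  apply: le_lt_trans (enorm_triangle (q k) _ _) _.
  rewrite (enormB (q k)); move: ne kw uq; move: (enorm _) (enorm _) (_^-1).
  by move=> a b c; lra.
apply: bigcup_measurable => k _; apply: bigcup_measurable => n _.
have -> : [set w | enorm (U w - q k) < n.+1%:R^-1] =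
    (fun w => enorm (U w - q k)) @^-1` `]-oo, n.+1%:R^-1[.
  by apply/seteqP; split => w /=; rewrite in_itv.
rewrite -[X in measurable X]setTI.
have me := measurable_enorm (mvecB mU (mvec_cst (q k))).
by apply: me => //; exact: measurable_itv.
Qed.

(* [h w (U w)] is the infimum of [h w (q n) + L * enorm (U w - q n)] over a dense
   sequence [q] of [X]. *)
Lemma measurable_lipx_comp X L (h : T -> 'rV[R]_d -> R) U : X !=set0 ->
  (forall w, lipx X L (h w)) -> (forall u, X u -> measurable_fun setT (h ^~ u)) ->
  mvec U -> (forall w, X (U w)) -> measurable_fun setT (fun w => h w (U w)).
Proof.
move=> X0 hL mh mU XU; have [q [Xq qd]] := dense_sequence X0.
apply: (@measurable_inf_seq _ _ _ (fun n w => h w (q n) + L * enorm (U w - q n))).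
- move=> n; apply: measurable_funD; first exact: mh.
  apply: measurable_funM; first exact: measurable_cst.
  by apply: measurable_enorm; apply: mvecB => //; exact: mvec_cst.
- by move=> n w; rewrite -lerBlDl; exact: hL.
move=> w e e0; have D0 : 0 < 2 * `|L| + 1 by rewrite ltr_wpDl// mulr_ge0.
have [n hn] := qd (U w) _ (XU w) (divr_gt0 e0 D0); exists n.
have := hL w _ _ (Xq n) (XU w); rewrite (enormB (q n)) => h1.
have h2 : L * enorm (U w - q n) <= `|L| * enorm (U w - q n).
  by rewrite ler_wpM2r ?enorm_ge0// ler_norm.
have h3 : enorm (U w - q n) * (2 * `|L| + 1) < e by rewrite -ltr_pdivlMr.
have h4 := enorm_ge0 (U w - q n).
move: h1 h2 h3 h4; move: (enorm _) (`|L|) (h w _) (h w _) => a b p r.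
move: (L * a) => La; lra.
Qed.

(* Strong convexity bounds the distance from [q n] to the minimiser by a multiple
   of the square root of the excess objective, so each coordinate of the
   minimiser is an infimum over [n] of measurable functions. *)
Lemma mvec_prox X L c rho (h : T -> 'rV[R]_d -> R) z x : X !=set0 ->
  (forall u v (t : R), X u -> X v -> 0 <= t <= 1 -> X (t *: u + (1 - t) *: v)) ->
  0 <= L -> c < rho -> 0 < rho ->
  (forall w, lipx X L (h w)) -> (forall w, wcx X c (h w)) ->
  (forall u, X u -> measurable_fun setT (h ^~ u)) -> mvec z ->
  (forall w, is_prox X (h w) rho (z w) (x w)) -> mvec x.
Proof.
move=> X0 Xconv L0 cr r0 hL hc mh mz px; have [q [Xq qd]] := dense_sequence X0.
pose G n w := prox_obj (h w) rho (z w) (q n).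
have mG n : measurable_fun setT (G n).
  apply: measurable_funD; first exact: mh.
  apply: measurable_funM; first exact: measurable_cst.
  by apply: measurable_dot; apply: mvecB => //; exact: mvec_cst.
pose m w := prox_obj (h w) rho (z w) (x w).
have mG_le n w : m w <= G n w by apply: (proj2 (px w)).
have approx w e : 0 < e -> exists n, G n w < m w + e /\ enorm (x w - q n) < e.
  move=> e0; pose r := enorm (x w - z w) + 1.
  have rr0 : 0 <= r by rewrite addr_ge0 ?enorm_ge0.
  pose K := L + rho * r; have K0 : 0 <= K by rewrite addr_ge0 ?mulr_ge0// ltW.
  have D0 : 0 < K + 1 by rewrite ltr_wpDl.
  (* The entry 1 keeps [q n] in the ball of radius [r], where the objective is [K]-Lipschitz; the
     last entry then keeps its excess below [e]. *)
  have m0 : 0 < Num.min 1 (Num.min e (e / (K + 1))).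
    by rewrite !lt_min ltr01 e0 divr_gt0.
  have [n] := qd (x w) _ (proj1 (px w)) m0.
  rewrite !lt_min => /and3P[h1 h2 h3]; exists n; split=> //.
  have qr : enorm (q n - z w) <= r.
    apply: le_trans (enorm_triangle (x w) _ _) _.
    by rewrite (enormB (q n)) addrC lerD2l ltW.
  have xr : enorm (x w - z w) <= r by rewrite lerDl.
  have := prox_obj_lipx r0 rr0 (hL w) (conj (Xq n) qr) (conj (proj1 (px w)) xr).
  rewrite -/(G n w) -/(m w) -/K (enormB (q n)) => le1.
  rewrite addrC -ltrBlDr; apply: le_lt_trans le1 _.
  move: h3; rewrite ltr_pdivlMr// mulrDr mulr1 mulrC; apply: le_lt_trans.
  by rewrite lerDl enorm_ge0.
have mm : measurable_fun setT m.
  apply: (@measurable_inf_seq _ _ _ G) => // w e e0.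
  by have [n [h1 _]] := approx w e e0; exists n.
move=> i.
have C0 : 0 < 2 / (rho - c) by rewrite divr_gt0 ?subr_gt0.
apply: (@measurable_inf_seq _ _ _
  (fun n w => q n ord0 i + Num.sqrt (2 / (rho - c) * (G n w - m w)))).
- move=> n; apply: measurable_funD; first exact: measurable_cst.
  apply: measurable_sqrt; apply: measurable_funM; first exact: measurable_cst.
  exact: measurable_funB.
- move=> n w; rewrite -lerBlDl.
  have := coord_le_enorm (x w - q n) i; rewrite !mxE.
  move/(le_trans (ler_norm _))/le_trans; apply.
  rewrite -[enorm _]ger0_norm ?enorm_ge0// -sqrtr_sqr ler_wsqrtr//.
  have := prox_growth Xconv (ltW cr) (hc w) (px w) (Xq n).
  rewrite -/(G n w) -/(m w) enormB enorm_sqE => h1.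
  rewrite mulrAC ler_pdivlMr ?subr_gt0//.
  by move: h1; move: (dot _ _) => D; lra.
move=> w e e0.
(* The first entry bounds the coordinate error, the second makes the square root of the rescaled
   excess at most [e / 2]. *)
have m0 : 0 < Num.min (e / 2) ((rho - c) / 2 * (e / 2) ^+ 2).
  by rewrite lt_min !mulr_gt0 ?subr_gt0 ?exprn_gt0 ?divr_gt0.
have [n [h1 h2]] := approx w _ m0; exists n.
have h3 : q n ord0 i <= x w ord0 i + enorm (x w - q n).
  have := coord_le_enorm (q n - x w) i; rewrite !mxE enormB.
  by move=> hh; have := le_trans (ler_norm _) hh; lra.
have h4 : Num.sqrt (2 / (rho - c) * (G n w - m w)) <= e / 2.
  rewrite -[leRHS]ger0_norm ?divr_ge0 ?(ltW e0)// -sqrtr_sqr ler_wsqrtr//.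
  rewrite mulrAC ler_pdivrMr ?subr_gt0//.
  by move: h1; rewrite addrC -ltrBlDr lt_min => /andP[_]; move: (_ ^+ 2) => D; lra.
move: h2; rewrite lt_min => /andP[h5 _].
lra.
Qed.

End MeasurableVectors.

(** * Expectations of bounded functions and independence *)

(** Boundedness makes integrability automatic, and the class is stable under products and partial
    integration. *)
Definition bmf (R : realType) dT (T : measurableType dT) (f : T -> R) : Prop :=
  measurable_fun setT f /\ exists M, forall w, `|f w| <= M.

Definition ER (R : realType) dT (T : measurableType dT) (P : probability T R)
  (f : T -> R) : R := Rintegral P setT f.

Section BoundedMeasurable.
Variables (R : realType) (dT : measure_display) (T : measurableType dT).
Implicit Types f g : T -> R.

Lemma bmf_cst (a : R) : bmf (fun _ : T => a).
Proof. by split; [exact: measurable_cst|exists `|a|]. Qed.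

Lemma bmfD f g : bmf f -> bmf g -> bmf (fun w => f w + g w).
Proof.
move=> [mf [M fM]] [mg [N gN]]; split; first exact: measurable_funD.
by exists (M + N) => w; apply: le_trans (ler_normD _ _) _; exact: lerD.
Qed.

Lemma bmfM f g : bmf f -> bmf g -> bmf (fun w => f w * g w).
Proof.
move=> [mf [M fM]] [mg [N gN]]; split; first exact: measurable_funM.
by exists (M * N) => w; rewrite normrM; exact: ler_pM.
Qed.

Lemma bmfZ a f : bmf f -> bmf (fun w => a * f w).
Proof. by move=> bf; apply: bmfM => //; exact: bmf_cst. Qed.

Lemma bmfN f : bmf f -> bmf (fun w => - f w).
Proof.
move=> [mf [M fM]]; split; first exact: measurable_funN.
by exists M => w; rewrite normrN.
Qed.

Lemma bmfB f g : bmf f -> bmf g -> bmf (fun w => f w - g w).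
Proof. by move=> bf /bmfN; exact: bmfD. Qed.

Lemma bmf_sum (I : Type) (s : seq I) (Pr : pred I) (F : I -> T -> R) :
  (forall i, bmf (F i)) -> bmf (fun w => \sum_(i <- s | Pr i) F i w).
Proof.
move=> bF; elim: s => [|i s IH].
  by under eq_fun do rewrite big_nil; exact: bmf_cst.
under eq_fun do rewrite big_cons; case: (Pr i) => //.
exact: bmfD.
Qed.

Lemma bmf_comp dS (S : measurableType dS) (X : S -> T) f :
  measurable_fun setT X -> bmf f -> bmf (fun s => f (X s)).
Proof.
by move=> mX [mf [M fM]]; split; [exact: measurableT_comp|exists M => s].
Qed.

Variable P : probability T R.

Lemma bmf_integrable f : bmf f -> P.-integrable setT (EFin \o f).
Proof.
move=> [mf [M fM]]; apply: measurable_bounded_integrable => //.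
  exact: le_lt_trans (probability_le1 P measurableT) (ltry 1).
exists M; split; first exact: num_real.
by move=> x Mx w _; apply: le_trans (fM w) (ltW Mx).
Qed.

Lemma ERE f : bmf f -> ((ER P f)%:E = \int[P]_w (f w)%:E)%E.
Proof.
by move=> bf; rewrite fineK//; apply: integrable_fin_num => //; exact: bmf_integrable.
Qed.

Lemma ER_cst a : ER P (fun _ => a) = a.
Proof.
transitivity (a * fine (P setT)); first exact: Rintegral_cst.
by rewrite probability_setT mulr1. Qed.

Lemma ER_D f g : bmf f -> bmf g -> ER P (fun w => f w + g w) = ER P f + ER P g.
Proof. by move=> bf bg; rewrite /ER RintegralD//; exact: bmf_integrable. Qed.

Lemma ER_B f g : bmf f -> bmf g -> ER P (fun w => f w - g w) = ER P f - ER P g.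
Proof. by move=> bf bg; rewrite /ER RintegralB//; exact: bmf_integrable. Qed.

Lemma ER_Z a f : bmf f -> ER P (fun w => a * f w) = a * ER P f.
Proof. by move=> bf; rewrite /ER RintegralZl//; exact: bmf_integrable. Qed.

Lemma ER_sum (I : Type) (s : seq I) (Pr : pred I) (F : I -> T -> R) :
  (forall i, bmf (F i)) ->
  ER P (fun w => \sum_(i <- s | Pr i) F i w) = \sum_(i <- s | Pr i) ER P (F i).
Proof.
move=> bF; elim: s => [|i s IH].
  by rewrite big_nil; under eq_fun do rewrite big_nil; exact: ER_cst.
rewrite big_cons; under eq_fun do rewrite big_cons.
case: (Pr i) => //.
by rewrite ER_D ?IH//; exact: bmf_sum.
Qed.

Lemma ER_le f g : bmf f -> bmf g -> (forall w, f w <= g w) -> ER P f <= ER P g.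
Proof. by move=> bf bg fg; apply: le_Rintegral => //; exact: bmf_integrable. Qed.

Lemma ER_ge0 f : (forall w, 0 <= f w) -> 0 <= ER P f.
Proof. by move=> f0; apply: Rintegral_ge0. Qed.

Lemma ER_bound f M : bmf f -> (forall w, `|f w| <= M) -> `|ER P f| <= M.
Proof.
move=> bf fM; rewrite ler_norml -[M](ER_cst M) -mulN1r -ER_Z; last exact: bmf_cst.
apply/andP; split; apply: ER_le => //; try exact: bmfZ (bmf_cst _); try exact: bmf_cst.
  by move=> w; rewrite mulN1r; have := fM w; rewrite ler_norml => /andP[].
by move=> w; have := fM w; rewrite ler_norml => /andP[].
Qed.

End BoundedMeasurable.

(** * Fubini's theorem, and freezing an independent variable *)

Section FubiniBounded.
Variables (R : realType) (d1 d2 : measure_display).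
Variables (T1 : measurableType d1) (T2 : measurableType d2).
Variables (P1 : probability T1 R) (P2 : probability T2 R).

Lemma bmf_section1 (f : T1 * T2 -> R) (x : T1) : bmf f -> bmf (fun y => f (x, y)).
Proof.
move=> bf; apply: (bmf_comp (X := fun y => (x, y)) _ bf); exact: pair1_measurable.
Qed.

Lemma bmf_ER1 (f : T1 * T2 -> R) : bmf f -> bmf (fun x => ER P2 (fun y => f (x, y))).
Proof.
move=> bf; split; last first.
  have [_ [M fM]] := bf; exists M => x; apply: ER_bound => //; exact: bmf_section1.
have := measurable_fubini_F (bmf_integrable (P1 \x P2)%E bf).
move=> mF; have -> : (fun x => ER P2 (fun y => f (x, y))) =
    fine \o fubini_F P2 (EFin \o f) by [].
by apply: measurableT_comp mF; exact: fine_measurable.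
Qed.

Lemma ER_fubini1 (f : T1 * T2 -> R) : bmf f ->
  ER (P1 \x P2)%E f = ER P1 (fun x => ER P2 (fun y => f (x, y))).
Proof.
move=> bf; have ifx := bmf_integrable (P1 \x P2)%E bf.
rewrite {1}/ER /Rintegral -(integral12_prod_meas1 ifx) /ER /Rintegral.
congr fine; apply: eq_integral => x _.
exact/esym/(ERE P2 (bmf_section1 x bf)).
Qed.

Lemma ER_fubini (f : T1 * T2 -> R) : bmf f ->
  ER P1 (fun x => ER P2 (fun y => f (x, y))) =
  ER P2 (fun y => ER P1 (fun x => f (x, y))).
Proof.
move=> bf; have ifx := bmf_integrable (P1 \x P2)%E bf.
rewrite -ER_fubini1// {1}/ER /Rintegral -(integral21_prod_meas1 ifx) /ER /Rintegral.
congr fine; apply: eq_integral => y _; apply/esym/ERE.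
apply: (bmf_comp (X := fun x => (x, y)) _ bf); exact: pair2_measurable.
Qed.

End FubiniBounded.

(* [X] is independent of the sigma-algebra generated by [G] and has law [nu]. *)
Section Freeze.
Variables (R : realType) (dT dS : measure_display).
Variables (T : measurableType dT) (S : measurableType dS).
Variables (P : probability T R) (nu : probability S R).
Variables (G : set (set T)) (X : T -> S).
Hypotheses (Gm : G `<=` @measurable _ T) (GI : setI_closed G) (GT : G setT).
Hypothesis mX : measurable_fun setT X.
Hypothesis GX : forall A B, G A -> measurable B ->
  P (A `&` X @^-1` B) = (P A * nu B)%E.

Local Notation T' := (g_sigma_algebraType G).

Lemma sub_sigma_measurable dY (Y : measurableType dY) (f : T -> Y) :
  measurable_fun setT (f : T' -> Y) -> measurable_fun setT f.
Proof.
move=> mf mD B mB; have := mf measurableT B mB.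
apply: smallest_sub => //; exact: sigma_algebra_measurable.
Qed.

Lemma sub_sigma_bmf (f : T -> R) : bmf (f : T' -> R) -> bmf f.
Proof. by move=> [mf bf]; split => //; exact: sub_sigma_measurable. Qed.

Lemma measurable_sub_sigma_id : measurable_fun setT (fun w : T => w : T').
Proof. exact: sub_sigma_measurable (@measurable_id _ T' setT). Qed.

Let idT : T -> T' := fun w => w.

Let mid : measurable_fun setT idT := measurable_sub_sigma_id.

Let pr : T -> T' * S := fun w => (idT w, X w).

Let mpr : measurable_fun setT pr.
Proof. exact: measurable_fun_pair. Qed.

Let idM : {mfun T >-> T'} := HB.pack idT (isMeasurableFun.Build _ _ _ _ idT mid).
Let prM : {mfun T >-> (T' * S)%type} :=
  HB.pack pr (isMeasurableFun.Build _ _ _ _ pr mpr).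

(** Independence is given on the pi-system [G]. For fixed [B] both sides are finite measures in [A],
    so their agreement extends to the sigma-algebra that [G] generates. *)
Lemma freeze_rect (A : set T') B : measurable A -> measurable B ->
  P (A `&` X @^-1` B) = (P A * nu B)%E.
Proof.
move=> mA mB.
have mXB : measurable (X @^-1` B) by rewrite -[X in measurable X]setTI; exact: mX.
have n0 : (0 <= nu B)%E by [].
have nf : nu B \is a fin_num by rewrite fin_num_measure.
pose c : {nonneg R} := NngNum (fine_ge0 n0).
have [m1 m1E] : exists m : {measure set T' -> \bar R},
    forall C, m C = P (C `&` X @^-1` B).
  unshelve (refine (ex_intro _ (pushforward (mrestr P mXB) idT : measure T' R) _)).
    exact: mid.
  by [].
have [m2 m2E] : exists m : {measure set T' -> \bar R}, forall C, m C = (P C * nu B)%E.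
  unshelve (refine (ex_intro _
    (mscale c (pushforward P idT : measure T' R) : measure T' R) _)).
    exact: mid.
  by move=> C; rewrite /= /mscale/= fineK// muleC.
rewrite -m1E -m2E; apply: (@measure_unique _ R T' G (fun=> setT) erefl GI (fun=> GT) _ m1 m2 _ _ A mA).
- by rewrite bigcup_const//; exists 0%N.
- by move=> C GC; rewrite m1E m2E; exact: GX.
- move=> k; rewrite m1E setTI.
  exact: le_lt_trans (probability_le1 P mXB) (ltry 1).
Qed.

Lemma bmf_freeze (f : T' * S -> R) : bmf f -> bmf (fun w => f (w, X w)).
Proof. by move=> bf; exact: (bmf_comp mpr bf). Qed.

(** By [freeze_rect] the pair of the identity into [T'] and [X] has a product law, so Fubini
    integrates [X] out with the first coordinate frozen. Measurability on [T'], which is [T] with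
    the coarser sigma-algebra, does the work of conditioning. *)
Lemma ER_freeze (f : T' * S -> R) : bmf f ->
  ER P (fun w => f (w, X w)) = ER P (fun w => ER nu (fun s => f (w, s))).
Proof.
move=> bf; pose P' : probability T' R := distribution P idM.
have e (g : T' -> R) : bmf g -> ER P g = ER P' g.
  move=> bg; rewrite /ER /Rintegral; congr fine; apply/esym.
  rewrite (@integral_distribution _ _ _ _ _ P idM)//.
    by apply/measurable_EFinP; case: bg.
  by apply: bmf_integrable; exact: sub_sigma_bmf.
rewrite (e (fun w => ER nu (fun s => f (w, s)))); last exact: (bmf_ER1 P').
rewrite -(ER_fubini1 P' nu bf).
have mf : measurable_fun setT (EFin \o f) by apply/measurable_EFinP; case: bf.
rewrite /ER /Rintegral; congr fine.
transitivity (\int[distribution P prM]_x (f x)%:E)%E.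
  rewrite (@integral_distribution _ _ _ _ _ P prM)//.
  by apply: bmf_integrable; exact: bmf_freeze.
apply: eq_measure_integral => A mA _; apply/esym.
apply: product_measure_unique => // B C mB mC.
exact: freeze_rect.
Qed.

End Freeze.

Section FreezeGhost.
Variables (R : realType) (dT dS : measure_display).
Variables (T : measurableType dT) (S : measurableType dS).
Variables (P : probability T R) (nu : probability S R).
Variables (G : set (set T)) (X : T -> S).
Hypotheses (Gm : G `<=` @measurable _ T) (GI : setI_closed G) (GT : G setT).
Hypothesis mX : measurable_fun setT X.
Hypothesis GX : forall A B, G A -> measurable B ->
  P (A `&` X @^-1` B) = (P A * nu B)%E.

Local Notation T' := (g_sigma_algebraType G).
Local Notation Q := (P \x nu)%E.

Lemma ER_fst (g : T -> R) : bmf g -> ER Q (fun p => g p.1) = ER P g.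
Proof.
move=> bg; rewrite ER_fubini1; last exact: bmf_comp measurable_fst bg.
by congr ER; apply/funext => w /=; rewrite ER_cst.
Qed.

Lemma measurable_freeze_ghost1 :
  measurable_fun setT (fun p : T * S => ((p.1 : T', X p.1), p.2)).
Proof.
apply: measurable_fun_pair; last exact: measurable_snd.
apply: measurable_fun_pair; last exact: measurableT_comp mX measurable_fst.
exact: measurableT_comp (measurable_sub_sigma_id Gm) measurable_fst.
Qed.

Lemma measurable_freeze_ghost2 :
  measurable_fun setT (fun p : T * S => ((p.1 : T', p.2), X p.1)).
Proof.
apply: measurable_fun_pair; last exact: measurableT_comp mX measurable_fst.
apply: measurable_fun_pair; last exact: measurable_snd.
exact: measurableT_comp (measurable_sub_sigma_id Gm) measurable_fst.
Qed.

(** Given [G], the variable [X] and the second coordinate are independent of common law [nu]: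
    freezing [X] turns both sides into double integrals over [nu], which Fubini exchanges. *)
Lemma ER_freeze_swap (f : T' * S * S -> R) : bmf f ->
  ER Q (fun p => f ((p.1, X p.1), p.2)) = ER Q (fun p => f ((p.1, p.2), X p.1)).
Proof.
move=> bf.
rewrite ER_fubini1; last exact: (bmf_comp measurable_freeze_ghost1 bf).
rewrite [RHS]ER_fubini1; last exact: (bmf_comp measurable_freeze_ghost2 bf).
have P'm : bmf (fun q : T' * S => ER nu (fun s => f (q, s))).
  split; last first.
    have [_ [M fM]] := bf; exists M => q; apply: ER_bound => //; exact: bmf_section1.
  (* [bmf_ER1] is stated for a probability on the first factor; only measurability is at stake, so a
     Dirac mass will do. *)
  have pr : probability (T' * S)%type R by exact: (dirac point).
  by have [] := bmf_ER1 pr nu bf.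
have msw : measurable_fun setT (fun q : T' * S * S => ((q.1.1, q.2), q.1.2)).
  apply: measurable_fun_pair.
    apply: measurable_fun_pair; last exact: measurable_snd.
    exact: measurableT_comp measurable_fst measurable_fst.
  exact: measurableT_comp measurable_snd measurable_fst.
have bg : bmf (fun q : T' * S * S => f ((q.1.1, q.2), q.1.2)) := bmf_comp msw bf.
have P'g : bmf (fun q : T' * S => ER nu (fun s => f ((q.1, s), q.2))).
  split; last first.
    have [_ [M fM]] := bg; exists M => q; apply: ER_bound => //.
      exact: (bmf_section1 q bg).
    by move=> s; exact: (fM (q, s)).
  have pr : probability (T' * S)%type R by exact: (dirac point).
  by have [] := bmf_ER1 pr nu bg.
rewrite (ER_freeze Gm GI GT mX GX P'm) (ER_freeze Gm GI GT mX GX P'g).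
congr ER; apply/funext => w /=.
have mw : measurable_fun setT (fun q : S * S => ((w : T', q.1), q.2)).
  apply: measurable_fun_pair; last exact: measurable_snd.
  by apply: measurable_fun_pair; [exact: measurable_cst|exact: measurable_fst].
exact: (ER_fubini nu nu (bmf_comp mw bf)).
Qed.

(** Given [G] the two factors are independent copies, so their product averages to the square of the
    conditional mean of [A]. *)
Lemma ER_freeze_cov_ge0 (A : T' * S -> R) : bmf A ->
  0 <= ER Q (fun p => A (p.1, X p.1) * A (p.1, p.2)).
Proof.
move=> bA.
have b1 : bmf (fun p : T' * S => ER nu (fun s => A (p.1, s))).
  have [mA [M AM]] := bA; split; last first.
    exists M => p; apply: ER_bound => //; exact: bmf_section1.
  have pr : probability T' R by exact: (dirac point).
  exact: measurableT_comp (proj1 (bmf_ER1 pr nu bA)) measurable_fst.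
have mfx : measurable_fun setT (fun p : T * S => (p.1 : T', X p.1)).
  exact: measurableT_comp measurable_fst measurable_freeze_ghost1.
have mfs : measurable_fun setT (fun p : T * S => (p.1 : T', p.2)).
  exact: measurableT_comp measurable_fst measurable_freeze_ghost2.
rewrite ER_fubini1; last exact: bmfM (bmf_comp mfx bA) (bmf_comp mfs bA).
have -> : (fun x => ER nu (fun y => A (x, X x) * A (x, y))) =
    (fun x => (fun p : T' * S => A p * ER nu (fun s => A (p.1, s))) (x, X x)).
  by apply/funext => x /=; rewrite (ER_Z nu _ (bmf_section1 (x : T') bA)).
rewrite (ER_freeze Gm GI GT mX GX (bmfM bA b1)).
apply: ER_ge0 => w /=.
under [X in ER nu X]eq_fun do rewrite mulrC.
by rewrite (ER_Z nu _ (bmf_section1 (w : T') bA)) -expr2 sqr_ge0.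
Qed.

End FreezeGhost.

(** * Sigma-algebras of independent samples *)

Section IndependentFamily.
Variables (R : realType) (dT dS : measure_display).
Variables (T : measurableType dT) (S : measurableType dS) (P : probability T R).
Variables (I : finType) (X : I -> T -> S).
Hypothesis mX : forall i, measurable_fun setT (X i).
Hypothesis iX : mutually_independent P X.

(** Rectangles rather than the sigma-algebra of the other samples: on this pi-system independence
    from sample [p] is read off the product formula, and [freeze_rect] does the extension. *)
Definition others (p : I) : set (set T) :=
  [set A | exists2 B : I -> set S, (forall q, measurable (B q)) &
     A = \bigcap_(q in [set` ~: [set p]]) X q @^-1` B q].

Lemma others_measurable p : others p `<=` @measurable _ T.
Proof.
move=> _ [B mB ->]; apply: fin_bigcap_measurable; first exact: finite_finset.
move=> q _.
by rewrite -[X in measurable X]setTI; exact: mX.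
Qed.

Lemma others_setI p : setI_closed (others p).
Proof.
move=> _ _ [B mB ->] [C mC ->]; exists (fun q => B q `&` C q).
  by move=> q; exact: measurableI.
by rewrite -bigcapI; apply: eq_bigcapr => q _; rewrite preimage_setI.
Qed.

Lemma others_setT p : others p setT.
Proof.
exists (fun=> setT) => //; apply/seteqP; split => // w _ q _; exact: I.
Qed.

Lemma others_indep p A B : others p A -> measurable B ->
  P (A `&` X p @^-1` B) = (P A * P (X p @^-1` B))%E.
Proof.
move=> [C mC ->] mB.
pose D q := if q == p then B else C q.
have mD q : measurable (D q) by rewrite /D; case: ifP.
have e := iX [set: I]%SET mD; rewrite (iX (~: [set p])%SET mC).
have -> : \bigcap_(q in [set` ~: [set p]]) X q @^-1` C q `&` X p @^-1` B =
    \bigcap_(i in [set` [set: I]%SET]) X i @^-1` D i.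
  apply/seteqP; split => [w [h hB] q _|w h].
    rewrite /D /=; case: eqP => [->//|/eqP qp]; apply: h.
    by rewrite /= !inE.
  split=> [q|]; last by have := h p; rewrite /= inE /D eqxx; apply.
  by rewrite /= !inE => qp; have := h q; rewrite /= inE /D (negbTE qp); apply.
rewrite e (bigD1 p) ?inE//= /D eqxx muleC; congr (_ * _)%E.
by apply: eq_big => q; rewrite !inE ?andTb// => /negbTE ->.
Qed.

Lemma others_mem p q B : q != p -> measurable B -> others p (X q @^-1` B).
Proof.
move=> qp mB; exists (fun r => if r == q then B else setT).
  by move=> r; case: ifP.
apply/seteqP; split => [w wB r _|w /(_ q)]; first by rewrite /=; case: eqP => [->|].
by rewrite /= !inE eqxx; apply.
Qed.

Lemma others_measurable_fun p q : q != p ->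
  measurable_fun setT (X q : g_sigma_algebraType (others p) -> S).
Proof.
move=> qp _ B mB; rewrite setTI; apply: sub_sigma_algebra; exact: others_mem.
Qed.

Lemma sigma_of_measurable_fun q :
  measurable_fun setT (X q : g_sigma_algebraType (sigma_of X) -> S).
Proof.
move=> _ B mB; rewrite setTI; apply: sub_sigma_algebra; apply: sub_sigma_algebra.
by exists q => //; exists B => //; rewrite setTI.
Qed.

Lemma sigma_of_measurable : sigma_of X `<=` @measurable _ T.
Proof.
apply: smallest_sub; first exact: sigma_algebra_measurable.
move=> _ [q _ [B mB <-]]; exact: mX.
Qed.

Lemma sigma_of_setI : setI_closed (sigma_of X).
Proof. by move=> A B sA sB; apply: (@measurableI _ (g_sigma_algebraType _)). Qed.

Lemma sigma_of_setT : sigma_of X setT.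
Proof. exact: (@measurableT _ (g_sigma_algebraType _)). Qed.

End IndependentFamily.

(** * Generalisation gap of one minibatch step *)

Definition bvec (R : realType) (d : nat) dT (T : measurableType dT)
    (U : T -> 'rV[R]_d) : Prop :=
  forall i, bmf (fun w => U w ord0 i).

Section BoundedVectors.
Variables (R : realType) (d : nat) (dT : measure_display) (T : measurableType dT).
Implicit Types U V : T -> 'rV[R]_d.

Lemma bvecP U M : mvec U -> (forall w, enorm (U w) <= M) -> bvec U.
Proof.
move=> mU UM i; split; first exact: mU.
by exists M => w; apply: le_trans (UM w); exact: coord_le_enorm.
Qed.

Lemma bvecB U V : bvec U -> bvec V -> bvec (fun w => U w - V w).
Proof.
move=> bU bV i; have -> : (fun w => (U w - V w) ord0 i) =
  (fun w => U w ord0 i - V w ord0 i) by apply/funext => w; rewrite !mxE.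
exact: bmfB.
Qed.

Lemma bmf_dot U V : bvec U -> bvec V -> bmf (fun w => dot (U w) (V w)).
Proof. by move=> bU bV; apply: bmf_sum => i; exact: bmfM. Qed.

End BoundedVectors.

(** Here r = 1 / M. Weight 2 - r on the upper bound for [g] and (1 - r) / 2 on the lower one leave
    [g] with coefficient 1, the term s0 p / 4 <= s0 N / 2, and (2 - r) (1 + r) / 2 times [B]. That
    factor is 9/8 - (r - 1/2)^2 / 2, which explains the constant; the terms in [lam] have slack. *)
Lemma gap_arith (R : realType) (M B s0 lam p g N : R) :
  1 <= M -> 0 <= B -> 0 < s0 -> 0 <= lam -> 0 <= p -> p <= 2 * N ->
  g <= (M + 1) / (2 * M) * B + M * s0 / 4 * p + lam * (M - 1) / (4 * M) * p ->
  M * (s0 + lam) * p <= 2 * g ->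
  g - (s0 + lam) / 2 * N <= 9 / 8 * B.
Proof.
move=> M1 B0 s00 l0 p0 pN h1 h2.
have M0 : 0 < M by apply: lt_le_trans M1.
pose r := M^-1; pose q := M * p.
have r0 : 0 < r by rewrite invr_gt0.
have r1 : r <= 1 by rewrite invf_le1.
have q0 : 0 <= q by rewrite mulr_ge0// ltW.
have pE : p = r * q by rewrite /r /q mulKf// gt_eqF.
have {}h1 : g <= (1 + r) / 2 * B + s0 / 4 * q + lam / 4 * ((1 - r) * (r * q)).
  apply: le_trans h1 _; rewrite -pE /r /q le_eqVlt; apply/orP; left; apply/eqP.
  by field; rewrite gt_eqF.
have {}h2 : (s0 + lam) * q <= 2 * g by move: h2; rewrite /q mulrCA mulrA.
rewrite pE in pN; move: r q r0 r1 q0 pN h1 h2 {pE} => r q r0 r1 q0 pN h1 h2.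
have h3 : (s0 + lam) / 4 * (r * q) <= (s0 + lam) / 2 * N.
  have c0 : 0 <= (s0 + lam) / 4 by lra.
  by have := ler_wpM2l c0 pN; lra.
have r2 : 0 <= 2 - r by lra.
have r3 : 0 <= 1 - r by lra.
have k1 := ler_wpM2l r2 h1.
have k2 := ler_wpM2l r3 h2.
have k3 : 0 <= B * (r - 1 / 2) ^+ 2 by rewrite mulr_ge0 ?sqr_ge0.
have lq : 0 <= lam * q by rewrite mulr_ge0.
have k4 : 0 <= lam * q * r by rewrite mulr_ge0// ltW.
have k5 : 0 <= lam * q * (1 - r) by rewrite mulr_ge0.
have k6 : 0 <= lam * q * (1 - r) * (1 - r) ^+ 2 by rewrite mulr_ge0 ?sqr_ge0.
lra.
Qed.

Lemma dot_sub_center (R : realType) (d : nat) (e a b : 'rV[R]_d) :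
  dot (a - b) (a - b) =
  dot (a - e) (a - e) + dot (b - e) (b - e) - 2 * dot (a - e) (b - e).
Proof. by rewrite !dotE (dotC b a) (dotC e a) (dotC e b); ring. Qed.

Lemma gap_young_eq (R : realType) (L M s0 lam p : R) : 0 < M -> 0 < s0 ->
  L ^+ 2 / (2 * (M ^+ 2 * s0 / (M + 1)))
  + M ^+ 2 * s0 / (M + 1) / 2 * (p - (M - 1) / (2 * M) * p)
  + lam / 2 * ((M - 1) / (2 * M) * p) =
  (M + 1) / (2 * M) * (L ^+ 2 / (M * s0)) + M * s0 / 4 * p
  + lam * (M - 1) / (4 * M) * p.
Proof.
move=> M0 s00; field; rewrite (gt_eqF M0) (gt_eqF s00)/=.
by rewrite gt_eqF// addr_gt0.
Qed.

Lemma sum_growth_arith (R : realType) (c D a b u v p q s t : R) :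
  u + s + a + c / 2 * D <= v + t + b -> p + t + b + c / 2 * D <= q + s + a ->
  c * D <= v - u + (q - p).
Proof. lra. Qed.

Section GeneralizationGap.
Variables (R : realType) (d : nat) (X : set 'rV[R]_d).
Hypothesis Xconv : forall u v (t : R), X u -> X v -> 0 <= t <= 1 ->
  X (t *: u + (1 - t) *: v).
Variables (n : nat) (dO : measure_display) (O : measurableType dO).
Variables (Q : probability O R).
(* [f i w] is the model at the [i]-th of [n.+2] samples, the one of index [ord0]
   being fresh; [x j] is the step computed from all samples but the [j]-th, so
   that [x ord0] is the actual step. *)
Variables (f : 'I_n.+2 -> O -> 'rV[R]_d -> R) (x : 'I_n.+2 -> O -> 'rV[R]_d).
Variables (y : O -> 'rV[R]_d) (L lam gamma s0 : R).
Local Notation M := (n.+1%:R : R).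
Local Notation up := (lift (ord0 : 'I_n.+2)).
Hypotheses (L0 : 0 <= L) (lam0 : 0 <= lam) (s00 : 0 < s0).
Hypothesis gammaE : s0 + lam + lam <= gamma.
Hypothesis fL : forall i w, lipx X L (f i w).
Hypothesis fc : forall i w, wcx X lam (f i w).
Hypothesis xP : forall j w,
  is_prox X (fun u => M^-1 * \sum_(i | i != j) f i w u) gamma (y w) (x j w).
Hypothesis fb : forall i j, bmf (fun w => f i w (x j w)).
Hypothesis xb : forall j, bvec (fun w => x j w - y w).
Hypothesis swap_same : forall j, ER Q (fun w => f (up j) w (x (up j) w)) =
  ER Q (fun w => f ord0 w (x ord0 w)).
Hypothesis swap_diff : forall j, ER Q (fun w => f (up j) w (x ord0 w)) =
  ER Q (fun w => f ord0 w (x (up j) w)).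
Hypothesis swap_center : forall j,
  ER Q (fun w => dot (x (up j) w - y w) (x (up j) w - y w)) =
  ER Q (fun w => dot (x ord0 w - y w) (x ord0 w - y w)).
Hypothesis swap_dist : forall i j, i != j ->
  ER Q (fun w => dot (x (up i) w - x (up j) w) (x (up i) w - x (up j) w)) =
  ER Q (fun w => dot (x ord0 w - x (up i) w) (x ord0 w - x (up i) w)).
Hypothesis cov_ge0 : forall j,
  0 <= ER Q (fun w => dot (x ord0 w - y w) (x (up j) w - y w)).

Let M0 : 0 < M. Proof. by rewrite ltr0Sn. Qed.
Let Xx j w : X (x j w). Proof. exact: proj1 (xP j w). Qed.

Lemma wcx_partial_mean j w : wcx X lam (fun u => M^-1 * \sum_(i | i != j) f i w u).
Proof.
have cE : lam = M^-1 * \sum_(i | i != j) lam.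
  rewrite sumr_const cardC1 card_ord -[X in _ * X]mulr_natl mulrA mulVf ?mul1r//.
rewrite [X in wcx _ X]cE; apply: wcx_scale; first by rewrite invr_ge0 ltW.
by apply: wcx_sum => i _; exact: fc.
Qed.

(** The two step objectives differ in a single model out of M. Adding the growth inequality of each
    at the minimiser of the other cancels the shared models and the proximal terms. *)
Lemma pair_stability j w :
  M * (gamma - lam) * dot (x ord0 w - x (up j) w) (x ord0 w - x (up j) w) <=
  f (up j) w (x (up j) w) - f (up j) w (x ord0 w)
  + (f ord0 w (x ord0 w) - f ord0 w (x (up j) w)).
Proof.
have lg : lam <= gamma by move: gammaE; move: (s00) (lam0); lra.
have g1 := prox_growth Xconv lg (wcx_partial_mean ord0 w) (xP ord0 w) (Xx (up j) w).
have g2 := prox_growth Xconv lg (wcx_partial_mean (up j) w) (xP (up j) w) (Xx ord0 w).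
have split0 u : \sum_(i | i != ord0) f i w u =
    f (up j) w u + \sum_(i | (i != ord0) && (i != up j)) f i w u.
  by rewrite (bigD1 (up j)).
have splitj u : \sum_(i | i != up j) f i w u =
    f ord0 w u + \sum_(i | (i != ord0) && (i != up j)) f i w u.
  rewrite (bigD1 ord0)//=; congr (_ + _); apply: eq_bigl => i; exact: andbC.
move: g1 g2; rewrite /prox_obj !split0 !splitj.
have -> : dot (x (up j) w - x ord0 w) (x (up j) w - x ord0 w) =
   dot (x ord0 w - x (up j) w) (x ord0 w - x (up j) w).
  by rewrite -opprB dotNl dotNr opprK.
rewrite !(mulrDr M^-1).
move: (\sum_(i | _) f i w (x ord0 w)) (\sum_(i | _) f i w (x (up j) w)) => S0 Sj.
move: (dot (x ord0 w - y w) _) (dot (x (up j) w - y w) _).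
move: (dot (x ord0 w - x (up j) w) _) => D a b h1 h2.
have h : (gamma - lam) * D <= M^-1 * (f (up j) w (x (up j) w) - f (up j) w (x ord0 w)
    + (f ord0 w (x ord0 w) - f ord0 w (x (up j) w))).
  move: (f (up j) w (x (up j) w)) (f (up j) w (x ord0 w)) h1 h2 => e1 e2.
  move: (f ord0 w (x (up j) w)) (f ord0 w (x ord0 w)) => e3 e4 h1 h2.
  by rewrite mulrDr !mulrBr; exact: sum_growth_arith h1 h2.
by move: h; rewrite ler_pdivlMl// mulrA.
Qed.

Let c w := mean (fun j => x (up j) w).
Let V w := M^-1 * \sum_j dot (x (up j) w - c w) (x (up j) w - c w).
Let D j w := dot (x ord0 w - x (up j) w) (x ord0 w - x (up j) w).

(** Both terms are compared with the value at the mean of the [x (up j)]: Jensen on one side, the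
    Lipschitz bound and Young's inequality with weight [a] on the other. *)
Lemma gap_jensen a w : 0 < a ->
  f ord0 w (x ord0 w) - M^-1 * \sum_j f ord0 w (x (up j) w) <=
  L ^+ 2 / (2 * a) + a / 2 * (M^-1 * \sum_j D j w - V w) + lam / 2 * V w.
Proof.
move=> a0.
have j1 := jensen Xconv (fc ord0 w) (fun j => Xx (up j) w).
have Xc : X (c w) := mean_in Xconv (fun j => Xx (up j) w).
have l1 := fL ord0 w (Xx ord0 w) Xc.
have e := mean_sq (fun j => x (up j) w) (x ord0 w).
have -> : M^-1 * \sum_j D j w - V w = enorm (x ord0 w - c w) ^+ 2.
  by rewrite /V /D e addrK enorm_sqE.
rewrite -/(c w) in j1; rewrite -/(V w) in j1.
have am : L * enorm (x ord0 w - c w) <=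
    L ^+ 2 / (2 * a) + a / 2 * enorm (x ord0 w - c w) ^+ 2.
  move: (enorm _) => s; rewrite -subr_ge0.
  have -> : L ^+ 2 / (2 * a) + a / 2 * s ^+ 2 - L * s = (L - a * s) ^+ 2 / (2 * a).
    by field; rewrite gt_eqF.
  by rewrite divr_ge0 ?sqr_ge0 ?mulr_ge0// ltW.
move: am l1 j1; move: (L * _) (_ ^+ 2 / _) (a / 2 * _) (lam / 2 * _) => p q r s.
by move: (f _ _ _) (f _ _ _) (M^-1 * _) => e1 e2 e3; lra.
Qed.

(** The variance as half the mean squared distance of a pair, the form to which exchangeability
    applies. *)
Lemma double_mean w :
  V w = M^-1 / 2 * (M^-1 * \sum_i \sum_j
    dot (x (up i) w - x (up j) w) (x (up i) w - x (up j) w)).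
Proof.
have e i := mean_sq (fun j => x (up j) w) (x (up i) w).
have {}e i : \sum_j dot (x (up i) w - x (up j) w) (x (up i) w - x (up j) w) =
    M * (dot (x (up i) w - c w) (x (up i) w - c w) + V w).
  by rewrite -e mulrA mulfV ?mul1r// ?gt_eqF.
under [X in _ = _ * (_ * X)]eq_bigr do rewrite e.
rewrite -mulr_sumr big_split/= sumr_const card_ord -mulr_natl.
have -> : \sum_j dot (x (up j) w - c w) (x (up j) w - c w) = M * V w.
  by rewrite /V mulrA mulfV ?mul1r// ?gt_eqF.
by field; rewrite gt_eqF.
Qed.

Let bx i j : bvec (fun w => x i w - x j w).
Proof.
have -> : (fun w => x i w - x j w) = (fun w => (x i w - y w) - (x j w - y w)).
  by apply/funext => w; rewrite opprB addrA subrK.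
exact: bvecB.
Qed.

Let bD j : bmf (D j). Proof. by apply: bmf_dot; exact: bx. Qed.

Let bV : bmf V.
Proof.
have -> : V = (fun w => M^-1 / 2 * (M^-1 * \sum_i \sum_j
    dot (x (up i) w - x (up j) w) (x (up i) w - x (up j) w))).
  by apply/funext => w; rewrite double_mean.
apply: bmfZ; apply: bmfZ; apply: bmf_sum => i; apply: bmf_sum => j.
by apply: bmf_dot; exact: bx.
Qed.

Let p := M^-1 * \sum_j ER Q (D j).

Lemma ER_V : ER Q V = (M - 1) / (2 * M) * p.
Proof.
have -> : V = (fun w => M^-1 / 2 * (M^-1 * \sum_i \sum_j
    dot (x (up i) w - x (up j) w) (x (up i) w - x (up j) w))).
  by apply/funext => w; rewrite double_mean.
have b2 i j : bmf (fun w => dot (x (up i) w - x (up j) w) (x (up i) w - x (up j) w)).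
  by apply: bmf_dot; exact: bx.
have b1 i : bmf (fun w => \sum_j
    dot (x (up i) w - x (up j) w) (x (up i) w - x (up j) w)) by exact: bmf_sum.
rewrite !ER_Z ?ER_sum//; [|exact: bmf_sum|apply: bmfZ; exact: bmf_sum].
have row i : ER Q (fun w => \sum_j
    dot (x (up i) w - x (up j) w) (x (up i) w - x (up j) w)) = (M - 1) * ER Q (D i).
  rewrite ER_sum// (bigD1 i)//= (_ : ER Q _ = 0); last first.
    rewrite -[RHS](ER_cst Q 0); congr ER; apply/funext => w.
    by rewrite subrr /dot big1// => k _; rewrite mxE mulr0.
  rewrite add0r (eq_bigr (fun=> ER Q (D i))); last first.
    by move=> j ji; rewrite swap_dist// eq_sym.
  rewrite sumr_const cardC1 card_ord -[LHS]mulr_natl; congr (_ * _).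
  by rewrite -natr1 addrK.
under eq_bigr do rewrite row.
by rewrite -mulr_sumr /p; move: (\sum_j _) => S; field; rewrite gt_eqF.
Qed.

Theorem generalization_gap :
  ER Q (fun w => f ord0 w (x ord0 w))
  - M^-1 * (\sum_j ER Q (fun w => f (up j) w (x ord0 w)))
  - (s0 + lam) / 2 * ER Q (fun w => dot (x ord0 w - y w) (x ord0 w - y w))
  <= 9 / 8 * (L ^+ 2 / (M * s0)).
Proof.
have M1 : 1 <= M by rewrite ler1n.
have p0 : 0 <= p.
  apply: mulr_ge0; first by rewrite invr_ge0 ltW.
  by apply: sumr_ge0 => j _; apply: ER_ge0 => w; exact: dot_ge0.
pose g := ER Q (fun w => f ord0 w (x ord0 w))
  - M^-1 * (\sum_j ER Q (fun w => f (up j) w (x ord0 w))).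
apply: (@gap_arith _ M _ s0 lam p g) => //.
- by rewrite divr_ge0 ?sqr_ge0 ?mulr_ge0// ltW.
- set N := ER Q _.
  (* Expand around the prox-center: [swap_center] gives both squares the same mean, and [cov_ge0]
     discards the cross term. *)
  suff pj j : ER Q (D j) <= 2 * N.
    rewrite /p mulrC ler_pdivrMr//; apply: le_trans (ler_sum _ (fun j _ => pj j)) _.
    by rewrite sumr_const card_ord -[leLHS]mulr_natr.
  have -> : D j = (fun w => dot (x ord0 w - y w) (x ord0 w - y w)
      + dot (x (up j) w - y w) (x (up j) w - y w)
      - 2 * dot (x ord0 w - y w) (x (up j) w - y w)).
    by apply/funext => w; exact: dot_sub_center.
  have b0 : bmf (fun w => dot (x ord0 w - y w) (x ord0 w - y w)) by exact: bmf_dot.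
  have b1 : bmf (fun w => dot (x (up j) w - y w) (x (up j) w - y w)) by exact: bmf_dot.
  have b2 : bmf (fun w => dot (x ord0 w - y w) (x (up j) w - y w)) by exact: bmf_dot.
  rewrite ER_B ?ER_D ?ER_Z//; [|exact: bmfD|exact: bmfZ].
  rewrite swap_center -/N; have := cov_ge0 j; move: (ER Q _) => e; lra.
(* The mean of the [D j] minus [V] has expectation (M + 1) / (2 M) [p]. This weight brings the
   coefficient of [p] to M s0 / 4, half of the M s0 / 2 that stability gives in a lower bound for
   [g]. *)
- pose a := M ^+ 2 * s0 / (M + 1).
  have Mp : 0 < M + 1 by rewrite addr_gt0.
  have a0 : 0 < a by rewrite divr_gt0 ?mulr_gt0 ?exprn_gt0.
  have bl : bmf (fun w => M^-1 * \sum_j f ord0 w (x (up j) w)).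
    by apply: bmfZ; apply: bmf_sum => j; exact: fb.
  have bs : bmf (fun w => M^-1 * \sum_j D j w) by apply: bmfZ; exact: bmf_sum.
  have bd : bmf (fun w => M^-1 * \sum_j D j w - V w) by exact: bmfB.
  have b1 : bmf (fun w => L ^+ 2 / (2 * a) + a / 2 * (M^-1 * \sum_j D j w - V w)).
    by apply: bmfD; [exact: bmf_cst|exact: bmfZ].
  have := ER_le Q (bmfB (fb ord0 ord0) bl) (bmfD b1 (bmfZ (lam / 2) bV))
    (fun w => gap_jensen w a0).
  rewrite (ER_B Q (fb ord0 ord0) bl) ER_Z; last by apply: bmf_sum => j; exact: fb.
  rewrite ER_sum; last by move=> j; exact: fb.
  rewrite (ER_D Q b1 (bmfZ (lam / 2) bV)) (ER_D Q (bmf_cst _ _) (bmfZ _ bd)) ER_cst.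
  rewrite (ER_Z Q (a / 2) bd) (ER_B Q bs bV) (ER_Z Q (lam / 2) bV) ER_V.
  rewrite (ER_Z Q _ (bmf_sum _ _ bD)) ER_sum// -/p /g.
  under [X in _ -> _ - _ * X <= _]eq_bigr do rewrite swap_diff.
  move/le_trans; apply; rewrite le_eqVlt; apply/orP; left; apply/eqP.
  exact: gap_young_eq.
(* In expectation, exchanging samples makes the two differences of [pair_stability] equal, whence
   the factor 2. *)
have key j : M * (gamma - lam) * ER Q (D j) <=
    2 * (ER Q (fun w => f ord0 w (x ord0 w)) - ER Q (fun w => f (up j) w (x ord0 w))).
  have ba : bmf (fun w => f (up j) w (x (up j) w) - f (up j) w (x ord0 w)) by exact: bmfB.
  have bb : bmf (fun w => f ord0 w (x ord0 w) - f ord0 w (x (up j) w)) by exact: bmfB.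
  have := ER_le Q (bmfZ (M * (gamma - lam)) (bD j)) (bmfD ba bb) (pair_stability j).
  rewrite (ER_Z Q _ (bD j)) (ER_D Q ba bb) !ER_B// swap_same swap_diff.
  move: (ER Q _) (ER Q _) => u v; lra.
apply: (@le_trans _ _ (M * (gamma - lam) * p)).
  rewrite ler_wpM2r// ler_wpM2l ?(ltW M0)//; move: gammaE; lra.
rewrite /p mulrCA mulr_sumr.
apply: (@le_trans _ _ (M^-1 * \sum_j (2 * (ER Q (fun w => f ord0 w (x ord0 w))
   - ER Q (fun w => f (up j) w (x ord0 w)))))).
  rewrite ler_wpM2l ?invr_ge0 ?(ltW M0)//; apply: ler_sum => j _; exact: key.
rewrite -mulr_sumr sumrB sumr_const card_ord /g [n.+2.-1]/=.
move: (\sum_j _) (ER Q _) => S e.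
by rewrite -(mulr_natl e) le_eqVlt mulrCA mulrBr mulKf ?eqxx// gt_eqF.
Qed.

End GeneralizationGap.

(** * Descent along one step *)

(** [q] is what zeta / theta^2 leaves after rho / 2 + nu has been spent on |x^{k+1} - z|^2. The last
    inequality collects the costs charged to |x^k - x^{k-1}|^2 in the descent: [tau] for the model
    error, the second term for |x^k - z|^2, the third for |x^{k+1} - z|^2. It lets the squared
    increments telescope. *)
Lemma step_parameters (R : realType) (lam tau rho beta theta zeta nu : R) :
  0 <= lam -> 0 <= tau -> 0 < rho -> 0 <= beta < 1 -> theta = 1 - beta ->
  nu = rho - lam - tau -> 0 <= nu ->
  zeta = 2 * theta * (rho + lam * beta + tau) + tau + 2 * rho * beta ^+ 2 * theta^-1 ->
  let q := zeta / theta ^+ 2 - rho / 2 - nu in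
  [/\ 0 <= q, 0 < zeta &
   tau + rho * beta ^+ 2 / theta / 2 + (rho / 2 + nu) * beta ^+ 3 / theta
   <= q * theta ^+ 2].
Proof.
move=> l0 t0 r0 /andP[b0 b1] hth nuE nu0 hz q.
have th0 : 0 < theta by lra.
have th1 : theta <= 1 by lra.
pose i := theta^-1; have i0 : 0 < i by rewrite invr_gt0.
have c0 : 0 <= rho / 2 + nu by lra.
have k1 : 0 <= (rho / 2 + nu) * (theta * (1 - theta)).
  by rewrite mulr_ge0// mulr_ge0 ?subr_ge0// ltW.
have k2 : 0 <= (rho / 2 + nu) * (beta ^+ 2 * (1 - beta) * i).
  by rewrite mulr_ge0// !mulr_ge0 ?sqr_ge0 ?subr_ge0// ltW.
have k3 : 0 <= (lam + tau) * theta by rewrite mulr_ge0 ?addr_ge0// ltW.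
have k4 : 0 <= (lam + tau) * (beta ^+ 2 * i).
  by rewrite mulr_ge0 ?addr_ge0// mulr_ge0 ?sqr_ge0// ltW.
have k5 : 0 <= theta * (lam * beta + tau).
  by rewrite mulr_ge0 ?(ltW th0)// addr_ge0// mulr_ge0.
have k6 : 0 <= (rho / 2 + nu) * (beta ^+ 3 * i).
  by rewrite mulr_ge0// mulr_ge0 ?exprn_ge0// ltW.
have k7 : 0 <= rho * (beta ^+ 2 * i).
  by rewrite mulr_ge0 ?(ltW r0)// mulr_ge0 ?sqr_ge0// ltW.
have k8 : 0 < rho * theta by rewrite mulr_gt0.
have qE : q * theta ^+ 2 = zeta - (rho / 2 + nu) * theta ^+ 2.
  by rewrite /q; field; rewrite gt_eqF.
have main : tau + rho * beta ^+ 2 / theta / 2 + (rho / 2 + nu) * beta ^+ 3 / theta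
   <= q * theta ^+ 2.
  rewrite qE hz -/i; rewrite nuE in k1 k2 k6 *; lra.
split=> //; last by rewrite hz -/i; lra.
rewrite -(pmulr_lge0 q (exprn_gt0 2 th0)); apply: le_trans main.
rewrite -/i; lra.
Qed.

(* With [z] and [zn] the extrapolations before and after the step from [x] to
   [xn], [y] its prox-center and [h] the proximal point of [z], the variables stand
   for [a = |h - z|^2], [b = |h - x|^2], [bp = |h - xn|^2], [D = |x - x'|^2],
   [Dp = |xn - x|^2], [n = |xn - y|^2], [q1 = |h - zn|^2], [q2 = |x - z|^2] and
   [q3 = |xn - z|^2]. *)
Lemma descent_arith (R : realType) (lam tau rho beta theta zeta nu s0 q : R)
    (a b bp D Dp n q1 q2 q3 M Mp fh fx fn Fh Fx mh mu mn : R) :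
  0 <= lam -> 0 <= tau -> 0 < rho -> 0 <= beta < 1 -> theta = 1 - beta ->
  nu = rho - lam - tau -> 2 * (tau + lam) <= nu -> 0 < s0 -> 0 < zeta ->
  q = zeta / theta ^+ 2 - rho / 2 - nu -> 0 <= q ->
  tau + rho * beta ^+ 2 / theta / 2 + (rho / 2 + nu) * beta ^+ 3 / theta
    <= q * theta ^+ 2 ->
  0 <= b -> 0 <= D ->
  mn + (s0 + zeta / theta ^+ 2 + lam) / 2 * n
    + (s0 + zeta / theta ^+ 2) / 2 * (theta ^+ 2 * q1)
    <= mu + (s0 + zeta / theta ^+ 2 + lam) / 2 * (theta ^+ 2 * a) ->
  mu <= theta * mh + beta * Fx + lam / 2 * (theta * beta * b) ->
  mh <= Fh + tau / 2 * b ->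
  M = fh + rho / 2 * a -> Mp <= fh + rho / 2 * q1 ->
  fh + rho / 2 * a + nu / 2 * b <= fx + rho / 2 * q2 ->
  fh + rho / 2 * a + nu / 2 * bp <= fn + rho / 2 * q3 ->
  2 * a <= 3 * bp + 6 * q3 ->
  q2 = (beta / theta) ^+ 2 * D ->
  q3 <= n / theta + beta ^+ 3 / theta ^+ 2 * D ->
  theta * (Dp - beta * D) <= n ->
  theta * (rho - theta * lam + nu / 3) * a <=
    (1 + beta) * (fx - fn) + 2 * (s0 * theta ^+ 2 + zeta) / rho * (M - Mp)
    + (q * theta - tau) * (D - Dp)
    + 2 * (theta * (Fh - fh) + beta * (Fx - fx)
           + (fn - tau / 2 * Dp - mn - (s0 + lam) / 2 * n)).
Proof.
move=> l0 t0 r0 /andP[b0 b1] hth nuE nul s00 z0 qE qq0 hpar bb0 D0.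
move=> H1 H2 H3 HM H4 H5 H6 H7 q2E H8 H9.
have th0 : 0 < theta by lra.
have thn : theta != 0 by rewrite gt_eqF.
pose i := theta^-1; have i0 : 0 < i by rewrite invr_gt0.
have thi : theta * i = 1 by rewrite mulfV.
have nu0 : 0 <= nu by lra.
pose c := s0 * theta ^+ 2 + zeta.
have c0 : 0 < c by rewrite addr_gt0// mulr_gt0// exprn_gt0.
have z2E : zeta / theta ^+ 2 = q + rho / 2 + nu by lra.
have cE : (s0 + zeta / theta ^+ 2) * theta ^+ 2 = c by rewrite /c; field.
have {}H1 : mn + (s0 + zeta / theta ^+ 2 + lam) / 2 * n + c / 2 * q1
    <= mu + (c + lam * theta ^+ 2) / 2 * a.
  by move: H1; rewrite -cE; lra.
(* The envelope at the next extrapolation is at most the objective of [h] there; the scaling matches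
   the term c (q1 - a) left by twice [H1]. *)
have S1 : 2 * c / rho * (Mp - M) <= c * (q1 - a).
  have k : Mp - M <= rho / 2 * (q1 - a) by lra.
  have k0 : 0 <= 2 * c / rho by rewrite divr_ge0 ?mulr_ge0// ltW.
  apply: le_trans (ler_wpM2l k0 k) _; rewrite le_eqVlt; apply/orP; left; apply/eqP.
  by field; rewrite gt_eqF.
have S2 := ler_wpM2l (ltW th0) H3.
have S3 := ler_wpM2l (ltW th0) (lerD H5 H6).
(* The weights 3/2 and 3 are such that a third of this inequality uses up exactly the growth nu / 2
   at the new iterate; its [q3] part joins rho / 2 in [S5]. *)
have S4 : theta * nu * a <= theta * nu * (3 / 2 * bp + 3 * q3).
  by rewrite ler_wpM2l ?mulr_ge0 ?(ltW th0)//; lra.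
have S5 : theta * (rho / 2 + nu) * q3 <=
    (rho / 2 + nu) * n + (rho / 2 + nu) * beta ^+ 3 / theta * D.
  have k0 : 0 <= theta * (rho / 2 + nu).
    by rewrite mulr_ge0 ?(ltW th0)//; lra.
  apply: le_trans (ler_wpM2l k0 H8) _; rewrite le_eqVlt; apply/orP; left; apply/eqP.
  by field.
have S6 : theta * rho / 2 * q2 = rho * beta ^+ 2 / theta / 2 * D.
  by rewrite q2E; field.
(* Here rho > 3 (tau + lambda) enters, as 2 (tau + lam) <= nu: the growth at x^k has to cover the
   model error and the weak convexity of the batch model. *)
have S7 : 0 <= theta * b * (nu / 2 - tau - lam * beta).
  have k : lam * beta <= lam by rewrite ler_piMr// ltW.
  by rewrite mulr_ge0 ?mulr_ge0 ?(ltW th0)//; lra.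
have S8 := ler_wpM2l qq0 H9.
have S9 := ler_wpM2r D0 hpar.
have MMp : 2 * c / rho * (M - Mp) = - (2 * c / rho * (Mp - M)) by rewrite -mulrN opprB.
rewrite -/c MMp.
move: (2 * c / rho * (Mp - M)) S1 {MMp} => W S1.
move: (zeta / theta ^+ 2) z2E H1 => Z z2E H1.
rewrite z2E in H1.
move: S5 S6 S9 {hpar cE H8 q2E}.
have tb : theta = 1 - beta by [].
move: (rho * beta ^+ 2 / theta / 2) ((rho / 2 + nu) * beta ^+ 3 / theta) => P1 P2 S5 S6 S9.
clear qE z2E Z thi i0 c0 H4 HM H5 H6 H7 H9 H3 z0 s00 nuE nul.
rewrite !mulrDl in S9.
(* One [theta] is opened as 1 - beta: the first part telescopes, the second is the loss incurred in
   [S8]. *)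
have tt : q * theta ^+ 2 * D = q * theta * D - q * theta * (beta * D).
  by rewrite [in LHS]expr2 {2}tb; ring.
rewrite tt in S9.
clear tt.
subst theta.
lra.
Qed.

Section DescentStep.
Variables (R : realType) (d : nat) (X : set 'rV[R]_d).
Hypothesis Xconv : forall u v (t : R), X u -> X v -> 0 <= t <= 1 ->
  X (t *: u + (1 - t) *: v).
Variables (lam tau rho beta theta zeta nu s0 q : R).
Hypotheses (lam0 : 0 <= lam) (tau0 : 0 <= tau) (rho0 : 0 < rho).
Hypotheses (beta01 : 0 <= beta < 1) (thetaE : theta = 1 - beta).
Hypotheses (nuE : nu = rho - lam - tau) (nu_ge : 2 * (tau + lam) <= nu).
Hypotheses (s00 : 0 < s0) (zeta0 : 0 < zeta).
Hypotheses (qE : q = zeta / theta ^+ 2 - rho / 2 - nu) (q0 : 0 <= q).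
Hypothesis hpar : tau + rho * beta ^+ 2 / theta / 2
  + (rho / 2 + nu) * beta ^+ 3 / theta <= q * theta ^+ 2.
Local Notation gamma := (s0 + zeta / theta ^+ 2 + lam).
Implicit Types f : 'rV[R]_d -> R.

Definition extrapolate (x' x : 'rV[R]_d) := x + (beta / theta) *: (x - x').
Definition center (x' x : 'rV[R]_d) := x + beta *: (x - x').

(** The first two terms are centred when [h] and [x] are fixed before the batch. The rest is a
    generalisation gap at [xn]: the term in [tau] pays for passing from [f] to a fresh model, and
    the last square is the share of the proximal term that the stability bound needs. *)
Definition step_noise f (Fb fmb : 'rV[R]_d -> R) (x' x xn h : 'rV[R]_d) : R :=
  theta * (Fb h - f h) + beta * (Fb x - f x)
  + (f xn - tau / 2 * dot (xn - x) (xn - x) - fmb xn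
     - (s0 + lam) / 2 * dot (xn - center x' x) (xn - center x' x)).

Lemma descent_step f Fb fmb x' x xn h hn :
  wcx X (lam + tau) f -> wcx X lam fmb -> fmb x = Fb x ->
  (forall u, X u -> fmb u <= Fb u + tau / 2 * dot (u - x) (u - x)) ->
  X x -> is_prox X fmb gamma (center x' x) xn ->
  is_prox X f rho (extrapolate x' x) h -> is_prox X f rho (extrapolate x xn) hn ->
  theta * (rho - theta * lam + nu / 3)
    * dot (h - extrapolate x' x) (h - extrapolate x' x) <=
  (1 + beta) * (f x - f xn)
  + 2 * (s0 * theta ^+ 2 + zeta) / rho
    * (prox_obj f rho (extrapolate x' x) h - prox_obj f rho (extrapolate x xn) hn)
  + (q * theta - tau) * (dot (x - x') (x - x') - dot (xn - x) (xn - x))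
  + 2 * step_noise f Fb fmb x' x xn h.
Proof.
move=> fc mc mx mq Xx pn ph phn.
have th0 : 0 < theta by case/andP: beta01 thetaE => b0 b1 ->; lra.
have thn : theta != 0 by rewrite gt_eqF.
have bE : beta = 1 - theta by rewrite thetaE subKr.
have th01 : 0 <= theta <= 1 by case/andP: beta01 thetaE => b0 b1 ->; lra.
set z := extrapolate x' x; set zn := extrapolate x xn; set y := center x' x.
(* the step is compared with this point because [y = theta *: z + beta *: x] and
   [xn = theta *: zn + beta *: x] *)
pose u := theta *: h + (1 - theta) *: x.
have Xu : X u by apply: Xconv => //; exact: proj1 ph.
have eu : u - y = theta *: (h - z).
  by apply/rowP => i; rewrite /y /z /u /center /extrapolate bE !mxE; field.
have eun : u - xn = theta *: (h - zn).
  by apply/rowP => i; rewrite /zn /u /extrapolate bE !mxE; field.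
have exz : x - z = (- (beta / theta)) *: (x - x').
  by apply/rowP => i; rewrite /z /extrapolate !mxE; field.
(* In this convex combination the squared norm splits with the coefficients 1 / theta and beta^3 /
   theta^2. *)
have exn : xn - z = theta *: (theta^-1 *: (xn - y))
    + (1 - theta) *: ((- (beta / theta)) *: (x - x')).
  by apply/rowP => i; rewrite /z /y /extrapolate /center bE !mxE; field.
have exy : xn - y = (xn - x) - beta *: (x - x').
  by apply/rowP => i; rewrite /y /center !mxE; ring.
have lg : lam <= gamma.
  by rewrite lerDr addr_ge0 ?divr_ge0 ?exprn_ge0// ltW.
have H1 := prox_growth Xconv lg mc pn Xu.
have H2 := mc h x theta (proj1 ph) Xx th01.
have crho : lam + tau <= rho.
  by rewrite -subr_ge0 opprD addrA -nuE; apply: le_trans nu_ge; rewrite mulr_ge0// addr_ge0.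
have H4 := prox_growth Xconv crho fc ph Xx.
have H5 := prox_growth Xconv crho fc ph (proj1 pn).
have H3 := mq h (proj1 ph).
have HMp := proj2 phn h (proj1 ph).
rewrite /step_noise -/y.
have nuE' : rho - (lam + tau) = nu by rewrite nuE; ring.
rewrite nuE' in H4 H5.
have hh v : dot (v - h) (v - h) = dot (h - v) (h - v).
  by rewrite -opprB dotNl dotNr opprK.
apply: (@descent_arith _ lam tau rho beta theta zeta nu s0 q
  (dot (h - z) (h - z)) (dot (h - x) (h - x)) (dot (h - xn) (h - xn))
  (dot (x - x') (x - x')) (dot (xn - x) (xn - x)) (dot (xn - y) (xn - y))
  (dot (h - zn) (h - zn)) (dot (x - z) (x - z)) (dot (xn - z) (xn - z))
  _ _ (f h) (f x) (f xn) (Fb h) (Fb x) (fmb h) (fmb u) (fmb xn)) => //;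
  rewrite ?dot_ge0//.
- move: H1; rewrite /prox_obj eu eun !dotZl !dotZr.
  rewrite !(mulrA theta theta) -expr2.
  by rewrite (_ : gamma - lam = s0 + zeta / theta ^+ 2) ?addrK.
- by move: H2; rewrite -/u -bE mx.
- by move: H4; rewrite /prox_obj hh.
- by move: H5; rewrite /prox_obj hh.
- rewrite (_ : h - z = (h - xn) + (xn - z)); last by rewrite addrA subrK.
  move: (h - xn) (xn - z) => v w; rewrite -subr_ge0.
  have -> : 3 * dot v v + 6 * dot w w - 2 * dot (v + w) (v + w)
     = dot (v - 2 *: w) (v - 2 *: w).
    by rewrite !dotE (dotC w v); ring.
  exact: dot_ge0.
- by rewrite exz !dotE; ring.
- rewrite exn; apply: le_trans (dot_convex _ _ th01) _.
  rewrite !(dotZl, dotZr) -bE le_eqVlt; apply/orP; left; apply/eqP.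
  by move: (dot _ _) (dot _ _) => s t; field.
rewrite exy; move: (xn - x) (x - x') => v w; rewrite -subr_ge0.
have -> : dot (v - beta *: w) (v - beta *: w) - theta * (dot v v - beta * dot w w)
   = beta * dot (v - w) (v - w).
  by rewrite thetaE !dotE (dotC w v); ring.
by rewrite mulr_ge0 ?dot_ge0//; case/andP: beta01.
Qed.

End DescentStep.

Lemma telescope_ord (R : realType) (K : nat) (g : nat -> R) :
  \sum_(k < K) (g k - g k.+1) = g 0%N - g K.
Proof.
elim: K => [|K IH]; first by rewrite big_ord0 subrr.
by rewrite big_ord_recr/= IH addrA subrK.
Qed.

(* Both sides are quadratic in [(lam, tau)]; after bounding one factor [nu] below by
   [2 / 3 * rho] the difference is a nonnegative combination of [rho * a], [rho * tau]
   and [rho * lam], the barycentric coordinates of the triangle [tau + lam <= rho / 3]. *)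
Lemma rate_arith (R : realType) (lam tau rho beta theta zeta nu : R) :
  0 <= lam -> 0 <= tau -> 0 < rho -> 0 <= beta < 1 -> theta = 1 - beta ->
  nu = rho - lam - tau -> 3 * (tau + lam) <= rho ->
  zeta = 2 * theta * (rho + lam * beta + tau) + tau + 2 * rho * beta ^+ 2 * theta^-1 ->
  [/\ 3 * rho * (rho - theta * lam) <= nu * (rho * beta + 2 * zeta) &
      3 / 8 * (rho - theta * lam) <= nu].
Proof.
move=> l0 t0 r0 /andP[b0 b1] hth nuE ul hz.
have th0 : 0 < theta by lra.
have thl : 0 <= theta * lam by rewrite mulr_ge0// ltW.
split; last by lra.
have zge : 4 * theta * (rho + lam * beta + tau) + 2 * tau + 4 * rho * beta ^+ 2
    <= 2 * zeta.
  rewrite hz; have i1 : 1 <= theta^-1 by rewrite invf_ge1//; lra.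
  have k : 0 <= rho * beta ^+ 2 by rewrite mulr_ge0 ?sqr_ge0// ltW.
  have := ler_wpM2l k i1; lra.
have nu0 : 0 <= nu by lra.
have h1 := ler_wpM2l nu0 zge.
have nuge : 2 / 3 * rho <= nu by lra.
have c0 : 0 <= 4 * theta * beta * lam + (4 * theta + 2) * tau.
  by rewrite addr_ge0// mulr_ge0// ?mulr_ge0//; lra.
have h2 := ler_wpM2r c0 nuge.
pose a := rho / 3 - tau - lam; have a0 : 0 <= a by rewrite /a; lra.
have rE : rho = 3 * (a + tau + lam) by rewrite /a; field.
have s1 : 0 <= rho * a by rewrite mulr_ge0// ltW.
have s2 : 0 <= rho * tau by rewrite mulr_ge0// ltW.
have s3 : 0 <= rho * lam by rewrite mulr_ge0// ltW.
(* Each of the three quadratics in [beta] has a positive minimum; the squares are centred at its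
   minimiser or close to it. *)
have q1 : 0 <= (4 - 3 * beta + 4 * beta ^+ 2) - 3.
  have := sqr_ge0 (beta - 3 / 8); lra.
have q2 : 0 <= 2 * (4 - 3 * beta + 4 * beta ^+ 2) + 2 / 3 * (6 - 4 * beta) - 9.
  have := sqr_ge0 (beta - 1 / 2); lra.
have q3 : 0 <= 2 * (4 - 3 * beta + 4 * beta ^+ 2) + 8 / 3 * (1 - beta) * beta
     - 9 + 3 * (1 - beta).
  have := sqr_ge0 (beta - 19 / 32); lra.
have p1 := mulr_ge0 s1 q1.
have p2 := mulr_ge0 s2 q2.
have p3 := mulr_ge0 s3 q3.
apply: le_trans (_ : nu * (rho * beta + (4 * theta * (rho + lam * beta + tau)
   + 2 * tau + 4 * rho * beta ^+ 2)) <= _); last first.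
  by rewrite ler_wpM2l// lerD2l.
have eA : nu * (rho * beta + (4 * theta * (rho + lam * beta + tau)
   + 2 * tau + 4 * rho * beta ^+ 2)) =
   nu * rho * (4 - 3 * beta + 4 * beta ^+ 2)
   + nu * (4 * theta * beta * lam + (4 * theta + 2) * tau).
  by rewrite hth; ring.
rewrite eA; clear eA h1 zge hz.
move: h2; set c := nu * (_ + _) => h2.
have eN : nu * rho * (4 - 3 * beta + 4 * beta ^+ 2) =
   (3 * (rho * a) + 2 * (rho * tau) + 2 * (rho * lam)) * (4 - 3 * beta + 4 * beta ^+ 2).
  by rewrite nuE /a; field.
have eR : 3 * rho * (rho - theta * lam) =
   9 * (rho * a) + 9 * (rho * tau) + (9 - 3 * theta) * (rho * lam).
  by rewrite /a; field.
rewrite eN eR.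
have h3 : 8 / 3 * (1 - beta) * beta * (rho * lam) + 2 / 3 * (6 - 4 * beta) * (rho * tau)
    <= c.
  apply: le_trans h2; rewrite le_eqVlt; apply/orP; left; apply/eqP.
  by rewrite hth; field.
move: p1 p2 p3 h3; rewrite hth.
move: (rho * a) (rho * tau) (rho * lam) => u v w p1 p2 p3 h3.
lra.
Qed.

(* [a] and [b] are the square roots of the number of iterations and of the batch
   size. *)
Lemma final_arith (R : realType)
    (rho beta theta zeta nu A gamma0 s0 Delta L a b S : R) :
  0 < rho -> 0 <= beta -> 0 < theta -> 0 < A -> 0 <= zeta -> 0 < gamma0 ->
  0 < a -> 0 < b -> 0 <= Delta -> s0 = gamma0 * (a / b) ->
  3 * rho * A <= nu * (rho * beta + 2 * zeta) -> 3 / 8 * A <= nu ->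
  theta * (A + nu / 3) * S <=
    ((1 + beta) + 2 * (s0 * theta ^+ 2 + zeta) / rho) * Delta
    + 2 * (a ^+ 2 * (9 / 8 * (L ^+ 2 / (b ^+ 2 * s0)))) ->
  rho ^+ 2 / a ^+ 2 * S <=
  rho / A * (theta^-1 * (rho * beta + 2 * zeta) * Delta / a ^+ 2
   + (theta * gamma0 * Delta + rho * L ^+ 2 / (theta * gamma0)) * (2 / (a * b))).
Proof.
move=> r0 b0 th0 A0 z0 g0 a0 bb0 D0 s0E h1 h2 h3.
pose p := a / b; have p0 : 0 < p by rewrite divr_gt0.
pose N := rho * L ^+ 2 * p / gamma0.
have N0 : 0 <= N.
  by apply: divr_ge0 (ltW g0); apply: mulr_ge0 (ltW p0); exact: mulr_ge0 (ltW r0) (sqr_ge0 _).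
pose Z := rho * beta + 2 * zeta.
have Z0 : 0 <= Z by rewrite addr_ge0// mulr_ge0// ltW.
pose E := 2 * theta ^+ 2 * gamma0 * p * Delta.
have E0 : 0 <= E.
  apply: mulr_ge0 => //; apply: mulr_ge0 (ltW p0); apply: mulr_ge0 (ltW g0).
  by apply: mulr_ge0 => //; exact: sqr_ge0.
pose Y := Z * Delta + E + 2 * N.
have {}h3 : theta * (A + nu / 3) * (rho * S) <= (rho + Z) * Delta + E + 9 / 4 * N.
  rewrite mulrCA; apply: le_trans (ler_wpM2l (ltW r0) h3) _.
  rewrite le_eqVlt; apply/orP; left; apply/eqP; rewrite s0E /E /N /Z /p.
  by field; rewrite !gt_eqF.
(* The gain 1 + t, with t = nu / (3 A), pays for both excesses over [Y]: rho Delta because rho <= t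
   Z, and 9/4 in place of 2 because t >= 1/8. *)
have kY : (rho + Z) * Delta + E + 9 / 4 * N <= (1 + nu / (3 * A)) * Y.
  pose t := nu / (3 * A).
  have t1 : rho <= t * Z by rewrite /t mulrAC ler_pdivlMr ?mulr_gt0// mulrCA mulrA.
  have t2 : 1 / 8 <= t by rewrite /t ler_pdivlMr ?mulr_gt0//; lra.
  have t3 := ler_wpM2r D0 t1.
  have t0 : 0 <= t by lra.
  have t4 : 0 <= t * E by rewrite mulr_ge0.
  have t5 := ler_wpM2r N0 t2.
  rewrite -/t /Y; move: t3 t4 t5 E0 N0; move: (t) (Z) (E) (N) => t' Z' E' N'; lra.
have kp : 0 < 1 + nu / (3 * A).
  have nu0 : 0 <= nu by lra.
  by rewrite ltr_pwDl// divr_ge0// mulr_ge0// ltW.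
have hS : theta * A * (rho * S) <= Y.
  rewrite -(ler_pM2l kp); apply: le_trans kY; apply: le_trans h3.
  rewrite le_eqVlt; apply/orP; left; apply/eqP.
  by field; rewrite gt_eqF.
have -> : rho ^+ 2 / a ^+ 2 * S = rho / (A * theta * a ^+ 2) * (theta * A * (rho * S)).
  by field; rewrite !gt_eqF.
have -> : rho / A * (theta^-1 * (rho * beta + 2 * zeta) * Delta / a ^+ 2
   + (theta * gamma0 * Delta + rho * L ^+ 2 / (theta * gamma0)) * (2 / (a * b)))
   = rho / (A * theta * a ^+ 2) * Y.
  by rewrite /Y /Z /E /N /p; field; rewrite !gt_eqF.
rewrite ler_wpM2l//; apply: divr_ge0 (ltW r0) _.
by apply: mulr_ge0 (sqr_ge0 _); rewrite mulr_ge0// ltW.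
Qed.

Lemma sum_neq_ord0 (R : realType) n (g : 'I_n.+2 -> R) :
  \sum_(i | i != ord0) g i = \sum_(i < n.+1) g (lift ord0 i).
Proof.
by apply: (addrI (g ord0)); rewrite -big_ord_recl [RHS](bigD1 ord0).
Qed.

(** * The method *)

Section Problem.
Variables (R : realType) (d : nat) (X : set 'rV[R]_d) (x0 : 'rV[R]_d).
Hypothesis Xx0 : X x0.
Hypothesis Xcl : closed X.
Hypothesis Xconv : forall u v (t : R), X u -> X v -> 0 <= t <= 1 ->
  X (t *: u + (1 - t) *: v).
Variables (dS : measure_display) (S : measurableType dS) (Xi : probability S R).
Variables (F : 'rV[R]_d -> S -> R) (fm : 'rV[R]_d -> 'rV[R]_d -> S -> R).
Variables (L lam tau beta gamma : R) (n : nat).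
Hypotheses (L0 : 0 <= L) (lam0 : 0 <= lam) (tau0 : 0 <= tau).
Hypothesis F_measurable : forall u, X u -> measurable_fun setT (F u).
Hypothesis F_lip : forall s, lipx X L (F ^~ s).
Hypothesis F_wcx : forall s, wcx X (lam + tau) (F ^~ s).
(* Only differences of losses matter, so the loss is normalised at [x0]; this
   makes every random variable below bounded. *)
Hypothesis F_x0 : forall s, F x0 s = 0.
Hypothesis fm_measurable : forall y, X y ->
  measurable_fun (X `*` setT : set (borel_rV R d * S)%type)
    (fun p : borel_rV R d * S => fm p.1 y p.2).
Hypothesis fm_wcx : forall s x, X x -> wcx X lam (fun u => fm x u s).
Hypothesis fm_lip : forall s x, X x -> lipx X L (fun u => fm x u s).
Hypothesis fm_eq : forall s x, X x -> fm x x s = F x s.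
Hypothesis fm_le : forall s x u, X x -> X u ->
  fm x u s <= F u s + tau / 2 * dot (u - x) (u - x).
Hypothesis fm_ge : forall s x u, X x -> X u ->
  F u s <= fm x u s + tau / 2 * dot (u - x) (u - x).
Hypotheses (gamma0 : 0 < gamma) (lam_gamma : lam < gamma).

Local Notation M := (n.+1%:R : R).

Definition pop u := ER Xi (F u).

Let X0 : X !=set0. Proof. by exists x0. Qed.

Let borelX : measurable (X : set (borel_rV R d)).
Proof.
rewrite -[X]setCK; apply: measurableC; apply: sub_sigma_algebra.
exact: closed_openC.
Qed.

Lemma F_norm u s : X u -> `|F u s| <= L * enorm (u - x0).
Proof.
by move=> Xu; rewrite -[F u s]subr0 -(F_x0 s); exact: lipx_norm (F_lip s) Xu Xx0.
Qed.

Lemma F_bmf u : X u -> bmf (F u).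
Proof.
move=> Xu; split; first exact: F_measurable.
by exists (L * enorm (u - x0)) => s; exact: F_norm.
Qed.

Lemma pop_lipx : lipx X L pop.
Proof.
move=> u v Xu Xv; rewrite /pop -ER_B; [|exact: F_bmf..].
rewrite -[leRHS](ER_cst Xi); apply: ER_le; [|exact: bmf_cst|].
  by apply: bmfB; exact: F_bmf.
by move=> s; exact: F_lip.
Qed.

Lemma pop_wcx : wcx X (lam + tau) pop.
Proof.
move=> u v t Xu Xv tt; rewrite /pop.
have bu := bmfZ t (F_bmf Xu); have bv := bmfZ (1 - t) (F_bmf Xv).
rewrite -(ER_Z Xi t (F_bmf Xu)) -(ER_Z Xi (1 - t) (F_bmf Xv)) -(ER_D Xi bu bv).
set k := (_ + _) / 2 * _; rewrite -[k](ER_cst Xi) -(ER_D Xi (bmfD bu bv) (bmf_cst _ _)).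
apply: ER_le.
- by apply: F_bmf; exact: Xconv.
- by apply: bmfD (bmf_cst _ _); exact: bmfD.
by move=> s; exact: F_wcx.
Qed.

Definition partial_model (j : 'I_n.+2) (s : 'I_n.+2 -> S) (x u : 'rV[R]_d) : R :=
  M^-1 * \sum_(i | i != j) fm x u (s i).

(** A function of samples and points alone, so that samples can be permuted or replaced; for [x] in
    [X] the value chosen is the unique minimiser. *)
Definition partial_step j s x' x : 'rV[R]_d :=
  xget x0 [set u | is_prox X (partial_model j s x) gamma (center beta x' x) u].

Let M0 : 0 < M. Proof. by rewrite ltr0Sn. Qed.

Let meanE (c : R) (j : 'I_n.+2) : c = M^-1 * \sum_(i | i != j) c.
Proof. by rewrite sumr_const cardC1 card_ord [n.+2.-1]/= -(mulr_natl c) mulKf// gt_eqF. Qed.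

Lemma partial_model_lipx j s x : X x -> lipx X L (partial_model j s x).
Proof.
move=> Xx; rewrite (meanE L j); apply: lipx_scale; first by rewrite invr_ge0 ltW.
by apply: lipx_sum => i _; exact: fm_lip.
Qed.

Lemma partial_model_wcx j s x : X x -> wcx X lam (partial_model j s x).
Proof.
move=> Xx; rewrite (meanE lam j); apply: wcx_scale; first by rewrite invr_ge0 ltW.
by apply: wcx_sum => i _; exact: fm_wcx.
Qed.

Lemma partial_stepP j s x' x : X x ->
  is_prox X (partial_model j s x) gamma (center beta x' x) (partial_step j s x' x).
Proof.
move=> Xx; have [u pu] :=
  prox_exists (center beta x' x) X0 Xcl gamma0 L0 (partial_model_lipx j s Xx).
exact: (xgetPex x0 (ex_intro _ u pu)).
Qed.

Lemma partial_step_in j s x' x : X x -> X (partial_step j s x' x).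
Proof. by move=> Xx; exact: proj1 (partial_stepP j s x' Xx). Qed.

Lemma partial_step_unique j s x' x u : X x ->
  is_prox X (partial_model j s x) gamma (center beta x' x) u ->
  u = partial_step j s x' x.
Proof.
move=> Xx pu; apply: (prox_unique Xconv lam_gamma (partial_model_wcx j s Xx) pu).
exact: partial_stepP.
Qed.

Lemma partial_step_ext j s s' x' x : (forall i, i != j -> s i = s' i) ->
  partial_step j s x' x = partial_step j s' x' x.
Proof.
move=> e; rewrite /partial_step (_ : partial_model j s x = partial_model j s' x)//.
by apply/funext => u; rewrite /partial_model; congr (_ * _); apply: eq_bigr => i /e ->.
Qed.

Lemma partial_step_tperm a b j s x' x :
  partial_step j (fun i => s (tperm a b i)) x' x = partial_step (tperm a b j) s x' x.
Proof.
rewrite /partial_step (_ : partial_model j (fun i => s (tperm a b i)) x =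
  partial_model (tperm a b j) s x)//.
apply/funext => u; rewrite /partial_model; congr (_ * _); rewrite [RHS](reindex_inj (@perm_inj _ (tperm a b))).
by apply: eq_bigl => i; rewrite (inj_eq perm_inj).
Qed.

Lemma partial_step_dist j s x' x : X x ->
  enorm (partial_step j s x' x - center beta x' x) <=
  enorm (x - center beta x' x) + 2 * L / gamma.
Proof.
move=> Xx; exact: prox_dist gamma0 L0 (partial_model_lipx j s Xx)
  (partial_stepP j s x' Xx) Xx.
Qed.

Section Measurability.
Variables (dU : measure_display) (U : measurableType dU).
Implicit Types (x u : U -> 'rV[R]_d).

(** A Caratheodory argument: jointly measurable in base point and sample, Lipschitz in the
    evaluation point. *)
Lemma measurable_model x u (s : U -> S) : mvec x -> (forall w, X (x w)) -> mvec u ->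
  (forall w, X (u w)) -> measurable_fun setT s ->
  measurable_fun setT (fun w => fm (x w) (u w) (s w)).
Proof.
move=> mx Xx mu Xu ms.
apply: (measurable_lipx_comp (h := fun w v => fm (x w) v (s w)) (L := L) X0) => //.
  by move=> w; exact: fm_lip.
move=> v Xv.
apply: (@measurable_comp _ _ _ U (borel_rV R d * S)%type _ (X `*` setT)
  (fun p : borel_rV R d * S => fm p.1 v p.2) setT (fun w => (x w : borel_rV R d, s w))).
- by apply: measurableX => //; exact: measurableT.
- by move=> _ [w _ <-] /=; split.
- exact: fm_measurable.
- by apply: measurable_fun_pair => //; exact: mvec_borel.
Qed.

Lemma measurable_loss u (s : U -> S) : mvec u -> (forall w, X (u w)) ->
  measurable_fun setT s -> measurable_fun setT (fun w => F (u w) (s w)).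
Proof.
move=> mu Xu ms.
have -> : (fun w => F (u w) (s w)) = (fun w => fm (u w) (u w) (s w)).
  by apply/funext => w; rewrite fm_eq.
exact: measurable_model.
Qed.

Lemma measurable_pop u : mvec u -> (forall w, X (u w)) ->
  measurable_fun setT (fun w => pop (u w)).
Proof.
move=> mu Xu; apply: (measurable_lipx_comp (h := fun _ => pop) (L := L) X0) => //.
by move=> _; exact: pop_lipx.
Qed.

Lemma mvec_partial_step j (s : 'I_n.+2 -> U -> S) x' x : mvec x' -> mvec x ->
  (forall w, X (x w)) -> (forall i, i != j -> measurable_fun setT (s i)) ->
  mvec (fun w => partial_step j (s ^~ w) (x' w) (x w)).
Proof.
move=> mx' mx Xx ms.
apply: (mvec_prox (h := fun w => partial_model j (s ^~ w) (x w))
  (z := fun w => center beta (x' w) (x w)) X0 Xconv L0 lam_gamma gamma0).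
- by move=> w; exact: partial_model_lipx.
- by move=> w; exact: partial_model_wcx.
- move=> u Xu; apply: measurable_funM; first exact: measurable_cst.
  apply: measurable_sumR => i ij.
  exact: (measurable_model mx Xx (@mvec_cst _ _ _ _ u) (fun=> Xu) (ms i ij)).
- by apply: mvecD => //; apply: mvecZ; exact: mvecB.
by move=> w; exact: partial_stepP.
Qed.

Lemma mvec_pop_prox rho (z h : U -> 'rV[R]_d) : 0 < rho -> lam + tau < rho -> mvec z ->
  (forall w, is_prox X pop rho (z w) (h w)) -> mvec h.
Proof.
move=> r0 cr mz ph; apply: (mvec_prox (h := fun=> pop) X0 Xconv L0 cr r0 _ _ _ mz ph).
- by move=> _; exact: pop_lipx.
- by move=> _; exact: pop_wcx.
by move=> u _; exact: measurable_cst.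
Qed.

End Measurability.


Section BoundedStep.
Variables (dU : measure_display) (U : measurableType dU).
Variables (xp x : U -> 'rV[R]_d) (s : 'I_n.+2 -> U -> S) (C : R).
Hypotheses (mxp : mvec xp) (mx : mvec x) (Xx : forall w, X (x w)).
Hypothesis ms : forall i, measurable_fun setT (s i).
Hypothesis xpC : forall w, enorm (xp w - x0) <= C.
Hypothesis xC : forall w, enorm (x w - x0) <= C.
Local Notation Z j w := (partial_step j (s ^~ w) (xp w) (x w)).

Lemma enorm_center w : enorm (x w - center beta (xp w) (x w)) <= `|beta| * (2 * C).
Proof.
rewrite /center opprD addrA subrr add0r enormN enormZ ler_wpM2l//.
apply: le_trans (enorm_triangle x0 _ _) _.
rewrite mulr_natl mulr2n; apply: lerD => //; by rewrite enormB.
Qed.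

Lemma bvec_step j : bvec (fun w => Z j w - center beta (xp w) (x w)).
Proof.
apply: (@bvecP _ _ _ _ _ (`|beta| * (2 * C) + 2 * L / gamma)).
  apply: mvecB; first by apply: mvec_partial_step => // i _.
  by apply: mvecD => //; apply: mvecZ; exact: mvecB.
move=> w; apply: le_trans (partial_step_dist j _ _ (Xx w)) _.
by rewrite lerD2r enorm_center.
Qed.

Lemma model_norm y u t : X y -> X u ->
  `|fm y u t| <= L * enorm (u - y) + L * enorm (y - x0).
Proof.
move=> Xy Xu; rewrite -[fm y u t](subrK (fm y y t)).
apply: le_trans (ler_normD _ _) _; apply: lerD.
  exact: (lipx_norm (fm_lip t Xy) Xu Xy).
by rewrite fm_eq//; exact: F_norm.
Qed.

Lemma bmf_model u i (D : R) : mvec u -> (forall w, X (u w)) ->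
  (forall w, enorm (u w - x w) <= D) -> bmf (fun w => fm (x w) (u w) (s i w)).
Proof.
move=> mu Xu uD; split; first exact: (measurable_model mx Xx mu Xu (ms i)).
exists (L * D + L * C) => w; apply: le_trans (model_norm _ (Xx w) (Xu w)) _.
by apply: lerD; rewrite ler_wpM2l.
Qed.

Lemma bmf_step_model i j : bmf (fun w => fm (x w) (Z j w) (s i w)).
Proof.
apply: (@bmf_model _ i (`|beta| * (2 * C) + 2 * L / gamma + `|beta| * (2 * C))).
- by apply: mvec_partial_step => // k _.
- by move=> w; exact: partial_step_in.
move=> w; apply: le_trans (enorm_triangle (center beta (xp w) (x w)) _ _) _.
apply: lerD; last by rewrite enormB enorm_center.
apply: le_trans (partial_step_dist j _ _ (Xx w)) _.
by rewrite lerD2r enorm_center.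
Qed.

End BoundedStep.

(** * Expected noise of one step *)

Section StepNoise.
Variables (dT : measure_display) (T : measurableType dT) (P : probability T R).
Variables (rho theta s0 : R) (xp x xn h : T -> 'rV[R]_d) (xi : 'I_n.+1 -> T -> S).
Variables (G : 'I_n.+1 -> set (set T)) (C : R).
Hypotheses (rho0 : 0 < rho) (rho_gt : lam + tau < rho).
Hypotheses (thetaE : theta = 1 - beta) (s00 : 0 < s0).
Hypothesis gamma_ge : s0 + lam + lam <= gamma.
Hypothesis Gm : forall j, G j `<=` @measurable _ T.
Hypothesis GI : forall j, setI_closed (G j).
Hypothesis GT : forall j, G j setT.
Hypothesis mxi : forall j, measurable_fun setT (xi j).
Hypothesis GX : forall j A B, G j A -> measurable B ->
  P (A `&` xi j @^-1` B) = (P A * Xi B)%E.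
Hypothesis Gxp : forall j, mvec (xp : g_sigma_algebraType (G j) -> 'rV[R]_d).
Hypothesis Gx : forall j, mvec (x : g_sigma_algebraType (G j) -> 'rV[R]_d).
Hypothesis Gxi : forall i j, i != j ->
  measurable_fun setT (xi i : g_sigma_algebraType (G j) -> S).
Hypothesis Xx : forall w, X (x w).
Hypothesis xpC : forall w, enorm (xp w - x0) <= C.
Hypothesis xC : forall w, enorm (x w - x0) <= C.
Local Notation Q := (P \x Xi)%E.
Local Notation batch w := (fun u => M^-1 * \sum_(i < n.+1) fm (x w) u (xi i w)).
Hypothesis xnP : forall w,
  is_prox X (batch w) gamma (center beta (xp w) (x w)) (xn w).
Hypothesis hP : forall w,
  is_prox X pop rho (extrapolate beta theta (xp w) (x w)) (h w).

(* The sample of index [ord0] is the fresh one. In [unfrozen], the [j]-th sample of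
   the batch is an independent variable too. *)
Definition ghosted (i : 'I_n.+2) (p : T * S) : S :=
  if unlift ord0 i is Some j then xi j p.1 else p.2.

Definition unfrozen (j : 'I_n.+1) (i : 'I_n.+2) (q : T * S * S) : S :=
  if unlift ord0 i is Some j' then if j' == j then q.1.2 else xi j' q.1.1 else q.2.

Local Notation T' j := (g_sigma_algebraType (G j)).

Lemma measurable_unfrozen j i :
  measurable_fun setT (unfrozen j i : T' j * S * S -> S).
Proof.
rewrite /unfrozen; case: unliftP => [k _|_]; last exact: measurable_snd.
case: eqP => [_|/eqP kj]; first exact: measurableT_comp measurable_snd measurable_fst.
apply: (measurableT_comp (f := xi k : T' j -> S)); first exact: Gxi.
exact: measurableT_comp measurable_fst measurable_fst.
Qed.

Lemma measurable_ghosted i : measurable_fun setT (ghosted i).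
Proof.
rewrite /ghosted; case: unliftP => [k _|_]; last exact: measurable_snd.
exact: measurableT_comp (mxi k) measurable_fst.
Qed.

Lemma unfrozen_here j p :
  (fun i => unfrozen j i ((p.1, xi j p.1), p.2)) = ghosted ^~ p.
Proof.
apply/funext => i; rewrite /unfrozen /ghosted; case: unliftP => // k _ /=.
by case: eqP => // ->.
Qed.

Lemma unfrozen_swap j p :
  (fun i => unfrozen j i ((p.1, p.2), xi j p.1)) =
  (fun i => ghosted (tperm ord0 (lift ord0 j) i) p).
Proof.
apply/funext => i; rewrite /unfrozen /ghosted.
case: (unliftP ord0 i) => [k ->|->]; last by rewrite tpermL liftK.
have [->|kj] /= := eqVneq k j; first by rewrite tpermR unlift_none.
by rewrite tpermD ?liftK ?neq_lift// (inj_eq lift_inj) eq_sym.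
Qed.

Lemma mvec_comp dU (U : measurableType dU) dV (V : measurableType dV)
    (g : V -> U) (u : U -> 'rV[R]_d) :
  measurable_fun setT g -> mvec u -> mvec (fun v => u (g v)).
Proof. by move=> mg mu i; exact: measurableT_comp (mu i) mg. Qed.

Lemma sub_mvec j (u : T -> 'rV[R]_d) : mvec (u : T' j -> 'rV[R]_d) -> mvec u.
Proof. by move=> mu i; exact: sub_sigma_measurable (@Gm j) _ _ _ (mu i). Qed.

(** The source of every swap hypothesis of [generalization_gap]. [Psi] may involve the past because
    [xp] and [x] are measurable for [G j]. *)
Lemma ER_ghost_swap j (Psi : 'rV[R]_d -> 'rV[R]_d -> ('I_n.+2 -> S) -> R) :
  bmf (fun q : T' j * S * S => Psi (xp q.1.1) (x q.1.1) (unfrozen j ^~ q)) ->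
  ER Q (fun p => Psi (xp p.1) (x p.1) (ghosted ^~ p)) =
  ER Q (fun p => Psi (xp p.1) (x p.1)
                   (fun i => ghosted (tperm ord0 (lift ord0 j) i) p)).
Proof.
move=> b; have := ER_freeze_swap (@Gm j) (@GI j) (@GT j) (mxi j) (@GX j) b.
under eq_fun do rewrite unfrozen_here.
by under [in RHS]eq_fun do rewrite unfrozen_swap.
Qed.


(** Linearity treats one sample at a time, so measurability of [u] for each [G j] is enough:
    freezing sample j replaces its loss by the population loss. *)
Lemma ER_batch_loss (u : T -> 'rV[R]_d) (D : R) :
  (forall j, mvec (u : T' j -> 'rV[R]_d)) -> (forall w, X (u w)) ->
  (forall w, enorm (u w - x0) <= D) ->
  [/\ bmf (fun w => M^-1 * \sum_(i < n.+1) F (u w) (xi i w)),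
      bmf (fun w => pop (u w)) &
      ER P (fun w => M^-1 * \sum_(i < n.+1) F (u w) (xi i w)) =
      ER P (fun w => pop (u w))].
Proof.
move=> mu Xu uD.
have mu' : mvec u := sub_mvec (mu ord0).
have bF j : bmf (fun w => F (u w) (xi j w)).
  split; first exact: (measurable_loss mu' Xu (mxi j)).
  by exists (L * D) => w; apply: le_trans (F_norm _ (Xu w)) _; rewrite ler_wpM2l.
have bp : bmf (fun w => pop (u w)).
  split; first exact: measurable_pop.
  exists (L * D) => w; apply: ER_bound; first exact: F_bmf.
  by move=> s; apply: le_trans (F_norm _ (Xu w)) _; rewrite ler_wpM2l.
split=> //; first by apply: bmfZ; exact: bmf_sum.
rewrite ER_Z; last exact: bmf_sum.
rewrite ER_sum// (eq_bigr (fun=> ER P (fun w => pop (u w)))) => [|j _].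
  by rewrite sumr_const card_ord -(mulr_natl (ER P _)) mulKf// gt_eqF.
have b2 : bmf (fun q : T' j * S => F (u q.1) q.2).
  split; last first.
    by exists (L * D) => q; apply: le_trans (F_norm _ (Xu q.1)) _; rewrite ler_wpM2l.
  exact: (measurable_loss (mvec_comp measurable_fst (mu j)) (fun q => Xu q.1)
    measurable_snd).
exact: (ER_freeze (@Gm j) (@GI j) (@GT j) (mxi j) (@GX j) b2).
Qed.

Let mxp : mvec xp := sub_mvec (@Gxp ord0).
Let mx : mvec x := sub_mvec (@Gx ord0).

Lemma partial_model_batch p u :
  partial_model ord0 (ghosted ^~ p) (x p.1) u =
  M^-1 * \sum_(i < n.+1) fm (x p.1) u (xi i p.1).
Proof.
rewrite /partial_model sum_neq_ord0; congr (_ * _).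
by apply: eq_bigr => i _; rewrite /ghosted liftK.
Qed.

Lemma next_partial_step p :
  xn p.1 = partial_step ord0 (ghosted ^~ p) (xp p.1) (x p.1).
Proof.
apply: partial_step_unique => //.
rewrite (_ : partial_model _ _ _ = batch p.1)//.
by apply/funext => u; exact: partial_model_batch.
Qed.

Let mxp1 : mvec (fun p : T * S => xp p.1) := mvec_comp measurable_fst mxp.
Let mx1 : mvec (fun p : T * S => x p.1) := mvec_comp measurable_fst mx.
Let cen (p : T * S) := center beta (xp p.1) (x p.1).
Let Zg j (p : T * S) := partial_step j (ghosted ^~ p) (xp p.1) (x p.1).

Let bZ j : bvec (fun p => Zg j p - cen p).
Proof.
exact: (bvec_step mxp1 mx1 (fun p => Xx p.1) measurable_ghosted
  (fun p => xpC p.1) (fun p => xC p.1)).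
Qed.

Let bf i j : bmf (fun p => fm (x p.1) (Zg j p) (ghosted i p)).
Proof.
exact: (bmf_step_model mxp1 mx1 (fun p => Xx p.1) measurable_ghosted
  (fun p => xpC p.1) (fun p => xC p.1)).
Qed.

Lemma ghosted_gap :
  ER Q (fun p => fm (x p.1) (xn p.1) p.2)
  - M^-1 * (\sum_(j < n.+1) ER Q (fun p => fm (x p.1) (xn p.1) (xi j p.1)))
  - (s0 + lam) / 2 * ER Q (fun p => dot (xn p.1 - cen p) (xn p.1 - cen p))
  <= 9 / 8 * (L ^+ 2 / (M * s0)).
Proof.
have mUp j : mvec (fun q : T' j * S * S => xp q.1.1).
  exact: (mvec_comp (measurableT_comp measurable_fst measurable_fst) (@Gxp j)).
have mU j : mvec (fun q : T' j * S * S => x q.1.1).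
  exact: (mvec_comp (measurableT_comp measurable_fst measurable_fst) (@Gx j)).
have bUZ j i : bvec (fun q : T' j * S * S =>
    partial_step i (unfrozen j ^~ q) (xp q.1.1) (x q.1.1)
    - center beta (xp q.1.1) (x q.1.1)).
  exact: (bvec_step (mUp j) (mU j) (fun q => Xx q.1.1) (@measurable_unfrozen j)
    (fun q => xpC q.1.1) (fun q => xC q.1.1)).
have swapf j i l : ER Q (fun p => fm (x p.1) (Zg l p) (ghosted i p)) =
    ER Q (fun p => fm (x p.1) (Zg (tperm ord0 (lift ord0 j) l) p)
                      (ghosted (tperm ord0 (lift ord0 j) i) p)).
  rewrite (@ER_ghost_swap j (fun x' x s => fm x (partial_step l s x' x) (s i))).
    by congr ER; apply/funext => p; rewrite (partial_step_tperm _ _ _ (ghosted ^~ p)).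
  exact: (bmf_step_model (mUp j) (mU j) (fun q => Xx q.1.1) (@measurable_unfrozen j)
    (fun q => xpC q.1.1) (fun q => xC q.1.1)).
have tR j : tperm ord0 (lift ord0 j) (lift ord0 j) = ord0 :> 'I_n.+2 by rewrite tpermR.
have tL j : tperm ord0 (lift ord0 j) ord0 = lift ord0 j :> 'I_n.+2 by rewrite tpermL.
have := @generalization_gap R d X Xconv n _ _ Q
  (fun i p u => fm (x p.1) u (ghosted i p)) Zg cen L lam gamma s0 lam0 s00 gamma_ge.
have -> : (fun p => fm (x p.1) (xn p.1) p.2) =
    (fun p => fm (x p.1) (Zg ord0 p) (ghosted ord0 p)).
  by apply/funext => p; rewrite /Zg -next_partial_step /ghosted unlift_none.
have -> : (fun p => dot (xn p.1 - cen p) (xn p.1 - cen p)) =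
    (fun p => dot (Zg ord0 p - cen p) (Zg ord0 p - cen p)).
  by apply/funext => p; rewrite /Zg -next_partial_step.
have -> : \sum_(j < n.+1) ER Q (fun p => fm (x p.1) (xn p.1) (xi j p.1)) =
    \sum_(j < n.+1) ER Q (fun p => fm (x p.1) (Zg ord0 p) (ghosted (lift ord0 j) p)).
  apply: eq_bigr => j _; congr ER; apply/funext => p.
  by rewrite /Zg -next_partial_step /ghosted liftK.
apply.
- by move=> i p; exact: fm_lip.
- by move=> i p; exact: fm_wcx.
- by move=> j p; exact: partial_stepP.
- exact: bf.
- exact: bZ.
- by move=> j; rewrite (swapf j) tR.
- by move=> j; rewrite (swapf j) tR tL.
- move=> j; rewrite (@ER_ghost_swap j (fun x' x s =>
    dot (partial_step (lift ord0 j) s x' x - center beta x' x)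
        (partial_step (lift ord0 j) s x' x - center beta x' x))); last exact: bmf_dot.
  by congr ER; apply/funext => p; rewrite (partial_step_tperm _ _ _ (ghosted ^~ p)) tR.
- move=> i j ij; rewrite (@ER_ghost_swap j (fun x' x s =>
    dot (partial_step (lift ord0 i) s x' x - partial_step (lift ord0 j) s x' x)
        (partial_step (lift ord0 i) s x' x - partial_step (lift ord0 j) s x' x))).
    congr ER; apply/funext => p; rewrite !(partial_step_tperm _ _ _ (ghosted ^~ p)) tR.
    rewrite tpermD ?neq_lift// ?(inj_eq lift_inj) 1?eq_sym//.
    by rewrite -/(Zg _ p) -opprB dotNl dotNr opprK.
  have e : (fun q : T' j * S * S =>
      partial_step (lift ord0 i) (unfrozen j ^~ q) (xp q.1.1) (x q.1.1)
      - partial_step (lift ord0 j) (unfrozen j ^~ q) (xp q.1.1) (x q.1.1)) =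
    (fun q => (partial_step (lift ord0 i) (unfrozen j ^~ q) (xp q.1.1) (x q.1.1)
        - center beta (xp q.1.1) (x q.1.1))
      - (partial_step (lift ord0 j) (unfrozen j ^~ q) (xp q.1.1) (x q.1.1)
        - center beta (xp q.1.1) (x q.1.1))).
    by apply/funext => q; rewrite opprB addrA subrK.
  have bd := bvecB (bUZ j (lift ord0 i)) (bUZ j (lift ord0 j)).
  rewrite -e in bd; exact: bmf_dot.
move=> j.
(* The step without the fresh sample, as a function of its j-th sample alone. [A] is thus x_0 - y at
   the j-th sample and x_j - y at the fresh one; [q.2] merely fills the slot that
   [partial_step ord0] skips. *)
pose sV i (q : T' j * S) : S := unfrozen j i (q, q.2).
have msV i : measurable_fun setT (sV i).
  apply: (measurableT_comp (@measurable_unfrozen j i)).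
  by apply: measurable_fun_pair; [exact: measurable_id|exact: measurable_snd].
pose A (q : T' j * S) := partial_step ord0 (sV ^~ q) (xp q.1) (x q.1)
  - center beta (xp q.1) (x q.1).
have bA : bvec A.
  exact: (bvec_step (mvec_comp measurable_fst (@Gxp j)) (mvec_comp measurable_fst (@Gx j))
    (fun q => Xx q.1) msV (fun q => xpC q.1) (fun q => xC q.1)).
have -> : (fun p => dot (Zg ord0 p - cen p) (Zg (lift ord0 j) p - cen p)) =
    (fun p => dot (A (p.1, xi j p.1)) (A (p.1, p.2))).
  apply/funext => p; congr dot.
    rewrite /A /Zg /cen /=; congr (_ - _); apply: partial_step_ext => i i0.
    rewrite -[ghosted i p]/((ghosted ^~ p) i) -(unfrozen_here j) /sV /unfrozen.
    by case: unliftP i0 => [k ->|->] //; rewrite eqxx.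
  rewrite /A /Zg /cen /=; congr (_ - _).
  rewrite -[in LHS](tL j) -(partial_step_tperm _ _ _ (ghosted ^~ p)); apply: partial_step_ext => i i0.
  rewrite -[LHS]/((fun i => ghosted (tperm ord0 (lift ord0 j) i) p) i) -unfrozen_swap.
  rewrite /sV /unfrozen.
  by case: unliftP i0 => [k ->|->] //; rewrite eqxx.
rewrite /dot ER_sum => [|i]; last first.
  have mfs := measurable_freeze_ghost2 (@Gm j) (mxi j).
  have mfx := measurable_freeze_ghost1 (@Gm j) (mxi j).
  apply: bmfM.
    exact: (bmf_comp (measurableT_comp measurable_fst mfx) (bA i)).
  exact: (bmf_comp (measurableT_comp measurable_fst mfs) (bA i)).
apply: sumr_ge0 => i _.
exact: (ER_freeze_cov_ge0 (@Gm j) (@GI j) (@GT j) (mxi j) (@GX j) (bA i)).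
Qed.


Lemma mvec_next : mvec xn.
Proof.
have -> : xn = (fun w => partial_step ord0 (fun i => ghosted i (w, point)) (xp w) (x w)).
  by apply/funext => w; rewrite -(next_partial_step (w, point)).
apply: (mvec_partial_step (s := fun i w => ghosted i (w, point)) mxp mx Xx) => i _.
apply: (measurableT_comp (measurable_ghosted i)).
by apply: measurable_fun_pair; [exact: measurable_id|exact: measurable_cst].
Qed.

Lemma next_in w : X (xn w). Proof. exact: proj1 (xnP w). Qed.

Let K1 := `|beta| * (2 * C).

Lemma next_dist w : enorm (xn w - center beta (xp w) (x w)) <= K1 + 2 * L / gamma.
Proof.
have pm : lipx X L (batch w).
  move=> u v Xu Xv; rewrite -!(partial_model_batch (w, point)).
  exact: partial_model_lipx.
apply: le_trans (prox_dist gamma0 L0 pm (xnP w) (Xx w)) _.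
by rewrite lerD2r; exact: (enorm_center xpC xC).
Qed.

Lemma next_bound w : enorm (xn w - x0) <= K1 + 2 * L / gamma + K1 + C.
Proof.
apply: le_trans (enorm_triangle (x w) _ _) _; apply: lerD => //.
apply: le_trans (enorm_triangle (center beta (xp w) (x w)) _ _) _.
apply: lerD; first exact: next_dist.
by rewrite enormB; exact: (enorm_center xpC xC).
Qed.

Let K2 := `|beta / theta| * (2 * C).

Lemma prox_extrapolate_dist w :
  enorm (h w - extrapolate beta theta (xp w) (x w)) <= K2 + 2 * L / rho.
Proof.
apply: le_trans (prox_dist rho0 L0 pop_lipx (hP w) (Xx w)) _.
rewrite lerD2r /extrapolate opprD addrA subrr add0r enormN enormZ ler_wpM2l//.
apply: le_trans (enorm_triangle x0 _ _) _.
rewrite mulr_natl mulr2n; apply: lerD => //; by rewrite enormB.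
Qed.

Lemma prox_bound w : enorm (h w - x0) <= K2 + 2 * L / rho + K2 + C.
Proof.
apply: le_trans (enorm_triangle (extrapolate beta theta (xp w) (x w)) _ _) _.
rewrite -(addrA (K2 + 2 * L / rho)); apply: lerD; first exact: prox_extrapolate_dist.
apply: le_trans (enorm_triangle (x w) _ _) _; apply: lerD => //.
rewrite /extrapolate addrC addKr enormZ ler_wpM2l//.
apply: le_trans (enorm_triangle x0 _ _) _.
rewrite mulr_natl mulr2n; apply: lerD => //; by rewrite enormB.
Qed.

Lemma bmf_prox_extrapolate :
  bmf (fun w => dot (h w - extrapolate beta theta (xp w) (x w))
                    (h w - extrapolate beta theta (xp w) (x w))).
Proof.
have mz : mvec (fun w => extrapolate beta theta (xp w) (x w)).
  by apply: mvecD => //; apply: mvecZ; exact: mvecB.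
have mh : mvec h := mvec_pop_prox rho0 rho_gt mz hP.
suff vh : bvec (fun w => h w - extrapolate beta theta (xp w) (x w)) by exact: bmf_dot.
exact: bvecP (mvecB mh mz) prox_extrapolate_dist.
Qed.

Theorem ER_step_noise :
  let noise w := step_noise lam tau beta theta s0 pop
    (fun u => M^-1 * \sum_(i < n.+1) F u (xi i w)) (batch w)
    (xp w) (x w) (xn w) (h w) in
  bmf noise /\ ER P noise <= 9 / 8 * (L ^+ 2 / (M * s0)).
Proof.
move=> noise.
(* [h] depends on the past only, through the extrapolated point; this is what centres its loss
   term. *)
have Gh j : mvec (h : T' j -> 'rV[R]_d).
  have Gz : mvec (fun w : T' j => extrapolate beta theta (xp w) (x w)).
    apply: mvecD; first exact: Gx.
    by apply: mvecZ; apply: mvecB; [exact: Gx|exact: Gxp].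
  exact: (mvec_pop_prox (U := T' j) rho0 rho_gt Gz hP).
have [bFh bph eh] := ER_batch_loss Gh (fun w => proj1 (hP w)) prox_bound.
have [bFx bpx ex] := ER_batch_loss (@Gx) Xx xC.
have mxn := mvec_next.
have bpn : bmf (fun w => pop (xn w)).
  split; first exact: (measurable_pop mxn next_in).
  exists (L * (K1 + 2 * L / gamma + K1 + C)) => w; apply: ER_bound.
    exact: F_bmf (next_in w).
  by move=> s; apply: le_trans (F_norm _ (next_in w)) _; rewrite ler_wpM2l// next_bound.
have dxn w : enorm (xn w - x w) <= K1 + 2 * L / gamma + K1.
  apply: le_trans (enorm_triangle (center beta (xp w) (x w)) _ _) _.
  by apply: lerD; [exact: next_dist|rewrite enormB; exact: (enorm_center xpC xC)].
have vD := bvecP (mvecB mxn mx) dxn.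
have bD := bmf_dot vD vD.
have mc : mvec (fun w => center beta (xp w) (x w)).
  by apply: mvecD => //; apply: mvecZ; exact: mvecB.
have vn := bvecP (mvecB mxn mc) next_dist.
have bn := bmf_dot vn vn.
have bm j : bmf (fun w => fm (x w) (xn w) (xi j w)).
  exact: (@bmf_model _ _ x (fun=> xi j) C mx Xx (fun=> mxi j) xC xn ord0 _ mxn next_in dxn).
have bmb : bmf (fun w => M^-1 * \sum_(i < n.+1) fm (x w) (xn w) (xi i w)).
  by apply: bmfZ; exact: bmf_sum.
have mxn1 : mvec (fun p : T * S => xn p.1) := mvec_comp measurable_fst mxn.
have bQF : bmf (fun p : T * S => F (xn p.1) p.2).
  split; first exact: (measurable_loss mxn1 (fun p => next_in p.1) measurable_snd).
  exists (L * (K1 + 2 * L / gamma + K1 + C)) => p.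
  by apply: le_trans (F_norm _ (next_in p.1)) _; rewrite ler_wpM2l// next_bound.
have bQm : bmf (fun p : T * S => fm (x p.1) (xn p.1) p.2).
  exact: (@bmf_model _ _ (fun p : T * S => x p.1) (fun=> snd) C mx1
    (fun p => Xx p.1) (fun=> measurable_snd) (fun p => xC p.1) (fun p => xn p.1) ord0 _
    mxn1 (fun p => next_in p.1) (fun p => dxn p.1)).
have bQD : bmf (fun p : T * S => dot (xn p.1 - x p.1) (xn p.1 - x p.1)).
  exact: (bmf_comp measurable_fst bD).
(* The fresh sample is independent of x^{k+1}, so the population value there is the mean fresh loss,
   and [fm_ge] passes to the fresh model. *)
have fresh : ER P (fun w => pop (xn w)) <= ER Q (fun p => fm (x p.1) (xn p.1) p.2)
    + tau / 2 * ER P (fun w => dot (xn w - x w) (xn w - x w)).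
  rewrite -(ER_fst P Xi bD) -(ER_Z _ _ bQD) -(ER_D _ bQm (bmfZ _ bQD)).
  have <- : ER Q (fun p => F (xn p.1) p.2) = ER P (fun w => pop (xn w)).
    by rewrite (ER_fubini1 _ _ bQF).
  apply: ER_le => // [|p]; first exact: bmfD bQm (bmfZ _ bQD).
  by apply: fm_ge => //; exact: next_in.
have gap := ghosted_gap.
rewrite (ER_fst P Xi bn) in gap.
have eb : ER P (fun w => M^-1 * \sum_(i < n.+1) fm (x w) (xn w) (xi i w)) =
    M^-1 * \sum_(j < n.+1) ER Q (fun p => fm (x p.1) (xn p.1) (xi j p.1)).
  rewrite ER_Z; last exact: bmf_sum.
  rewrite ER_sum//; congr (_ * _); apply: eq_bigr => j _.
  by rewrite (ER_fst P Xi (bm j)).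
rewrite -eb in gap.
have b1 := bmfZ theta (bmfB bFh bph).
have b2 := bmfZ beta (bmfB bFx bpx).
have b3 := bmfB bpn (bmfZ (tau / 2) bD).
have b4 := bmfB b3 bmb.
have b5 := bmfB b4 (bmfZ ((s0 + lam) / 2) bn).
have b12 := bmfD b1 b2.
have b := bmfD b12 b5.
split; first exact: b.
rewrite [ER P noise](ER_D P b12 b5) (ER_D P b1 b2).
rewrite (ER_Z P theta (bmfB bFh bph)) (ER_Z P beta (bmfB bFx bpx)).
rewrite (ER_B P bFh bph) (ER_B P bFx bpx) eh ex !subrr !mulr0 addr0 add0r.
rewrite (ER_B P b4 (bmfZ ((s0 + lam) / 2) bn)) (ER_B P b3 bmb).
rewrite (ER_B P bpn (bmfZ (tau / 2) bD)) (ER_Z P (tau / 2) bD).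
rewrite (ER_Z P ((s0 + lam) / 2) bn).
apply: le_trans gap; rewrite !lerD2r lerBlDr; exact: fresh.
Qed.

End StepNoise.

(** * Summation over the iterations *)

Section Method.
Variables (dT : measure_display) (T : measurableType dT) (P : probability T R).
Variables (K : nat) (xi : nat -> 'I_n.+1 -> T -> S) (x h : nat -> T -> 'rV[R]_d).
Variables (rho theta zeta nu s0 q Delta : R).
Hypothesis mxi : forall k i, measurable_fun setT (xi k i).
Hypothesis xi_law : forall k i A, (1 <= k <= K)%N -> measurable A ->
  P (xi k i @^-1` A) = Xi A.
Hypothesis xi_indep :
  mutually_independent P (fun p : 'I_K * 'I_n.+1 => xi p.1.+1 p.2).
Hypotheses (x_0 : forall w, x 0%N w = x0) (x_1 : forall w, x 1%N w = x0).
Hypothesis x_step : forall k w, (1 <= k <= K)%N ->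
  is_prox X (fun u => M^-1 * \sum_(i < n.+1) fm (x k w) u (xi k i w)) gamma
    (center beta (x k.-1 w) (x k w)) (x k.+1 w).
Hypothesis h_prox : forall k w,
  is_prox X pop rho (extrapolate beta theta (x k.-1 w) (x k w)) (h k w).
Hypotheses (rho0 : 0 < rho) (beta01 : 0 <= beta < 1) (thetaE : theta = 1 - beta).
Hypotheses (nuE : nu = rho - lam - tau) (nu_ge : 2 * (tau + lam) <= nu).
Hypotheses (s00 : 0 < s0) (zeta0 : 0 < zeta).
Hypotheses (qE : q = zeta / theta ^+ 2 - rho / 2 - nu) (q0 : 0 <= q).
Hypothesis hpar : tau + rho * beta ^+ 2 / theta / 2
  + (rho / 2 + nu) * beta ^+ 3 / theta <= q * theta ^+ 2.
Hypothesis gammaE : gamma = s0 + zeta / theta ^+ 2 + lam.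
Hypothesis gamma_ge : s0 + lam + lam <= gamma.
Hypothesis rho_gt : lam + tau < rho.
Hypothesis Delta_ge : forall u, X u -> - pop u <= Delta.

Lemma iter_in k w : (k <= K.+1)%N -> X (x k w).
Proof.
case: k => [|[|k]] kK; first by rewrite x_0.
  by rewrite x_1.
by have [] := @x_step k.+1 w kK.
Qed.

(** A step uses the two previous points, so the induction carries two consecutive ones. The radius
    may depend on [k], since it serves boundedness only. *)
Lemma iter_bound k : (k <= K.+1)%N -> exists C, forall w, enorm (x k w - x0) <= C.
Proof.
have two j : (j <= K)%N -> exists C, forall w,
    enorm (x j w - x0) <= C /\ enorm (x j.+1 w - x0) <= C.
  elim: j => [_|j IH jK].
    by exists 0 => w; rewrite x_0 x_1 subrr enorm0.
  have [C HC] := IH (ltnW jK); have C0 : 0 <= C.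
    by apply: le_trans (proj1 (HC point)); exact: enorm_ge0.
  have Xx w : X (x j.+1 w) by apply: iter_in; exact: ltnW.
  have B := next_bound Xx (fun w => proj1 (HC w)) (fun w => proj2 (HC w))
    (fun w => x_step w (jK : (1 <= j.+1 <= K)%N)).
  exists (`|beta| * (2 * C) + 2 * L / gamma + `|beta| * (2 * C) + C) => w.
  split; last exact: B.
  apply: le_trans (proj2 (HC w)) _; rewrite lerDr.
  by rewrite !addr_ge0 ?divr_ge0 ?mulr_ge0// ltW.
case: k => [_|k kK]; first by exists 0 => w; rewrite x_0 subrr enorm0.
by have [C HC] := two k kK; exists C => w; exact: (proj2 (HC w)).
Qed.

(** The map [phi] makes room for coarser sigma-algebras: with [phi] the identity from such a space,
    measurability of the earlier samples is all that is asked. *)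
Lemma iter_mvec dU (U : measurableType dU) (phi : U -> T) k : (k <= K.+1)%N ->
  (forall k' i, (1 <= k' < k)%N -> measurable_fun setT (fun u => xi k' i (phi u))) ->
  mvec (fun u => x k (phi u)).
Proof.
have two j : (j <= K)%N ->
    (forall k' i, (1 <= k' < j.+1)%N -> measurable_fun setT (fun u => xi k' i (phi u))) ->
    mvec (fun u => x j (phi u)) /\ mvec (fun u => x j.+1 (phi u)).
  elim: j => [_ _|j IH jK mk].
    split; [under eq_fun do rewrite x_0|under eq_fun do rewrite x_1]; exact: mvec_cst.
  have [m1 m2] := IH (ltnW jK) (fun k' i (kk : (1 <= k' < j.+1)%N) =>
    mk k' i (introT andP (conj (proj1 (andP kk)) (ltnW (proj2 (andP kk)))))).
  split=> //.
  have Xx u : X (x j.+1 (phi u)) by apply: iter_in; exact: ltnW.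
  pose s i u := if unlift ord0 i is Some l then xi j.+1 l (phi u) else point.
  have e : (fun u => x j.+2 (phi u)) =
      (fun u => partial_step ord0 (s ^~ u) (x j (phi u)) (x j.+1 (phi u))).
    apply/funext => u; apply: partial_step_unique => //.
    have := x_step (phi u) (jK : (1 <= j.+1 <= K)%N).
    rewrite (_ : partial_model _ _ _ = (fun v => M^-1 *
      \sum_(i < n.+1) fm (x j.+1 (phi u)) v (xi j.+1 i (phi u))))//.
    apply/funext => v; rewrite /partial_model sum_neq_ord0; congr (_ * _).
    by apply: eq_bigr => i _; rewrite /s liftK.
  rewrite e; apply: (mvec_partial_step (s := s) m1 m2 Xx) => i _; rewrite /s.
  case: unliftP => [l _|_]; last exact: measurable_cst.
  by apply: mk; rewrite ltnS leqnn.
case: k => [_ _|k kK mk]; first by under eq_fun do rewrite x_0; exact: mvec_cst.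
exact: (proj2 (two k kK mk)).
Qed.

Let noise (k : 'I_K) w := step_noise lam tau beta theta s0 pop
  (fun u => M^-1 * \sum_(i < n.+1) F u (xi k.+1 i w))
  (fun u => M^-1 * \sum_(i < n.+1) fm (x k.+1 w) u (xi k.+1 i w))
  (x k w) (x k.+1 w) (x k.+2 w) (h k.+1 w).

(* [rho ^+ 2] times this is the squared norm of the gradient of the Moreau envelope
   at the extrapolated point. *)
Definition gap_sq k w :=
  dot (h k w - extrapolate beta theta (x k.-1 w) (x k w))
      (h k w - extrapolate beta theta (x k.-1 w) (x k w)).

Let famX (p : 'I_K * 'I_n.+1) := xi p.1.+1 p.2.

Lemma step_expectations (k : 'I_K) :
  [/\ bmf (gap_sq k.+1), bmf (noise k) &
      ER P (noise k) <= 9 / 8 * (L ^+ 2 / (M * s0))].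
Proof.
have kK : (k < K)%N := ltn_ord k.
have [C1 HC1] := iter_bound (leqW (ltnW kK)).
have [C2 HC2] := iter_bound (leqW kK).
pose C := Num.max C1 C2.
have xpC w : enorm (x k w - x0) <= C by rewrite le_max HC1.
have xC w : enorm (x k.+1 w - x0) <= C by rewrite le_max HC2 orbT.
have Xx w : X (x k.+1 w) by apply: iter_in; exact: ltnW.
have mX p : measurable_fun setT (famX p) by exact: mxi.
(* All samples of all steps but this one, later ones included; the current points and the rest of
   the batch are measurable for it. *)
pose G j := others famX (k, j).
have mpast j k' i : (1 <= k' < k.+1)%N ->
    measurable_fun setT (xi k' i : g_sigma_algebraType (G j) -> S).
  case: k' => // k' /= k'k.
  have k'K : (k' < K)%N by apply: leq_ltn_trans kK; exact: ltnW.
  apply: (@others_measurable_fun _ _ _ _ _ famX (k, j) (Ordinal k'K, i)).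
  by rewrite xpair_eqE negb_and -val_eqE /= neq_ltn (k'k : (k' < k)%N).
have GX j A B : G j A -> measurable B -> P (A `&` xi k.+1 j @^-1` B) = (P A * Xi B)%E.
  move=> GA mB; rewrite -(@xi_law k.+1 j B)//.
  exact: (others_indep (X := famX) xi_indep GA mB).
have Gxp j : mvec (x k : g_sigma_algebraType (G j) -> 'rV[R]_d).
  apply: (@iter_mvec _ (g_sigma_algebraType (G j)) (fun w => w) k); first exact: leqW (ltnW kK).
  by move=> k' i /andP[a b]; apply: mpast; rewrite a ltnW.
have Gx j : mvec (x k.+1 : g_sigma_algebraType (G j) -> 'rV[R]_d).
  apply: (@iter_mvec _ (g_sigma_algebraType (G j)) (fun w => w) k.+1); first exact: ltnW.
  by move=> k' i kk; apply: mpast.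
have Gxi i j : i != j ->
    measurable_fun setT (xi k.+1 i : g_sigma_algebraType (G j) -> S).
  move=> ij; apply: (@others_measurable_fun _ _ _ _ _ famX (k, j) (k, i)).
  by rewrite xpair_eqE eqxx.
have Gm j : G j `<=` @measurable _ T by exact: others_measurable.
have GI j : setI_closed (G j) by exact: others_setI.
have GT j : G j setT by exact: others_setT.
have kK1 : (1 <= k.+1 <= K)%N by [].
have [b1 b2] := ER_step_noise rho0 rho_gt s00 gamma_ge Gm GI GT (fun j => @mxi k.+1 j)
  GX Gxp Gx Gxi Xx xpC xC (fun w => x_step w kK1) (h_prox k.+1).
split=> //.
exact: (bmf_prox_extrapolate rho0 rho_gt Gm Gxp Gx Xx xpC xC (h_prox k.+1)).
Qed.


Let gapM k w := prox_obj pop rho (extrapolate beta theta (x k.-1 w) (x k w)) (h k w).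
Let sqD k w := dot (x k w - x k.-1 w) (x k w - x k.-1 w).

Let theta_gt0 : 0 < theta.
Proof. by case/andP: beta01 => _ b1; rewrite thetaE subr_gt0. Qed.

Lemma path_bound w :
  theta * (rho - theta * lam + nu / 3) * \sum_(k < K) gap_sq k.+1 w <=
  ((1 + beta) + 2 * (s0 * theta ^+ 2 + zeta) / rho) * Delta
  + 2 * \sum_(k < K) noise k w.
Proof.
set c := 2 * (s0 * theta ^+ 2 + zeta) / rho.
have c0 : 0 <= c.
  apply: divr_ge0; last exact: ltW.
  by rewrite mulr_ge0// addr_ge0 ?(ltW zeta0)// mulr_ge0 ?sqr_ge0// ltW.
have b0 : 0 <= beta by case/andP: beta01.
have nu0 : 0 <= nu by apply: le_trans nu_ge; rewrite mulr_ge0// addr_ge0.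
(* The telescoped squared increments start at 0 because x^1 = x^0, so this sign lets them be
   dropped. *)
have C10 : 0 <= q * theta - tau.
  rewrite subr_ge0; apply: (@le_trans _ _ (q * theta ^+ 2)).
    apply: le_trans hpar; rewrite -addrA lerDl addr_ge0//.
      by rewrite !divr_ge0 ?mulr_ge0 ?sqr_ge0 ?(ltW rho0) ?(ltW theta_gt0).
    rewrite divr_ge0 ?(ltW theta_gt0)// mulr_ge0 ?exprn_ge0// addr_ge0//.
    by rewrite divr_ge0// ltW.
  rewrite ler_wpM2l// expr2 ler_piMl ?(ltW theta_gt0)//.
  by rewrite thetaE lerBlDr lerDl.
have step (k : 'I_K) : theta * (rho - theta * lam + nu / 3) * gap_sq k.+1 w <=
    (1 + beta) * (pop (x k.+1 w) - pop (x k.+2 w))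
    + c * (gapM k.+1 w - gapM k.+2 w) + (q * theta - tau) * (sqD k.+1 w - sqD k.+2 w)
    + 2 * noise k w.
  have kK : (k < K)%N := ltn_ord k.
  have Xk : X (x k.+1 w) by apply: iter_in; exact: ltnW.
  apply: (@descent_step R d X Xconv lam tau rho beta theta zeta nu s0 q) => //.
  - exact: pop_wcx.
  - have wp : wcx X lam (partial_model ord0
        (fun i => if unlift ord0 i is Some l then xi k.+1 l w else point) (x k.+1 w)).
      exact: partial_model_wcx.
    rewrite (_ : (fun u => _) = partial_model ord0
        (fun i => if unlift ord0 i is Some l then xi k.+1 l w else point) (x k.+1 w))//.
    apply/funext => u; rewrite /partial_model sum_neq_ord0; congr (_ * _).
    by apply: eq_bigr => i _; rewrite liftK.
  - by congr (_ * _); apply: eq_bigr => i _; rewrite fm_eq.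
  - move=> u Xu.
    have -> : tau / 2 * dot (u - x k.+1 w) (u - x k.+1 w) =
        M^-1 * \sum_(i < n.+1) (tau / 2 * dot (u - x k.+1 w) (u - x k.+1 w)).
      by rewrite sumr_const card_ord -(mulr_natl (_ * _)) mulKf// gt_eqF.
    rewrite -mulrDr -big_split/= ler_wpM2l ?invr_ge0 ?(ltW M0)//.
    by apply: ler_sum => i _; exact: fm_le.
  - by rewrite -gammaE; exact: (x_step w (kK : (1 <= k.+1 <= K)%N)).
  - exact: (h_prox k.+2 w).
have [N NE] : exists N : 'I_K -> R, forall k, noise k w = N k by exists (noise ^~ w).
rewrite [X in _ + 2 * X](eq_bigr N); last by move=> k _; exact: NE.
have {}step (k : 'I_K) : theta * (rho - theta * lam + nu / 3) * gap_sq k.+1 w <=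
    (1 + beta) * (pop (x k.+1 w) - pop (x k.+2 w))
    + c * (gapM k.+1 w - gapM k.+2 w) + (q * theta - tau) * (sqD k.+1 w - sqD k.+2 w)
    + 2 * N k by rewrite -NE.
rewrite mulr_sumr; apply: le_trans (ler_sum _ (fun k _ => step k)) _.
rewrite !big_split/= -!mulr_sumr.
rewrite (telescope_ord K (fun k => pop (x k.+1 w))).
rewrite (telescope_ord K (fun k => gapM k.+1 w)) (telescope_ord K (fun k => sqD k.+1 w)).
rewrite lerD2r (mulrDl (1 + beta) c Delta).
have popx0 : pop x0 = 0.
  by rewrite /pop -[RHS](ER_cst Xi 0); congr ER; apply/funext => s; exact: F_x0.
have e1 : pop (x 1%N w) - pop (x K.+1 w) <= Delta.
  by rewrite x_1 popx0 sub0r; apply: Delta_ge; exact: iter_in.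
(* Since z^1 = x0, the first envelope value is at most the normalised loss 0 at x0; the last one is
   at least the infimum of the loss, hence at least - Delta. *)
have e2 : gapM 1 w - gapM K.+1 w <= Delta.
  have g1 : gapM 1 w <= 0.
    apply: le_trans (proj2 (h_prox 1%N w) x0 Xx0) _.
    rewrite /prox_obj /= x_0 x_1 popx0 add0r /extrapolate subrr scaler0 addr0 subrr.
    by rewrite -enorm_sqE enorm0 expr0n mulr0.
  have g2 : - Delta <= gapM K.+1 w.
    apply: (@le_trans _ _ (pop (h K.+1 w))).
      by rewrite lerNl; apply: Delta_ge; exact: proj1 (h_prox K.+1 w).
    by rewrite /gapM /prox_obj lerDl mulr_ge0 ?dot_ge0 ?divr_ge0 ?(ltW rho0).
  by move: g1 g2; move: (gapM 1 w) (gapM K.+1 w) => u v g1 g2; lra.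
have e3 : sqD 1 w - sqD K.+1 w <= 0.
  by rewrite /sqD /= x_0 x_1 subrr -{1}enorm_sqE enorm0 expr0n sub0r oppr_le0 dot_ge0.
have b10 : 0 <= 1 + beta by rewrite addr_ge0.
rewrite -[leRHS]addr0; apply: lerD; last by rewrite mulr_ge0_le0.
by apply: lerD; exact: ler_wpM2l.
Qed.

Lemma sum_bound :
  theta * (rho - theta * lam + nu / 3) * \sum_(k < K) ER P (gap_sq k.+1) <=
  ((1 + beta) + 2 * (s0 * theta ^+ 2 + zeta) / rho) * Delta
  + 2 * (K%:R * (9 / 8 * (L ^+ 2 / (M * s0)))).
Proof.
have bg (k : 'I_K) : bmf (gap_sq k.+1) by have [] := step_expectations k.
have bn (k : 'I_K) : bmf (noise k) by have [] := step_expectations k.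
have en (k : 'I_K) : ER P (noise k) <= 9 / 8 * (L ^+ 2 / (M * s0)).
  by have [] := step_expectations k.
have bsg : bmf (fun w => \sum_(k < K) gap_sq k.+1 w) by exact: bmf_sum.
have bsn : bmf (fun w => \sum_(k < K) noise k w) by exact: bmf_sum.
have := ER_le P (bmfZ _ bsg) (bmfD (bmf_cst _ _) (bmfZ 2 bsn)) path_bound.
rewrite (ER_Z P _ bsg) (ER_D P (bmf_cst _ _) (bmfZ 2 bsn)) (ER_Z P 2 bsn) ER_cst.
rewrite (ER_sum P _ _ bg) (ER_sum P _ _ bn) => /le_trans; apply.
rewrite lerD2l ler_wpM2l//.
apply: le_trans (ler_sum _ (fun k _ => en k)) _.
by rewrite sumr_const card_ord (mulr_natl (9 / 8 * _)).
Qed.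

(** The domain may carry just the sigma-algebra of the samples, from which the random index is
    independent. *)
Lemma bmf_gap_sq dU (U : measurableType dU) (phi : U -> T) (k : 'I_K) :
  (forall k' i, (1 <= k' <= K)%N -> measurable_fun setT (fun u => xi k' i (phi u))) ->
  bmf (fun u => gap_sq k.+1 (phi u)).
Proof.
move=> mk; have kK : (k < K)%N := ltn_ord k.
have [C1 HC1] := iter_bound (leqW (ltnW kK)).
have [C2 HC2] := iter_bound (leqW kK).
pose C := Num.max C1 C2.
have xpC w : enorm (x k w - x0) <= C by rewrite le_max HC1.
have xC w : enorm (x k.+1 w - x0) <= C by rewrite le_max HC2 orbT.
have Xx w : X (x k.+1 w) by apply: iter_in; exact: ltnW.
have mU j : (j <= k.+1)%N -> mvec (fun u => x j (phi u)).
  move=> jk; apply: iter_mvec; first by apply: leq_trans jk _; exact: ltnW.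
  move=> k' i /andP[k'1 k'j]; apply: mk; rewrite k'1/=.
  exact: leq_trans (ltnW (leq_trans k'j jk)) kK.
have mz : mvec (fun u => extrapolate beta theta (x k (phi u)) (x k.+1 (phi u))).
  by apply: mvecD; [exact: mU|apply: mvecZ; apply: mvecB; exact: mU].
have mh : mvec (fun u => h k.+1 (phi u)).
  exact: (mvec_pop_prox rho0 rho_gt mz (fun u => h_prox k.+1 (phi u))).
have dist := prox_extrapolate_dist rho0 Xx xpC xC (h_prox k.+1).
have vh : bvec (fun u => h k.+1 (phi u)
    - extrapolate beta theta (x k (phi u)) (x k.+1 (phi u))).
  exact: (bvecP (mvecB mh mz) (fun u => dist (phi u))).
exact: bmf_dot.
Qed.

End Method.

End Problem.

(** * The random index, and reduction to normalised losses *)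

Section IndependentIndex.
Variables (R : realType) (dT : measure_display) (T : measurableType dT).
Variables (P : probability T R) (kstar : {RV P >-> nat}) (G : set (set T)).
Hypotheses (Gm : G `<=` @measurable _ T) (GI : setI_closed G) (GT : G setT).
Hypothesis indep : independent_systems P
  (preimage_set_system setT kstar measurable) G.

Lemma ER_indep_index (k : nat) (g : T -> R) :
  bmf (g : g_sigma_algebraType G -> R) ->
  ER P (fun w => (kstar w == k)%:R * g w) =
  fine (P (kstar @^-1` [set k])) * ER P g.
Proof.
move=> bg; pose T' := g_sigma_algebraType G.
have GX A B : G A -> measurable B ->
    P (A `&` kstar @^-1` B) = (P A * distribution P kstar B)%E.
  move=> GA mB; rewrite setIC muleC; apply: indep => //.
  by exists B => //; rewrite setTI.
have bi : bmf (fun j : nat => (j == k)%:R : R).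
  by split => //; exists 1 => j; case: eqP; rewrite ?normr1 ?normr0.
have bf : bmf (fun q : T' * nat => (q.2 == k)%:R * g q.1).
  apply: bmfM; first exact: (bmf_comp measurable_snd bi).
  exact: (bmf_comp (measurable_fst : measurable_fun setT (fst : T' * nat -> T')) bg).
rewrite (ER_freeze Gm GI GT (measurable_funPT kstar) GX bf).
have ei : ER (distribution P kstar) (fun j : nat => (j == k)%:R) =
    fine (P (kstar @^-1` [set k])).
  rewrite /ER /Rintegral (_ : (fun j => _) = (fun j => (\1_[set k] j)%:E)).
    by rewrite integral_indic// setIT.
  apply/funext => j; rewrite indicE; congr (_%:R)%:E; congr nat_of_bool.
  by apply/eqP/idP => [->|/set_mem//]; exact/mem_set.
have bg' : bmf g := sub_sigma_bmf Gm bg.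
rewrite -ei -(ER_Z P _ bg'); congr ER; apply/funext => w /=.
under [X in ER _ X]eq_fun do rewrite mulrC.
by rewrite (ER_Z _ _ bi) mulrC.
Qed.

End IndependentIndex.

Lemma is_argmin_shift (V : Type) (R : realType) (X : set V) (g g' : V -> R) (a : R) x :
  (forall u, X u -> g u = g' u + a) -> is_argmin X g x -> is_argmin X g' x.
Proof.
move=> e [Xx xm]; split=> // u Xu.
by rewrite -(lerD2r a) -!e//; exact: xm.
Qed.

Lemma wcx_shift (R : realType) (d : nat) (X : set 'rV[R]_d) c a g :
  wcx X c g -> wcx X c (fun u => g u - a).
Proof.
move=> gc u v t Xu Xv tt; have := gc u v t Xu Xv tt.
move: (g _) (g u) (g v) (c / 2 * _) => e1 e2 e3 e4; lra.
Qed.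

Lemma lipx_shift (R : realType) (d : nat) (X : set 'rV[R]_d) L a g :
  lipx X L g -> lipx X L (fun u => g u - a).
Proof. by move=> gL u v Xu Xv; rewrite opprB addrA subrK; exact: gL. Qed.

Lemma population_shift (R : realType) (d : nat) (dS : measure_display)
    (S : measurableType dS) (Xi : probability S R) (F : 'rV[R]_d -> S -> R) u v :
  Xi.-integrable setT (EFin \o F u) -> Xi.-integrable setT (EFin \o F v) ->
  population Xi F u - population Xi F v = pop Xi (fun x s => F x s - F v s) u.
Proof.
by move=> iu iv; rewrite /population unlock /pop /ER RintegralB.
Qed.

Unset Implicit Arguments.

Theorem theoremB2 (R : realType) (d : nat) (X : set 'rV[R]_d)
    (hX0 : X !=set0) (hXclosed : closed X) (hXconvex : convex_set X)
    (* data distribution, loss and model functions *)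
    (dS : measure_display) (S : measurableType dS) (Xi : probability S R)
    (F : 'rV[R]_d -> S -> R) (fm : 'rV[R]_d -> 'rV[R]_d -> S -> R)
    (lambda tau L mu : R)
    (hlambda : 0 <= lambda) (htau : 0 <= tau) (hL : 0 < L)
    (hmu : mu < lambda + tau)
    (hFint : forall x, X x -> Xi.-integrable setT (EFin \o F x))
    (hfmmeas : forall y, X y ->
       measurable_fun (X `*` setT : set (borel_rV R d * S)%type)
         (fun p : borel_rV R d * S => fm p.1 y p.2))
    (hFcont : forall s, {within X, continuous (fun x => F x s)})
    (hFwc : forall s, weakly_convex_on X mu (fun x => F x s))
    (hFbelow : has_lbound [set population Xi F x | x in X])
    (hmodel_wc : forall s x, X x -> weakly_convex_on X lambda (fun y => fm x y s))
    (hmodel_eq : forall s x, X x -> fm x x s = F x s)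
    (hmodel_quad : forall s x y, X x -> X y ->
       `|fm x y s - F y s| <= tau / 2 * enorm (x - y) ^+ 2)
    (hmodel_lip : forall s x y z, X x -> X y -> X z ->
       fm x z s - fm x y s <= L * enorm (z - y))
    (* parameters *)
    (rho beta theta zeta gamma gamma0 : R) (m K : nat)
    (hm : (1 <= m)%N) (hK : (1 <= K)%N)
    (hrho : 3 * (tau + lambda) < rho) (hrho0 : 0 < rho)
    (hbeta : 0 <= beta < 1) (hgamma0 : 0 < gamma0)
    (htheta : theta = 1 - beta)
    (hzeta : zeta = 2 * theta * (rho + lambda * beta + tau) + tau
                    + 2 * rho * beta ^+ 2 * theta^-1)
    (hgamma : gamma = gamma0 * Num.sqrt (K%:R / m%:R)
                      + theta ^- 2 * zeta + lambda)
    (* samples, random index and iterates on a common probability space *)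
    (dT : measure_display) (T : measurableType dT) (P : probability T R)
    (xi : nat -> 'I_m -> {RV P >-> S})
    (hxi_dist : forall k i, (1 <= k <= K)%N -> forall A, measurable A ->
       distribution P (xi k i) A = Xi A)
    (hxi_indep : mutually_independent P
       (fun p : 'I_K * 'I_m => xi p.1.+1 p.2 : T -> S))
    (kstar : {RV P >-> nat})
    (hkstar_range : forall w, (1 <= kstar w <= K)%N)
    (hkstar_unif : forall k, (1 <= k <= K)%N ->
       P (kstar @^-1` [set k]) = (K%:R^-1)%:E)
    (hkstar_indep : independent_systems P
       (preimage_set_system setT kstar measurable)
       (sigma_of (fun p : 'I_K * 'I_m => xi p.1.+1 p.2 : T -> S)))
    (x0 : 'rV[R]_d) (hx0 : X x0) (x : nat -> T -> 'rV[R]_d)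
    (hx_0 : forall w, x 0%N w = x0) (hx_1 : forall w, x 1%N w = x0)
    (hx : extrapolated_method X fm beta gamma K (fun k i w => xi k i w) x) :
  let f := population Xi F in
  let Delta := f x0 - inf [set f u | u in X] in
  ('E_P[fun w =>
      (enorm (gradient (moreau_env X f rho) (extrap beta x (kstar w) w)) ^+ 2)%R]
   <= (rho / (rho - theta * lambda) *
       (theta^-1 * (rho * beta + 2 * zeta) * Delta / K%:R
        + (theta * gamma0 * Delta + rho * L ^+ 2 / (theta * gamma0))
          * (2 / Num.sqrt (m%:R * K%:R)))%R)%:E)%E.
Proof.
case: m hm hgamma xi hxi_dist hxi_indep hkstar_indep hx => [//|n] _ hgamma xi
  hxi_dist hxi_indep hkstar_indep hx.
cbv zeta; set f := population Xi F; set Delta := f x0 - inf _.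
have Xconv := convex_setP hXconvex.
have [b0 b1] : 0 <= beta /\ beta < 1 by case/andP: hbeta.
have th0 : 0 < theta by rewrite htheta subr_gt0.
(* Subtracting F(x0, s) from loss and models alike shifts each objective by a constant, so
   minimisers and proximal points stay the same. *)
pose Fc u s := F u s - F x0 s.
pose fmc x' u s := fm x' u s - F x0 s.
have F_meas u : X u -> measurable_fun setT (F u).
  by move=> Xu; apply/measurable_EFinP; exact: measurable_int (hFint u Xu).
have Fc_meas u : X u -> measurable_fun setT (Fc u).
  by move=> Xu; apply: measurable_funB; exact: F_meas.
have dist2 (u v : 'rV[R]_d) : enorm (u - v) ^+ 2 = dot (v - u) (v - u).
  by rewrite enormB enorm_sqE.
have quad_le s x' u : X x' -> X u ->
    fm x' u s <= F u s + tau / 2 * dot (u - x') (u - x').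
  move=> Xx Xu; have := hmodel_quad s x' u Xx Xu.
  by rewrite dist2 ler_norml => /andP[_]; rewrite lerBlDl.
have quad_ge s x' u : X x' -> X u ->
    F u s <= fm x' u s + tau / 2 * dot (u - x') (u - x').
  move=> Xx Xu; have := hmodel_quad s x' u Xx Xu.
  by rewrite dist2 ler_norml lerNl opprB lerBlDl => /andP[].
(* The model at [v] is exact at [v] and Lipschitz, with an error at [u] quadratic in the
   distance. *)
have F_lip s : lipx X L (F ^~ s).
  apply: (lipx_of_local Xconv htau) => u v Xu Xv.
  have := hmodel_lip s v v u Xv Xv Xu; rewrite (hmodel_eq s v Xv) => h1.
  have := quad_ge s v u Xv Xu; rewrite -enorm_sqE => h2.
  by rewrite lerBlDl addrA; apply: le_trans h2 _; rewrite lerD2r -lerBlDl.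
have Fc_lip s : lipx X L (Fc ^~ s) by exact: lipx_shift.
have Fc_wcx s : wcx X (lambda + tau) (Fc ^~ s).
  by apply: wcx_shift; apply: wcx_le (ltW hmu) _; exact: wcxP.
have Fc_x0 s : Fc x0 s = 0 by rewrite /Fc subrr.
have fmc_meas y : X y -> measurable_fun (X `*` setT : set (borel_rV R d * S)%type)
    (fun p : borel_rV R d * S => fmc p.1 y p.2).
  move=> Xy; apply: measurable_funB; first exact: hfmmeas.
  by apply: measurable_funTS; exact: measurableT_comp (F_meas _ hx0) measurable_snd.
have fmc_wcx s x' : X x' -> wcx X lambda (fun u => fmc x' u s).
  by move=> Xx; apply: wcx_shift; apply: wcxP; exact: hmodel_wc.
have fmc_lip s x' : X x' -> lipx X L (fun u => fmc x' u s).
  by move=> Xx; apply: lipx_shift => u v Xu Xv; exact: hmodel_lip.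
have fmc_eq s x' : X x' -> fmc x' x' s = Fc x' s.
  by move=> Xx; rewrite /fmc hmodel_eq.
have fmc_le s x' u : X x' -> X u ->
    fmc x' u s <= Fc u s + tau / 2 * dot (u - x') (u - x').
  by move=> Xx Xu; rewrite /Fc addrAC lerD2r; exact: quad_le.
have fmc_ge s x' u : X x' -> X u ->
    Fc u s <= fmc x' u s + tau / 2 * dot (u - x') (u - x').
  by move=> Xx Xu; rewrite /fmc addrAC lerD2r; exact: quad_ge.
pose nu := rho - lambda - tau.
have nu_ge : 2 * (tau + lambda) <= nu by rewrite /nu; lra.
have nu0 : 0 <= nu by lra.
have rho_gt : lambda + tau < rho by lra.
have [q0 zeta0 hpar] := step_parameters hlambda htau hrho0 hbeta htheta erefl nu0 hzeta.
pose q := zeta / theta ^+ 2 - rho / 2 - nu.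
pose s0 := gamma0 * Num.sqrt (K%:R / n.+1%:R).
have a0 : 0 < Num.sqrt (K%:R : R) by rewrite sqrtr_gt0 ltr0n.
have bb0 : 0 < Num.sqrt (n.+1%:R : R) by rewrite sqrtr_gt0 ltr0n.
have s0E : s0 = gamma0 * (Num.sqrt K%:R / Num.sqrt n.+1%:R).
  by rewrite /s0 sqrtrM// sqrtrV.
have s00 : 0 < s0 by rewrite s0E mulr_gt0// divr_gt0.
have gammaE : gamma = s0 + zeta / theta ^+ 2 + lambda.
  by rewrite hgamma (mulrC (theta ^- 2)).
(* [q0] gives zeta / theta^2 >= rho / 2 + nu, and nu >= 2 (tau + lambda). *)
have z2 : lambda <= zeta / theta ^+ 2.
  by move: q0 nu_ge; rewrite -/nu; move: (zeta / theta ^+ 2) => z' h1 h2; lra.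
have gamma_ge : s0 + lambda + lambda <= gamma.
  by rewrite gammaE lerD2r lerD2l.
have lam_gamma : lambda < gamma by rewrite gammaE ltrDr ltr_pwDl// (le_trans hlambda).
have gamma_gt0 : 0 < gamma by exact: le_lt_trans lam_gamma.
have popE u : X u -> f u = pop Xi Fc u + f x0.
  by move=> Xu; rewrite -(population_shift (hFint u Xu) (hFint x0 hx0)) subrK.
have popc_lip : lipx X L (pop Xi Fc) := pop_lipx hx0 Xi Fc_meas Fc_lip Fc_x0.
have popc_wcx : wcx X (lambda + tau) (pop Xi Fc) :=
  pop_wcx hx0 Xconv Xi Fc_meas Fc_lip Fc_wcx Fc_x0.
have f_lip : lipx X L f.
  by move=> u v Xu Xv; rewrite (popE u Xu) (popE v Xv) opprD addrACA subrr addr0; exact: popc_lip.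
have f_wcx : wcx X (lambda + tau) f.
  move=> u v t Xu Xv tt; rewrite (popE u Xu) (popE v Xv) (popE _ (Xconv u v t Xu Xv tt)).
  have := popc_wcx u v t Xu Xv tt.
  by move: (pop _ _ _) (pop _ _ u) (pop _ _ v) (_ / 2 * _) (f x0) => e1 e2 e3 e4 e5; lra.
have x_step k w : (1 <= k <= K)%N ->
    is_prox X (fun u => n.+1%:R^-1 * \sum_(i < n.+1) fmc (x k w) u (xi k i w)) gamma
      (center beta (x k.-1 w) (x k w)) (x k.+1 w).
  move=> kK; apply: (is_argmin_shift
    (a := n.+1%:R^-1 * \sum_(i < n.+1) F x0 (xi k i w))) (hx k w kK) => u Xu.
  rewrite /prox_obj /batch_model enorm_sqE /fmc sumrB mulrBr.
  by rewrite [RHS]addrAC subrK.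
pose z k w := extrapolate beta theta (x k.-1 w) (x k w).
have [h hP] : exists h : nat -> T -> 'rV[R]_d,
    forall k w, is_prox X (pop Xi Fc) rho (z k w) (h k w).
  have ex (p : nat * T) := prox_exists (z p.1 p.2) hX0 hXclosed hrho0 (ltW hL) popc_lip.
  by have [h hP] := choice ex; exists (fun k w => h (k, w)) => k w; exact: (hP (k, w)).
have grad k w : enorm (gradient (moreau_env X f rho) (z k w)) ^+ 2 =
    rho ^+ 2 * gap_sq beta x h theta k w.
  have pf : is_prox X f rho (z k w) (h k w).
    apply: (is_argmin_shift (a := - f x0)) (hP k w) => u Xu.
    by rewrite /prox_obj popE// addrAC addrK.
  rewrite (moreau_env_gradient hX0 hXclosed Xconv (ltW hL) rho_gt hrho0 f_lip f_wcx pf).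
  by rewrite enormZ exprMn real_normK ?num_real// dist2.
have Delta_ge u : X u -> - pop Xi Fc u <= Delta.
  move=> Xu; have -> : pop Xi Fc u = f u - f x0 by rewrite (popE u Xu) addrK.
  by rewrite opprB lerD2l lerN2; apply: ge_inf => //; exists u.
have Delta0 : 0 <= Delta.
  by rewrite /Delta subr_ge0; apply: ge_inf => //; exists x0.
have mxi k i : measurable_fun setT (xi k i : T -> S) by exact: measurable_funPT.
have law k i A : (1 <= k <= K)%N -> measurable A -> P (xi k i @^-1` A) = Xi A.
  by move=> kK mA; exact: (hxi_dist k i kK A mA).
have SB := sum_bound hx0 hXclosed Xconv (ltW hL) hlambda htau Fc_meas Fc_lip Fc_wcx
  Fc_x0 fmc_meas fmc_wcx fmc_lip fmc_eq fmc_le fmc_ge gamma_gt0 lam_gamma mxi law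
  hxi_indep hx_0 hx_1 x_step hP hrho0 hbeta htheta erefl nu_ge s00 zeta0 erefl q0 hpar
  gammaE gamma_ge rho_gt Delta_ge.
pose famX (p : 'I_K * 'I_n.+1) : T -> S := xi p.1.+1 p.2.
have bgap dU (U : measurableType dU) (phi : U -> T) (k : 'I_K) :
    (forall k' i, (1 <= k' <= K)%N -> measurable_fun setT (fun u => xi k' i (phi u))) ->
    bmf (fun u => gap_sq beta x h theta k.+1 (phi u)).
  exact: (bmf_gap_sq hx0 hXclosed Xconv (ltW hL) Fc_meas Fc_lip Fc_wcx
    Fc_x0 fmc_meas fmc_wcx fmc_lip gamma_gt0 lam_gamma hx_0 hx_1 x_step hP hrho0 rho_gt).
have gap_sigma (k : 'I_K) :
    bmf (gap_sq beta x h theta k.+1 : g_sigma_algebraType (sigma_of famX) -> R).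
  apply: (bgap _ (g_sigma_algebraType (sigma_of famX)) (fun w => w)) => -[//|k'] i kK.
  exact: (@sigma_of_measurable_fun _ _ _ _ _ famX (Ordinal (proj2 (andP kK)), i)).
have gapT (k : 'I_K) : bmf (gap_sq beta x h theta k.+1).
  by apply: (bgap _ T (fun w => w)) => k' i _; exact: mxi.
(* Indicators of the random index split the integrand into terms to which its independence applies;
   the ordinal [k] stands for iteration k + 1. *)
pose ind (k : 'I_K) w := (kstar w == k.+1)%:R * gap_sq beta x h theta k.+1 w.
have sigma_meas : sigma_of famX `<=` @measurable _ T.
  by apply: sigma_of_measurable => p; exact: mxi.
have bk (k : 'I_K) : bmf (fun w => (kstar w == k.+1)%:R : R).
  have bi : bmf (fun j : nat => (j == k.+1)%:R : R).
    by split => //; exists 1 => j; case: eqP; rewrite ?normr1 ?normr0.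
  exact: (bmf_comp (measurable_funPT kstar) bi).
have bind k : bmf (ind k) by exact: bmfM.
have indE k : ER P (ind k) = K%:R^-1 * ER P (gap_sq beta x h theta k.+1).
  rewrite /ind (ER_indep_index sigma_meas (@sigma_of_setI _ _ _ _ _ famX)
    (@sigma_of_setT _ _ _ _ _ famX) hkstar_indep _ (gap_sigma k)).
  by rewrite hkstar_unif ?ltn_ord.
have integrandE w :
    enorm (gradient (moreau_env X f rho) (extrap beta x (kstar w) w)) ^+ 2 =
    rho ^+ 2 * \sum_(k < K) ind k w.
  rewrite /extrap -htheta (grad (kstar w) w); congr (_ * _).
  have /andP[k1 kK] := hkstar_range w.
  have kK' : ((kstar w).-1 < K)%N by rewrite prednK.
  rewrite (bigD1 (Ordinal kK'))//= /ind/= prednK// eqxx mul1r big1 ?addr0// => j jk.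
  suff -> : (kstar w == j.+1) = false by rewrite mul0r.
  by apply: contraNF jk => /eqP e; apply/eqP/val_inj; rewrite /= e.
have bsum : bmf (fun w => \sum_(k < K) ind k w) by exact: bmf_sum.
rewrite unlock (_ : (fun w => _) = (fun w => (rho ^+ 2 * \sum_(k < K) ind k w)%:E)).
  rewrite -(ERE P (bmfZ (rho ^+ 2) bsum)) lee_fin (ER_Z P _ bsum) (ER_sum P _ _ bind).
  rewrite (eq_bigr _ (fun k _ => indE k)) -mulr_sumr mulrA.
  have [r1 r2] := rate_arith hlambda htau hrho0 hbeta htheta (erefl nu)
    (ltW hrho) hzeta.
  have thl : theta * lambda <= lambda.
    by rewrite ler_piMl// htheta lerBlDr lerDl.
  have A0 : 0 < rho - theta * lambda by lra.
  have sqK : Num.sqrt K%:R ^+ 2 = K%:R :> R by rewrite sqr_sqrtr.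
  have sqn : Num.sqrt n.+1%:R ^+ 2 = n.+1%:R :> R by rewrite sqr_sqrtr.
  have := final_arith hrho0 b0 th0 A0 (ltW zeta0) hgamma0 a0 bb0 Delta0 s0E r1 r2.
  rewrite sqK sqn => /(_ _ _ SB).
  by rewrite sqrtrM// (mulrC (Num.sqrt n.+1%:R)).
by apply/funext => w; rewrite integrandE.
Qed.
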